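(* Let $\mathcal V$ be a finite set of integers containing both positive and negative integers, let $V(y)=\sum_{v\in\mathcal V}y^v$, let $\mathrm{min}_v=-\min\mathcal V$, and assume that the greatest common divisor of the exponents of the monomials of $y^{\mathrm{min}_v}V(y)$ equals $1$. Let $\bar B(t)=\sum_{n\ge0}b_nt^n$, where $b_n$ is the number of sequences $(v_1,\dots,v_n)\in\mathcal V^n$ with $v_1+\dots+v_n=0$ (bridges). Let $y_1(t),\dots,y_{\mathrm{min}_v}(t)$ be the solutions of $1-tV(y)=0$ that tend to $0$ as $t\to0$, with $y_1(t)$ the branch having real positive Taylor coefficients. Let $\tau$ be the unique positive real number with $V'(\tau)=0$, let $\rho=1/V(\tau)$, and let $\tau_k=y_k(\rho)$ for $k=2,\dots,\mathrm{min}_v$. Then $\bar B(t)$ has near $t=\rho$ a singular expansion of the form $\bar B(t)=a_{-1}(\rho-t)^{-1/2}+a_0+a_1(\rho-t)^{1/2}+a_2(\rho-t)+\cdots$, and its constant term is $$a_0=\frac12\operatorname{Res}_{y=\tau}\frac{1}{y(1-\rho V(y))}+\sum_{k=2}^{\mathrm{min}_v}\operatorname{Res}_{y=\tau_k}\frac{1}{y(1-\rho V(y))}.$$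
   Context: The small branches $y_1,\dots,y_{\mathrm{min}_v}$ are the $\mathrm{min}_v$ algebraic branches of the curve $1-tV(y)=0$ (equivalently $y^{\mathrm{min}_v}=t\,y^{\mathrm{min}_v}V(y)$) satisfying $y(t)\to0$ as $t\to0$; $\rho$ is the radius of convergence of $\bar B(t)$. *)

(* Defs.v *)
From HB Require Import structures.
From mathcomp Require Import all_boot all_order all_algebra finmap.
From mathcomp Require Import all_classical all_reals all_analysis.
From mathcomp Require Import complex.

Set Implicit Arguments.
Unset Strict Implicit.
Unset Printing Implicit Defensive.

Import Order.TTheory GRing.Theory Num.Theory.
Import numFieldNormedType.Exports.

Local Open Scope classical_set_scope.
Local Open Scope ring_scope.
Local Open Scope complex_scope.

Definition stepV (F : unitRingType) (S : {fset int}) (y : F) : F :=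
  \sum_(v <- S) y ^ v.

(* Equals - min S as soon as S contains a negative integer. *)
Definition minv (S : {fset int}) : nat :=
  absz (\big[Num.min/0]_(v <- S) v).

(* When S contains a negative integer, v + minv S >= 0 for all v in S, so these
   absolute values are the exponents of y ^ minv S * stepV S y. *)
Definition shifted (S : {fset int}) (v : int) : nat :=
  absz (v + (minv S)%:Z).

Definition aperiodic (S : {fset int}) : Prop :=
  \big[gcdn/0%N]_(v <- S) shifted S v = 1%N.

Definition bridges (S : {fset int}) (n : nat) : nat :=
  #|[pred w : n.-tuple S | \sum_(i < n) val (tnth w i) == 0]|.

Definition bridge_gf (K : numFieldType) (S : {fset int}) (t : K) : K :=
  limn (series (fun n => (bridges S n)%:R * t ^+ n)).

(* The polynomial y ^ minv S * (1 - t * stepV S y). *)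
Definition kernel_poly (F : fieldType) (S : {fset int}) (t : F) : {poly F} :=
  'X^(minv S) - t *: \sum_(v <- S) 'X^(shifted S v).

(* The small branches y 1, ..., y (minv S), followed along the real segment
   ]0, rho].  The divisibility condition says that they are distinct branches,
   i.e., that they enumerate roots of the kernel with multiplicity: distinct
   branches may meet at isolated points of the segment, and continuity alone
   would then allow two of the functions to follow the same branch. *)
Definition small_branches (R : realType) (S : {fset int}) (rho : R)
    (y : nat -> R -> R[i]) : Prop :=
  [/\ forall k, (1 <= k <= minv S)%N ->
        {within `]0, rho], continuous (y k : R -> (R[i])^o)},
      forall k, (1 <= k <= minv S)%N ->
        (y k : R -> (R[i])^o) t @[t --> 0^'+] --> (0 : (R[i])^o),
      forall k (t : R), (1 <= k <= minv S)%N -> 0 < t <= rho ->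
        y k t != 0 /\ 1 - t%:C * stepV S (y k t) = 0
    & forall t : R, 0 < t <= rho ->
        \prod_(1 <= k < (minv S).+1) ('X - (y k t)%:P) %| kernel_poly S t%:C].

(* The branch y 1 is the one that is real and positive for small t > 0.  Any
   branch whose expansion in powers of t ^ (1 / minv S) has nonnegative real
   coefficients is of this kind, but such nonnegativity may fail: for
   S = {-2, -1, 3} the positive small branch has a negative coefficient at
   t ^ (5 / 2). *)
Definition principal_first (R : realType) (y : nat -> R -> R[i]) : Prop :=
  \forall t \near 0^'+, 0 < y 1%N t.

(* c is the coefficient of (y - z) ^ -1 in a Laurent expansion
   f y = \sum_n u n * (y - z) ^ (n - m), valid in a punctured disc around z. *)
Definition is_residue (K : numFieldType) (f : K -> K) (z c : K) : Prop :=
  exists (m : nat) (u : nat -> K),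
    (exists2 r : K, 0 < r & forall y : K, 0 < `|y - z| < r ->
       series (fun n => u n * (y - z) ^ (n%:Z - m%:Z)) @ \oo --> f y)
    /\ c = if m is m'.+1 then u m' else 0.

Definition residue (K : numFieldType) (f : K -> K) (z : K) : K :=
  xget 0 [set c | is_residue f z c].

(* f t = a (-1) * (rho - t) ^ (-1/2) + a 0 + a 1 * (rho - t) ^ (1/2) + ... for
   t in the disc `|t| < rho close to rho; there Re (rho - t) > 0, and sqrtc is
   the principal determination of the square root (Re >= 0), unlike sqrtC. *)
Definition sqrt_expansion (R : realType) (f : R[i] -> R[i]) (rho : R)
    (a : int -> R[i]) : Prop :=
  exists2 r : R, 0 < r &
    forall t : R[i], `|t| < rho%:C -> `|t - rho%:C| < r%:C ->
      series (fun n : nat => a (n%:Z - 1) * sqrtc (rho%:C - t) ^ (n%:Z - 1)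
                : (R[i])^o) @ \oo --> (f t : (R[i])^o).

(* Main.v *)
Require Import Defs.
From HB Require Import structures.
From mathcomp Require Import all_boot all_order all_algebra finmap.
From mathcomp Require Import all_classical all_reals all_analysis.
From mathcomp Require Import cyclic separable cyclotomic complex.
From mathcomp Require Import ring lra zify.
Set Implicit Arguments.
Unset Strict Implicit.
Unset Printing Implicit Defensive.

Import Order.TTheory GRing.Theory Num.Theory.
Import numFieldNormedType.Exports.
Local Open Scope classical_set_scope.
Local Open Scope ring_scope.
Local Open Scope complex_scope.

(** Write [P_t = y^m (1 - t V)], [m = minv S], and [Q = y^m V].  On the circle
    [|y| = tau] the geometric series shows that the bridge series is the mean of
    [y^m / P_t], hence, for [|t| < rho], the sum of the residues of
    [y^(m-1) / P_t] at the roots of [P_t] in the disc [|y| < tau].  As [t] tends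
    to [rho] exactly one of these roots reaches the circle, and it does so at
    [tau], where [P_rho = - (y - tau)^2 H].  The residues at the other roots are
    the mean over a slightly smaller circle, which is analytic in [t].  For the
    remaining root put [s = sqrt (rho - t)] and [y = tau + s x]: then
    [P_t = s^2 (Q - x^2 H)], and [s] times its residue is a mean over a fixed
    circle in [x] around [- sqrt (Q / H)(tau)], which is analytic in [s].  The
    coefficient of [s] is the mean of a function odd in [x], so that it is half
    the sum of its residues in [x], i.e. half of the residue at [tau].

    Contour integrals are taken as limits of averages over roots of unity, and
    Cauchy's formula is only needed for rational functions, where it follows
    from partial fractions.  The small branches fill the disc [|y| < tau] because
    the argument principle counts [m] roots of [P_t] in it for [0 < t < rho]. *)

(** The branches are only continuous functions on the real segment, while the expansion is needed
    for complex [t]. Hence the analysis near [rho] speaks of the roots in the disc and never of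
    branches; these serve only to name the inner roots of [P_rho]. For [t < rho] no root lies on the
    circle, so a branch that starts at 0 stays inside, and the divisibility condition makes the
    branches exhaust the [m] inner roots. Positive roots below [tau] are simple, so [y 1] cannot
    leave the real axis (its conjugate would be a second nearby root) and must end at [tau], the
    only positive root of [P_rho]. Another branch reaching the circle would, by aperiodicity, also
    end at [tau], and would provide a second inner root close to [tau], which the local analysis
    forbids.

    The sign in [- sqrt (Q / H)(tau)] comes from [|t| < rho]: then [Re (rho - t) > 0], so [s] lies
    in a sector around the positive axis, and of the two roots near [tau + s xi] and [tau - s xi],
    with [xi = sqrt (Q / H)(tau)], only the second is in the disc. *)

Section Modulus.
Variable R : realType.
Implicit Types (z w : R[i]).

(** The norm of [R[i]] takes its values in [R[i]], whose order is partial. This real-valued copy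
    lets [lra] and [nra] handle the estimates. *)
Definition modc (z : R[i]) : R := complex.Re `|z|.

Lemma modcE z : (modc z)%:C = `|z|.
Proof. by rewrite RRe_real // normr_real. Qed.

Lemma modc_ge0 z : 0 <= modc z.
Proof. by rewrite -lecR modcE normr_ge0. Qed.

Lemma modc0 : modc 0 = 0.
Proof. by apply: complexI; rewrite modcE normr0. Qed.

Lemma modc1 : modc 1 = 1.
Proof. by apply: complexI; rewrite modcE normr1. Qed.

Lemma modc_eq0 z : (modc z == 0) = (z == 0).
Proof. by rewrite -(inj_eq (@complexI R)) modcE normr_eq0. Qed.

Lemma modc_gt0 z : (0 < modc z) = (z != 0).
Proof. by rewrite lt_neqAle modc_ge0 andbT eq_sym modc_eq0. Qed.

Lemma modcM z w : modc (z * w) = modc z * modc w.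
Proof. by apply: complexI; rewrite rmorphM /= !modcE normrM. Qed.

Lemma modcN z : modc (- z) = modc z.
Proof. by apply: complexI; rewrite !modcE normrN. Qed.

Lemma modcB z w : modc (z - w) = modc (w - z).
Proof. by rewrite -modcN opprB. Qed.

Lemma modcV z : modc z^-1 = (modc z)^-1.
Proof. by apply: complexI; rewrite fmorphV /= !modcE normfV. Qed.

Lemma modcX z n : modc (z ^+ n) = modc z ^+ n.
Proof. by apply: complexI; rewrite rmorphXn /= !modcE normrX. Qed.

Lemma ler_modcD z w : modc (z + w) <= modc z + modc w.
Proof. by rewrite -lecR rmorphD /= !modcE ler_normD. Qed.

Lemma ler_modcB z w : modc (z - w) <= modc z + modc w.
Proof. by rewrite (le_trans (ler_modcD _ _)) // modcN. Qed.

Lemma ler_modcDB z w : modc z - modc w <= modc (z + w).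
Proof.
rewrite lerBlDr; apply: le_trans (ler_modcB (z + w) w).
by rewrite addrK.
Qed.

Lemma modc_real (x : R) : 0 <= x -> modc x%:C = x.
Proof. by move=> x0; apply: complexI; rewrite modcE ger0_norm // ler0c. Qed.

Lemma modc_sum (I : Type) (r : seq I) (P : pred I) (F : I -> R[i]) :
  modc (\sum_(i <- r | P i) F i) <= \sum_(i <- r | P i) modc (F i).
Proof.
elim/big_rec2: _ => [|i x y _ h]; first by rewrite modc0.
by rewrite (le_trans (ler_modcD _ _)) // lerD2l.
Qed.

Lemma modc_prod (I : Type) (r : seq I) (P : pred I) (F : I -> R[i]) :
  modc (\prod_(i <- r | P i) F i) = \prod_(i <- r | P i) modc (F i).
Proof. by elim/big_rec2: _ => [|i x y _ h]; rewrite ?modc1 // modcM h. Qed.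

Lemma modc_Re2Im2 z : modc z ^+ 2 = complex.Re z ^+ 2 + complex.Im z ^+ 2.
Proof. by apply: complexI; rewrite rmorphXn /= modcE add_Re2_Im2. Qed.

Lemma Re_le_modc z : `|complex.Re z| <= modc z.
Proof. by rewrite -lecR modcE normc_ge_Re. Qed.

Lemma le0_of_eps (x : R) : (forall e : R, 0 < e -> x <= e) -> x <= 0.
Proof.
move=> h; rewrite leNgt; apply/negP => x0.
by have := h (x / 2) (divr_gt0 x0 (ltr0Sn _ _)); lra.
Qed.

Lemma modc_eps z : (forall e : R, 0 < e -> modc z <= e) -> z = 0.
Proof.
by move=> /le0_of_eps h; apply/eqP; rewrite -modc_eq0 eq_le h modc_ge0.
Qed.

Lemma geometric_small (C th e : R) : 0 <= C -> 0 <= th < 1 -> 0 < e ->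
  exists k0, forall k, (k0 <= k)%N -> C * th ^+ k <= e.
Proof.
move=> C0 /andP[th0 th1] e0.
have /cvgrPdist_le h : (C * th ^+ k) @[k --> \oo] --> (C * 0 : R).
  by apply: cvgMr; apply: cvg_expr; rewrite ger0_norm.
have [k0 _ hk] := h e e0; exists k0 => k /hk /=.
by rewrite mulr0 sub0r normrN ger0_norm // mulr_ge0 ?exprn_ge0.
Qed.

Lemma cvg_modcP (u : nat -> (R[i])^o) (l : (R[i])^o) :
  (forall e : R, 0 < e ->
     exists k0, forall k, (k0 <= k)%N -> modc (l - u k) <= e) <->
  u @ \oo --> l.
Proof.
split=> [h|/cvgrPdist_le h e e0].
  apply/cvgrPdist_le => e; rewrite ltcE => /andP[/eqP ei e0].
  have [k0 hk] := h _ e0; exists k0 => // k /hk /=.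
  by rewrite -modcE lecE /= ei eqxx.
have [|k0 _ hk] := h e%:C; first by rewrite ltcR.
by exists k0 => k /hk /=; rewrite -modcE lecR.
Qed.

Lemma series_geometric_cvg (v : nat -> R[i]) (l : R[i]) (C th : R) :
  0 <= C -> 0 <= th < 1 ->
  (forall k, modc (l - \sum_(0 <= n < k) v n) <= C * th ^+ k) ->
  series (v : nat -> (R[i])^o) @ \oo --> (l : (R[i])^o).
Proof.
move=> C0 th01 h; apply/cvg_modcP => e e0.
have [k0 hk] := geometric_small C0 th01 e0.
by exists k0 => k kk; apply: le_trans (h k) (hk k kk).
Qed.

End Modulus.

(** * Means over the unit circle as limits of averages over roots of unity *)

Section CircleMean.
Variable R : realType.
Implicit Types (g h : R[i] -> R[i]) (v w : R[i]).

Lemma prim_root_complex n : (0 < n)%N -> {w : R[i] | n.-primitive_root w}.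
Proof.
pose p : {poly R[i]} := 'X^n - 1; have [r Dp] := closed_field_poly_normal p.
move=> n_gt0; apply/sigW; rewrite (monicP _) ?monicXnsubC // scale1r in Dp.
have rn1 : all n.-unity_root r by apply/allP=> z; rewrite -root_prod_XsubC -Dp.
have sz_r : (n < (size r).+1)%N.
  by rewrite -(size_prod_XsubC r id) -Dp size_XnsubC.
have [|z] := hasP (has_prim_root n_gt0 rn1 _ sz_r); last by exists z.
by rewrite -separable_prod_XsubC -Dp separable_Xn_sub_1 // pnatr_eq0 -lt0n.
Qed.

Definition unity_gen n : R[i] := sval (prim_root_complex (ltn0Sn n)).

Definition avg n g : R[i] :=
  n.+1%:R^-1 * \sum_(j < n.+1) g (unity_gen n ^+ j).

(* [umean g v]: the mean of [g] over the unit circle, taken as the limit of the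
   averages over roots of unity, is [v]. *)
Definition umean g v : Prop := forall e : R, 0 < e ->
  exists n0, forall n, (n0 <= n)%N -> modc (v - avg n g) <= e.

Lemma modc_unity_gen n j : modc (unity_gen n ^+ j) = 1.
Proof.
have h : modc (unity_gen n) = 1.
  apply/eqP; rewrite -(@pexpr_eq1 _ _ n.+1) ?modc_ge0 // -modcX.
  by rewrite (prim_expr_order (svalP (prim_root_complex _))) modc1.
by rewrite modcX h expr1n.
Qed.

Lemma eq_avg n g h : (forall u, modc u = 1 -> g u = h u) -> avg n g = avg n h.
Proof.
by move=> gh; congr (_ * _); apply: eq_bigr => j _; rewrite gh ?modc_unity_gen.
Qed.

Lemma modc_nat (n : nat) : modc (n%:R : R[i]) = n%:R.
Proof. by rewrite -(rmorph_nat (real_complex R)) modc_real ?ler0n. Qed.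

Lemma modc_avg n g (C : R) : (forall u, modc u = 1 -> modc (g u) <= C) ->
  modc (avg n g) <= C.
Proof.
move=> h; rewrite modcM modcV modc_nat.
rewrite ler_pdivrMl ?ltr0Sn //; apply: le_trans (modc_sum _ _ _) _.
have -> : n.+1%:R * C = \sum_(i < n.+1) C.
  by rewrite sumr_const card_ord mulr_natl.
by apply: ler_sum => i _; rewrite h ?modc_unity_gen.
Qed.

Lemma avgB n g h : avg n (fun u => g u - h u) = avg n g - avg n h.
Proof. by rewrite /avg sumrB mulrBr. Qed.

Lemma eq_umean g h v : (forall u, modc u = 1 -> g u = h u) ->
  umean g v -> umean h v.
Proof.
move=> gh gv e /gv[n0 hn]; exists n0 => n /hn.
by rewrite (eq_avg n gh).
Qed.

Lemma umean_unique g v w : umean g v -> umean g w -> v = w.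
Proof.
move=> gv gw; apply/eqP; rewrite -subr_eq0; apply/eqP/modc_eps => e e0.
have [n1 h1] := gv (e / 2) (divr_gt0 e0 (ltr0Sn _ _)).
have [n2 h2] := gw (e / 2) (divr_gt0 e0 (ltr0Sn _ _)).
pose n := maxn n1 n2.
have -> : v - w = (v - avg n g) - (w - avg n g) by ring.
apply: le_trans (ler_modcB _ _) _.
have := h1 n (leq_maxl _ _); have := h2 n (leq_maxr _ _); lra.
Qed.

Lemma umeanD g h v w : umean g v -> umean h w ->
  umean (fun u => g u + h u) (v + w).
Proof.
move=> gv hw e e0.
have [n1 h1] := gv (e / 2) (divr_gt0 e0 (ltr0Sn _ _)).
have [n2 h2] := hw (e / 2) (divr_gt0 e0 (ltr0Sn _ _)).
exists (maxn n1 n2) => n; rewrite geq_max => /andP[/h1 l1 /h2 l2].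
have -> : v + w - avg n (fun u => g u + h u) = (v - avg n g) + (w - avg n h).
  by rewrite /avg big_split /=; ring.
by apply: le_trans (ler_modcD _ _) _; lra.
Qed.

Lemma umeanZ (c : R[i]) g v : umean g v -> umean (fun u => c * g u) (c * v).
Proof.
move=> gv e e0.
have c0 : 0 < modc c + 1 by rewrite ltr_wpDl ?modc_ge0.
have [n0 h] := gv (e / (modc c + 1)) (divr_gt0 e0 c0).
exists n0 => n /h; rewrite ler_pdivlMr // => h'.
have -> : c * v - avg n (fun u => c * g u) = c * (v - avg n g).
  by rewrite /avg -mulr_sumr; ring.
rewrite modcM; apply: le_trans h'; rewrite mulrC ler_wpM2l ?modc_ge0 //.
by rewrite lerDl.
Qed.

Lemma umeanB g h v w : umean g v -> umean h w ->
  umean (fun u => g u - h u) (v - w).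
Proof.
move=> gv hw; have := umeanD gv (umeanZ (-1) hw).
by rewrite mulN1r; apply: eq_umean => u _; rewrite mulN1r.
Qed.

Lemma umean_cst c : umean (fun=> c) c.
Proof.
move=> e e0; exists 0%N => n _.
rewrite /avg sumr_const card_ord -[c *+ _]mulr_natl mulKf ?pnatr_eq0 //.
by rewrite subrr modc0 ltW.
Qed.

Lemma umean_sum (I : Type) (r : seq I) (P : pred I)
    (g : I -> R[i] -> R[i]) (v : I -> R[i]) :
  (forall i, P i -> umean (g i) (v i)) ->
  umean (fun u => \sum_(i <- r | P i) g i u) (\sum_(i <- r | P i) v i).
Proof.
move=> h; elim: r => [|i r ih].
  by rewrite big_nil; apply: eq_umean (umean_cst 0) => u _; rewrite big_nil.
rewrite big_cons; case: ifP => Pi.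
  by apply: eq_umean (umeanD (h _ Pi) ih) => u _; rewrite big_cons Pi.
by apply: eq_umean ih => u _; rewrite big_cons Pi.
Qed.

(** An average never exceeds the supremum on the circle, so means pass to uniform limits. Both the
    approximant and its mean may depend on [e]. *)
Lemma umean_approx g v :
  (forall e : R, 0 < e -> exists h w, [/\ umean h w,
     modc (v - w) <= e & forall u, modc u = 1 -> modc (g u - h u) <= e]) ->
  umean g v.
Proof.
move=> H e e0; have e3 : 0 < e / 3 by rewrite divr_gt0.
have [h [w [hw vw gh]]] := H _ e3; have [n0 hn] := hw _ e3.
exists n0 => n /hn l.
have -> : v - avg n g = (v - w) + (w - avg n h) - (avg n g - avg n h) by ring.
rewrite -avgB; have := modc_avg n gh.
have := ler_modcB (v - w + (w - avg n h)) (avg n (fun u => g u - h u)).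
have := ler_modcD (v - w) (w - avg n h); lra.
Qed.

Lemma umean_bound g v C : (forall u, modc u = 1 -> modc (g u) <= C) ->
  umean g v -> modc v <= C.
Proof.
move=> gC gv; rewrite -subr_le0; apply: le0_of_eps => e /gv[n0 /(_ n0 (leqnn _)) h].
have := modc_avg n0 gC; have := ler_modcD (v - avg n0 g) (avg n0 g).
by rewrite subrK; lra.
Qed.

(** As soon as [n >= k], the number [w ^+ k] is a root of unity other than 1 and its geometric sum
    vanishes: the averages are eventually equal to 0, not merely small. *)
Lemma umeanX k : (0 < k)%N -> umean (fun u => u ^+ k) 0.
Proof.
move=> k0 e e0; exists k => n kn; rewrite sub0r modcN.
suff -> : avg n (fun u => u ^+ k) = 0 by rewrite modc0 ltW.
rewrite /avg; set w := unity_gen n.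
have pw : n.+1.-primitive_root w by apply: (svalP (prim_root_complex _)).
have wk : w ^+ k != 1.
  by rewrite -(prim_order_dvd pw) gtnNdvd // ltnS.
apply/eqP; rewrite mulf_eq0; apply/orP; right.
have : (w ^+ k - 1) * \sum_(j < n.+1) (w ^+ j) ^+ k = 0.
  under eq_bigr do rewrite exprAC.
  by rewrite -subrX1 exprAC (prim_expr_order pw) expr1n subrr.
by move/eqP; rewrite mulf_eq0 subr_eq0 (negbTE wk).
Qed.

Lemma umeanVX k : (0 < k)%N -> umean (fun u => u^-1 ^+ k) 0.
Proof.
move=> k0 e e0; exists k => n kn; rewrite sub0r modcN.
suff -> : avg n (fun u => u^-1 ^+ k) = 0 by rewrite modc0 ltW.
rewrite /avg; set w := unity_gen n.
have pw : n.+1.-primitive_root w by apply: (svalP (prim_root_complex _)).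
have wk : w ^+ k != 1.
  by rewrite -(prim_order_dvd pw) gtnNdvd // ltnS.
apply/eqP; rewrite mulf_eq0; apply/orP; right.
have : (w^-1 ^+ k - 1) * \sum_(j < n.+1) (w ^+ j)^-1 ^+ k = 0.
  under eq_bigr do rewrite -exprVn exprAC.
  by rewrite -subrX1 exprAC exprVn (prim_expr_order pw) invr1 expr1n subrr.
by move/eqP; rewrite mulf_eq0 subr_eq0 exprVn invr_eq1 (negbTE wk).
Qed.

Lemma umean_poly (p : {poly R[i]}) : umean (fun u => p.[u]) p`_0.
Proof.
have -> : p`_0 = \sum_(i < size p) (p`_i * (i == 0%N :> nat)%:R).
  case: (posnP (size p)) => [/eqP|sp].
    by rewrite size_poly_eq0 => /eqP ->; rewrite size_poly0 big_ord0 coef0.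
  rewrite (bigD1 (Ordinal sp)) //= mulr1 big1 ?addr0 // => i.
  by rewrite -val_eqE /= => /negbTE ->; rewrite mulr0.
apply: eq_umean => [u _|]; first by rewrite horner_coef.
apply: umean_sum => i _; apply: umeanZ.
case: (posnP i) => [->|i0]; last exact: umeanX.
by apply: eq_umean (umean_cst 1) => u _; rewrite expr0.
Qed.

Lemma umean_polyV (p : {poly R[i]}) : umean (fun u => p.[u^-1]) p`_0.
Proof.
have -> : p`_0 = \sum_(i < size p) (p`_i * (i == 0%N :> nat)%:R).
  case: (posnP (size p)) => [/eqP|sp].
    by rewrite size_poly_eq0 => /eqP ->; rewrite size_poly0 big_ord0 coef0.
  rewrite (bigD1 (Ordinal sp)) //= mulr1 big1 ?addr0 // => i.
  by rewrite -val_eqE /= => /negbTE ->; rewrite mulr0.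
apply: eq_umean => [u _|]; first by rewrite horner_coef.
apply: umean_sum => i _; apply: umeanZ.
case: (posnP i) => [->|i0]; last exact: umeanVX.
by apply: eq_umean (umean_cst 1) => u _; rewrite expr0.
Qed.

(** Integration term by term. The geometric bound on the remainder is uniform on the circle, so
    [umean_bound] carries it over to the means. *)
Lemma umean_series (f : R[i] -> R[i]) (kap : nat -> R[i] -> R[i])
    (v : nat -> R[i]) (l : R[i]) (C th : R) :
  0 <= C -> 0 <= th < 1 ->
  (forall k u, modc u = 1 ->
     modc (f u - \sum_(0 <= n < k) kap n u) <= C * th ^+ k) ->
  (forall n, umean (kap n) (v n)) -> umean f l ->
  series (v : nat -> (R[i])^o) @ \oo --> (l : (R[i])^o).
Proof.
move=> C0 th01 h kv fl; apply: (@series_geometric_cvg _ _ _ C th) => // k.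
apply: umean_bound (h k) _; apply: umeanB fl _.
exact: umean_sum.
Qed.

End CircleMean.

(** * Cauchy's formula for rational functions by partial fractions *)

Section CauchyFormula.
Variable R : realType.
Implicit Types (g h : R[i] -> R[i]) (v w : R[i]).

(** Plays the part of an analytic extension of [g] to the disc with value [v] at the centre. *)
Definition papprox g v := forall e : R, 0 < e -> exists p : {poly R[i]},
  p`_0 = v /\ forall u, modc u = 1 -> modc (g u - p.[u]) <= e.

Lemma modc_poly (p : {poly R[i]}) : exists2 C : R, 0 <= C &
  forall u, modc u = 1 -> modc p.[u] <= C.
Proof.
exists (\sum_(i < size p) modc p`_i); first by rewrite sumr_ge0 // => i _; apply: modc_ge0.
move=> u u1; rewrite horner_coef; apply: le_trans (modc_sum _ _ _) _.
by apply: ler_sum => i _; rewrite modcM modcX u1 expr1n mulr1.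
Qed.

Lemma papprox_bounded g v : papprox g v ->
  exists2 C : R, 0 <= C & forall u, modc u = 1 -> modc (g u) <= C.
Proof.
move=> /(_ 1 ltr01) [p [_ h]]; have [C C0 hC] := modc_poly p.
exists (1 + C) => [|u u1]; first lra.
have := ler_modcD (g u - p.[u]) p.[u]; rewrite subrK.
by have := h u u1; have := hC u u1; lra.
Qed.

Lemma papproxM g h v w : papprox g v -> papprox h w ->
  papprox (fun u => g u * h u) (v * w).
Proof.
move=> gv hw e e0.
have [Cg Cg0 hCg] := papprox_bounded gv; have [Ch Ch0 hCh] := papprox_bounded hw.
pose e1 := e / 2 / (Ch + 1); pose e2 := Num.min 1 (e / 2 / (Cg + 1)).
have e10 : 0 < e1 by rewrite !divr_gt0 //; lra.
have e20 : 0 < e2 by rewrite lt_min ltr01 !divr_gt0 //; lra.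
have [p [p0 hp]] := gv _ e10; have [q [q0 hq]] := hw _ e20.
exists (p * q); split; first by rewrite coefM big_ord1 subnn p0 q0.
move=> u u1; rewrite hornerM.
have -> : g u * h u - p.[u] * q.[u] = g u * (h u - q.[u]) + (g u - p.[u]) * q.[u] by ring.
apply: le_trans (ler_modcD _ _) _; rewrite !modcM.
have qb : modc q.[u] <= Ch + 1.
  have := ler_modcB (h u) (h u - q.[u]); rewrite opprB addrC subrK.
  have := hq u u1; have := hCh u u1.
  have : e2 <= 1 by rewrite ge_min lexx.
  lra.
have t1 : modc (g u) * modc (h u - q.[u]) <= e / 2.
  apply: (@le_trans _ _ ((Cg + 1) * (e / 2 / (Cg + 1)))); last by rewrite mulrC divfK //; lra.
  apply: ler_pM; rewrite ?modc_ge0 //; first by have := hCg u u1; lra.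
  by apply: le_trans (hq u u1) _; rewrite ge_min lexx orbT.
have t2 : modc (g u - p.[u]) * modc q.[u] <= e / 2.
  apply: (@le_trans _ _ (e / 2 / (Ch + 1) * (Ch + 1))); last by rewrite divfK //; lra.
  by apply: ler_pM; rewrite ?modc_ge0 //; apply: hp.
lra.
Qed.

Lemma papproxX g n : papprox g 1 -> papprox (fun u => g u ^+ n) 1.
Proof.
move=> g1; elim: n => [|n ih] e e0.
  by exists 1; split=> [|u _]; rewrite ?coef1 // expr0 hornerE subrr modc0 ltW.
have [p [p0 hp]] := papproxM g1 ih e0; exists p; rewrite p0 mulr1; split=> // u u1.
by rewrite exprS hp.
Qed.

Lemma papprox_geometric (a : R[i]) : modc a < 1 ->
  papprox (fun u => (1 - a * u)^-1) 1.
Proof.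
move=> a1 e e0; have a0 := modc_ge0 a.
have a10 : 0 <= (1 - modc a)^-1 by rewrite invr_ge0; lra.
have a01 : 0 <= modc a < 1 by rewrite a0.
have [k0 hk] := geometric_small a10 a01 e0.
exists (\sum_(i < k0.+1) (a ^+ i) *: 'X^i); split=> [|u u1].
  rewrite big_ord_recl coefD coefZ coefXn expr0 mul1r coef_sum big1 ?addr0 // => i _.
  by rewrite coefZ coefXn mulr0.
have nz : 1 - a * u != 0.
  rewrite -modc_gt0; have := ler_modcDB 1 (- (a * u)).
  by rewrite modc1 modcN modcM u1; lra.
have -> : (1 - a * u)^-1 - (\sum_(i < k0.+1) (a ^+ i) *: 'X^i).[u] =
          (1 - a * u)^-1 * (a * u) ^+ k0.+1.
  apply: (mulfI nz); rewrite mulrBr mulVKf // divff // horner_sum.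
  under eq_bigr do rewrite hornerZ hornerXn -exprMn.
  by rewrite -[1 - a * u]opprB mulNr -subrX1; ring.
rewrite modcM modcV modcX modcM u1 mulr1; apply: le_trans (hk k0.+1 (leqnSn _)).
rewrite ler_wpM2r ?exprn_ge0 // lef_pV2 ?posrE ?modc_gt0 //; last lra.
by have := ler_modcDB 1 (- (a * u)); rewrite modc1 modcN modcM u1; lra.
Qed.

Lemma papprox_umean g v : papprox g v -> umean g v.
Proof.
move=> gv; apply: umean_approx => e /gv[p [p0 hp]].
exists (fun u => p.[u]), v; split=> //; first by rewrite -p0; apply: umean_poly.
by rewrite subrr modc0 (le_trans (modc_ge0 (g 1 - p.[1]))) ?hp ?modc1.
Qed.

Lemma papprox_umeanV g v : papprox g v -> umean (fun u => g u^-1) v.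
Proof.
move=> gv; apply: umean_approx => e /gv[p [p0 hp]].
exists (fun u => p.[u^-1]), v; split=> //; first by rewrite -p0; apply: umean_polyV.
  by rewrite subrr modc0 (le_trans (modc_ge0 (g 1 - p.[1]))) ?hp ?modc1.
by move=> u u1; rewrite hp // modcV u1 invr1.
Qed.

Lemma umean_polX g v k : papprox g v -> (0 < k)%N -> umean (fun u => u ^+ k * g u) 0.
Proof.
move=> gv k0; rewrite -(mul0r v); apply: papprox_umean; apply: papproxM gv => e e0.
exists 'X^k; split=> [|u _]; first by rewrite coefXn eq_sym gtn_eqF.
by rewrite hornerXn subrr modc0 ltW.
Qed.

Lemma umean_polXV g v k : papprox g v -> (0 < k)%N ->
  umean (fun u => u^-1 ^+ k * g u^-1) 0.
Proof.
move=> gv k0; rewrite -(mul0r v).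
apply: (@papprox_umeanV (fun u => u ^+ k * g u)); apply: papproxM gv => e e0.
exists 'X^k; split=> [|u _]; first by rewrite coefXn eq_sym gtn_eqF.
by rewrite hornerXn subrr modc0 ltW.
Qed.

Lemma modc1_neq0 (u : R[i]) : modc u = 1 -> u != 0.
Proof. by move=> u1; rewrite -modc_gt0 u1. Qed.

(** The pole is inside the circle, so [(c + d u - z)^-1] is [(d u)^-1] times a power series in
    [u^-1]. For [n = 0] the factor [d u] cancels exactly; otherwise a power of [u^-1] is left over
    and the mean is 0. *)
Lemma umean_pole_in (c d z : R[i]) n : modc (z - c) < modc d ->
  umean (fun u => d * u / (c + d * u - z) ^+ n.+1) (n == 0%N)%:R.
Proof.
move=> zcd; have d0 : d != 0 by rewrite -modc_gt0 (le_lt_trans (modc_ge0 _) zcd).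
have a1 : modc ((z - c) / d) < 1.
  by rewrite modcM modcV ltr_pdivrMr ?modc_gt0 // mul1r.
have pa := papproxX n.+1 (papprox_geometric a1).
have E u : modc u = 1 -> d * u / (c + d * u - z) ^+ n.+1 =
   d^-1 ^+ n * (u^-1 ^+ n * (1 - (z - c) / d * u^-1)^-1 ^+ n.+1).
  move=> u1; have u0 := modc1_neq0 u1.
  have -> : c + d * u - z = d * u * (1 - (z - c) / d * u^-1) by field; rewrite u0 d0.
  rewrite [in LHS]exprMn invfM exprVn [in LHS]exprS invfM !exprMn !mulrA.
  by rewrite divff ?mulf_neq0 // mul1r invfM !exprVn.
case: n pa E => [|n] pa E.
  apply: eq_umean (papprox_umeanV pa) => u u1.
  by rewrite E // !expr0 !mul1r.
rewrite -[_%:R](mulr0 (d^-1 ^+ n.+1)).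
apply: eq_umean (umeanZ _ (umean_polXV pa (ltn0Sn n))) => u u1.
by rewrite E.
Qed.

(** The pole is outside the circle, so the quotient expands in powers of [u], and the factor [u] of
    the numerator removes the constant term. *)
Lemma umean_pole_out (c d z : R[i]) n : modc d < modc (z - c) ->
  umean (fun u => d * u / (c + d * u - z) ^+ n.+1) 0.
Proof.
move=> zcd; have w0 : z - c != 0 by rewrite -modc_gt0 (le_lt_trans (modc_ge0 _) zcd).
have a1 : modc (d / (z - c)) < 1.
  by rewrite modcM modcV ltr_pdivrMr ?modc_gt0 // mul1r.
have pa := papproxX n.+1 (papprox_geometric a1).
rewrite -[0](mulr0 (d * (c - z)^-1 ^+ n.+1)).
apply: eq_umean (umeanZ _ (umean_polX pa (ltn0Sn 0))) => u u1.
have w0' : c - z != 0 by rewrite -opprB oppr_eq0.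
have -> : c + d * u - z = (c - z) * (1 - d / (z - c) * u).
  by field; rewrite w0.
by rewrite exprMn invfM !exprVn expr1; ring.
Qed.

(** The weights [c], which will be the residues, are chosen before the circle, so that means over
    different circles can be compared. The sum runs over any duplicate-free [r] containing the poles
    because the induction combines decompositions whose lists of poles differ. *)
Lemma partial_fraction_means (n : nat) (rs : seq R[i]) (G : {poly R[i]}) :
  size rs = n -> exists c : R[i] -> R[i], (forall z, z \notin rs -> c z = 0) /\
  forall c0 d, (forall z, z \in rs -> modc (z - c0) != modc d) ->
    forall r, uniq r -> {subset rs <= r} ->
    umean (fun u => d * u * (G.[c0 + d * u] /
                             (\prod_(z <- rs) ('X - z%:P)).[c0 + d * u]))
      (\sum_(z <- r | modc (z - c0) < modc d) c z).
Proof.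
have nz (rs' : seq R[i]) c0 d : (forall z, z \in rs' -> modc (z - c0) != modc d) ->
    forall z u, z \in rs' -> modc u = 1 -> c0 + d * u - z != 0.
  move=> av z u /av h u1; apply: contraNneq h => E.
  have -> : z - c0 = d * u - (c0 + d * u - z) by ring.
  by rewrite E subr0 modcM u1 mulr1.
elim: n rs G => [|n ih] rs G.
  move=> /size0nil ->; exists (fun=> 0); split=> // c0 d _ r _ _.
  have -> : \sum_(z <- r | modc (z - c0) < modc d) 0 = 0 :> R[i] by rewrite big1_eq.
  pose p := d *: 'X * (G \Po (c0%:P + d *: 'X)).
  have -> : 0 = p`_0 :> R[i] by rewrite /p -scalerAl coefZ coefXM mulr0.
  apply: eq_umean (umean_poly p) => u _.
  by rewrite /p big_nil hornerC divr1 hornerM horner_comp !hornerE.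
case: rs => // z rs [srs].
(* With two distinct poles, [(z - z')^-1 ((y - z)^-1 - (y - z')^-1)] is the product of the two
   simple fractions, and each term has one factor fewer. *)
have [/hasP[z' z'rs z'z]|/hasPn alleq] := boolP (has (fun x => x != z) rs).
  pose rs2 := rem z' rs; have prs : perm_eq rs (z' :: rs2) by apply: perm_to_rem.
  have s1 : size (z :: rs2) = n by rewrite -srs (perm_size prs).
  have s2 : size (z' :: rs2) = n by rewrite -srs (perm_size prs).
  have [c1 [c10 h1]] := ih _ G s1; have [c2 [c20 h2]] := ih _ G s2.
  exists (fun x => (z - z')^-1 * (c1 x - c2 x)); split.
    move=> x; rewrite inE (perm_mem prs) inE !negb_or => /and3P[xz xz' xr].
    by rewrite c10 ?c20 ?subrr ?mulr0 // inE negb_or ?xz ?xz'.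
  move=> c0 d av r ur sr.
  have sub1 : {subset z :: rs2 <= z :: rs}.
    by move=> x; rewrite !inE (perm_mem prs) inE => /orP[->|->]; rewrite ?orbT.
  have sub2 : {subset z' :: rs2 <= z :: rs}.
    by move=> x; rewrite !inE (perm_mem prs) inE => /orP[->|->]; rewrite ?orbT.
  have m1 := h1 c0 d (fun x hx => av x (sub1 x hx)) r ur (fun x hx => sr x (sub1 x hx)).
  have m2 := h2 c0 d (fun x hx => av x (sub2 x hx)) r ur (fun x hx => sr x (sub2 x hx)).
  rewrite -mulr_sumr sumrB; apply: eq_umean (umeanZ _ (umeanB m1 m2)) => u u1 /=.
  rewrite !big_cons (perm_big _ prs) /= !big_cons !hornerM !hornerXsubC.
  have n1 := nz _ _ _ av z u (mem_head _ _) u1.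
  have n2 := nz _ _ _ av z' u ltac:(by rewrite inE z'rs orbT) u1.
  have n3 : (\prod_(j <- rs2) ('X - j%:P)).[c0 + d * u] != 0.
    rewrite horner_prod prodf_seq_neq0; apply/allP => x xr /=.
    by rewrite hornerXsubC (nz _ _ _ av) // sub1 // inE xr orbT.
  have n4 : z - z' != 0 by rewrite subr_eq0 eq_sym.
  by field; rewrite n1 n2 n3 n4.
(* With a single pole, dividing [G] by ['X - z] splits off a pure power of the pole and lowers the
   order of the rest. *)
have rsE : rs = nseq n z.
  by rewrite -srs; apply/all_pred1P/allP => x /alleq; rewrite negbK.
have /factor_theorem [G1 G1E] : root (G - G.[z]%:P) z by rewrite rootE !hornerE subrr.
have {}G1E : G = G1 * ('X - z%:P) + G.[z]%:P by rewrite -G1E subrK.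
have [c1 [c10 h1]] := ih _ G1 srs.
exists (fun x => c1 x + (x == z)%:R * (G.[z] * (n == 0%N)%:R)); split.
  move=> x; rewrite inE negb_or => /andP[/negbTE -> xr].
  by rewrite c10 // mul0r addr0.
move=> c0 d av r ur sr.
have m1 := h1 c0 d (fun x hx => av x (@mem_behead _ (z :: rs) x hx)) r ur
  (fun x hx => sr x (@mem_behead _ (z :: rs) x hx)).
have zr : z \in r by apply: sr; apply: mem_head.
rewrite big_split /=.
have E : \sum_(x <- r | modc (x - c0) < modc d) (x == z)%:R * (G.[z] * (n == 0%N)%:R) =
    G.[z] * ((modc (z - c0) < modc d)%R%:R * (n == 0%N)%:R).
  rewrite big_mkcond (bigD1_seq z) //= big1 ?addr0.
    by rewrite eqxx mul1r; case: ifP => _; rewrite ?mul1r // mul0r mulr0.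
  by move=> x /negbTE ->; rewrite mul0r if_same.
rewrite E; have m2 : umean (fun u => d * u / (c0 + d * u - z) ^+ n.+1)
    ((modc (z - c0) < modc d)%R%:R * (n == 0%N)%:R).
  case: ltgtP (av z (mem_head _ _)) => // h _; rewrite ?mul1r ?mul0r.
    exact: umean_pole_in.
  exact: umean_pole_out.
apply: eq_umean (umeanD m1 (umeanZ G.[z] m2)) => u u1 /=.
rewrite big_cons hornerM hornerXsubC {2}G1E rsE.
have n1 := nz _ _ _ av z u (mem_head _ _) u1.
have PE k x : (\prod_(j <- nseq k z) ('X - j%:P)).[x] = (x - z) ^+ k.
  elim: k => [|k ihk]; first by rewrite big_nil hornerC.
  by rewrite /= big_cons hornerM ihk hornerXsubC exprS.
rewrite PE hornerD hornerM hornerXsubC hornerC exprS.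
have n2 : (c0 + d * u - z) ^+ n != 0 by rewrite expf_neq0.
by field; rewrite n1 n2.
Qed.

Definition croots (P : {poly R[i]}) : seq R[i] :=
  undup (sval (closed_field_poly_normal P)).

Lemma croots_uniq P : uniq (croots P). Proof. exact: undup_uniq. Qed.

Lemma mem_croots P z : P != 0 -> (z \in croots P) = root P z.
Proof.
move=> P0; rewrite mem_undup; case: closed_field_poly_normal => /= r ->.
by rewrite rootZ ?lead_coef_eq0 // root_prod_XsubC.
Qed.

(* Cauchy's formula for the rational function [G / P]; the weight [c z] is its
   residue at [z]. *)
Lemma rational_means (G P : {poly R[i]}) : P != 0 ->
  exists c : R[i] -> R[i], forall c0 d,
    (forall z, root P z -> modc (z - c0) != modc d) ->
    umean (fun u => d * u * (G.[c0 + d * u] / P.[c0 + d * u]))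
      (\sum_(z <- croots P | modc (z - c0) < modc d) c z).
Proof.
move=> P0; have rP z := mem_croots z P0.
move: rP (croots_uniq P); rewrite /croots; case: closed_field_poly_normal => /= rs PE rP ur.
have [c [c0' h]] := partial_fraction_means ((lead_coef P)^-1 *: G) (erefl (size rs)).
exists c => c0 d av.
have av' z : z \in rs -> modc (z - c0) != modc d.
  by move=> zr; apply: av; rewrite -rP mem_undup.
have sr : {subset rs <= undup rs} by move=> x; rewrite mem_undup.
apply: eq_umean (h c0 d av' _ ur sr) => u u1.
by rewrite [in RHS]PE !hornerZ invfM; ring.
Qed.

End CauchyFormula.

(** * Power series division with rational coefficients, integrated over the circle *)

Section QuotientSeries.
Variable R : realType.
Implicit Types (g h : R[i] -> R[i]) (f p : nat -> R[i]) (v w : R[i]).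

(** Rational functions without poles on the circle: the class is closed under the operations of the
    division algorithm below, and its members are bounded on the circle and have a mean. *)
Definition urat g := exists A D : {poly R[i]}, forall u, modc u = 1 ->
  D.[u] != 0 /\ g u = A.[u] / D.[u].

Lemma eq_urat g h : (forall u, modc u = 1 -> g u = h u) -> urat g -> urat h.
Proof.
move=> gh [A [D H]]; exists A, D => u u1; have [? ?] := H u u1.
by rewrite -gh.
Qed.

Lemma urat_poly (p : {poly R[i]}) : urat (fun u => p.[u]).
Proof. by exists p, 1 => u _; rewrite hornerC oner_neq0 divr1. Qed.

Lemma urat_cst c : urat (fun=> c).
Proof. by apply: eq_urat (urat_poly c%:P) => u _; rewrite hornerC. Qed.

Lemma uratM g h : urat g -> urat h -> urat (fun u => g u * h u).
Proof.
move=> [A [D H]] [B [E H']]; exists (A * B), (D * E) => u u1.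
have [d0 ->] := H u u1; have [e0 ->] := H' u u1.
by rewrite !hornerM mulf_neq0 // invfM; split=> //; ring.
Qed.

Lemma uratB g h : urat g -> urat h -> urat (fun u => g u - h u).
Proof.
move=> [A [D H]] [B [E H']]; exists (A * E - B * D), (D * E) => u u1.
have [d0 ->] := H u u1; have [e0 ->] := H' u u1.
rewrite !hornerE mulf_neq0 //; split=> //.
by field; rewrite d0 e0.
Qed.

Lemma uratV g : urat g -> (forall u, modc u = 1 -> g u != 0) ->
  urat (fun u => (g u)^-1).
Proof.
move=> [A [D H]] g0; exists D, A => u u1; have [d0 E] := H u u1.
have := g0 u u1; rewrite E mulf_eq0 negb_or => /andP[-> _].
by rewrite invfM invrK mulrC.
Qed.

Lemma urat_mean g : urat g -> exists v, umean g v.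
Proof.
move=> [A [D H]].
(* The extra factor ['X] cancels the factor [u] that [rational_means] puts in front of the
   quotient. *)
have P0 : 'X * D != 0.
  rewrite mulf_neq0 ?polyX_eq0 //; have [+ _] := H 1 (modc1 R).
  by apply: contraNneq => ->; rewrite horner0.
have [c hc] := rational_means A P0.
eexists; apply: eq_umean (hc 0 1 _) => [u u1|z].
  have [d0 ->] := H u u1; have u0 := modc1_neq0 u1.
  by rewrite add0r !mul1r hornerM hornerX; field; rewrite d0 u0.
rewrite rootM subr0 modc1 => /orP[].
  by rewrite rootE hornerX => /eqP ->; rewrite modc0 eq_sym oner_neq0.
by apply: contraTneq => z1; have [] := H z z1.
Qed.

(** On the circle [u - z] has modulus at least the distance from [|z|] to 1. The product of these
    bounds over the roots is explicit and spares a compactness argument. *)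
Lemma modc_polyV (D : {poly R[i]}) : (forall u, modc u = 1 -> D.[u] != 0) ->
  exists2 C : R, 0 <= C & forall u, modc u = 1 -> modc D.[u]^-1 <= C.
Proof.
move=> H; have [rs DE] := closed_field_poly_normal D.
have lc0 : lead_coef D != 0.
  rewrite lead_coef_eq0; apply: contraTneq (H 1 (modc1 _)) => ->.
  by rewrite horner0 eqxx.
have rs1 z : z \in rs -> 0 < `|1 - modc z|.
  move=> zr; rewrite normr_gt0 subr_eq0 eq_sym; apply/eqP => z1.
  have := H z z1; rewrite DE hornerZ mulf_eq0 negb_or => /andP[_].
  by move/negP; apply; have := zr; rewrite -root_prod_XsubC rootE.
exists (modc (lead_coef D)^-1 * \prod_(z <- rs) `|1 - modc z|^-1).
  by rewrite mulr_ge0 ?modc_ge0 // prodr_ge0 // => z _; rewrite invr_ge0.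
move=> u u1; rewrite [in leLHS]DE hornerZ invfM modcM ler_wpM2l ?modc_ge0 //.
rewrite modcV horner_prod modc_prod -prodfV big_seq [leRHS]big_seq.
apply: ler_prod => z /rs1 z1; rewrite hornerXsubC invr_ge0 modc_ge0 /=.
have le1 : `|1 - modc z| <= modc (u - z).
  rewrite ler_norml; have := ler_modcDB u (- z); have := ler_modcDB (- z) u.
  by rewrite u1 modcN [- z + u]addrC; lra.
by rewrite lef_pV2 ?posrE // (lt_le_trans z1).
Qed.

Lemma urat_bounded g : urat g ->
  exists2 C : R, 0 <= C & forall u, modc u = 1 -> modc (g u) <= C.
Proof.
move=> [A [D H]]; have [C1 C10 h1] := modc_poly A.
have [C2 C20 h2] := modc_polyV (fun u u1 => (H u u1).1).
exists (C1 * C2); first by rewrite mulr_ge0.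
by move=> u u1; rewrite (H u u1).2 modcM ler_pM ?modc_ge0 ?h1 ?h2.
Qed.

(* Power series division of [\sum_j f j s^j] by [\sum_j p j s^j]: after [k]
   steps the remainder is [s^k * \sum_j qrem f p k j s^j]. *)
Fixpoint qrem (f p : nat -> R[i]) (k j : nat) : R[i] :=
  if k is k'.+1 then qrem f p k' j.+1 - qrem f p k' 0%N / p 0%N * p j.+1
  else f j.

Definition qcoef f p k := qrem f p k 0%N / p 0%N.

Definition psum (D : nat) (f : nat -> R[i]) (s : R[i]) : R[i] :=
  \sum_(0 <= j < D) f j * s ^+ j.

Lemma qrem_eq0 f p D : (forall j, (D <= j)%N -> f j = 0) ->
  (forall j, (D <= j)%N -> p j = 0) ->
  forall k j, (D <= j)%N -> qrem f p k j = 0.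
Proof.
move=> f0 p0; elim=> [|k ih] j jD /=; first exact: f0.
by rewrite (ih j.+1) ?(p0 j.+1) ?leqW // mulr0 subrr.
Qed.

Lemma qrem_identity f p D s k : p 0%N != 0 ->
  (forall j, (D <= j)%N -> f j = 0) -> (forall j, (D <= j)%N -> p j = 0) ->
  psum D f s = psum D p s * (\sum_(0 <= n < k) qcoef f p n * s ^+ n) +
               s ^+ k * psum D (qrem f p k) s.
Proof.
move=> p00 f0 p0; have r0 := qrem_eq0 f0 p0.
have D1 (g : nat -> R[i]) : (forall j, (D <= j)%N -> g j = 0) -> psum D g s = psum D.+1 g s.
  by move=> g0; rewrite /psum big_nat_recr //= g0 // mul0r addr0.
elim: k => [|k ih].
  by rewrite big_nil mulr0 add0r expr0 mul1r; apply: eq_bigr.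
rewrite ih big_nat_recr //= mulrDr -addrA; congr (_ + _).
have E : psum D (qrem f p k) s =
    qcoef f p k * psum D p s + s * psum D (qrem f p k.+1) s.
  rewrite (D1 (qrem f p k)) ?(D1 p) //; last exact: r0.
  rewrite {1 2}/psum !big_nat_recl //= !expr0 !mulr1 mulrDr.
  rewrite {2}/qcoef divfK // -addrA; congr (_ + _).
  rewrite /psum !mulr_sumr -big_split /=; apply: eq_bigr => j _.
  by rewrite exprS /qcoef; ring.
by rewrite E exprSr; ring.
Qed.

Lemma modc_qrem f p (A b : R) : 0 < b -> 0 <= A ->
  (forall j, modc (f j) <= A) -> (forall j, modc (p j) <= A) -> b <= modc (p 0%N) ->
  forall k j, modc (qrem f p k j) <= A * (1 + A / b) ^+ k.
Proof.
move=> b0 A0 fA pA bp; elim=> [|k ih] j /=; first by rewrite mulr1.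
apply: le_trans (ler_modcB _ _) _.
rewrite exprS mulrCA mulrDl mul1r lerD // !modcM modcV [A / b * _]mulrC.
rewrite mulrAC mulrA; apply: ler_pM; rewrite ?modc_ge0 ?mulr_ge0 ?invr_ge0 ?modc_ge0 //.
  rewrite ler_pM ?modc_ge0 //.
by rewrite lef_pV2 ?posrE // (lt_le_trans b0).
Qed.

(** The radius [r] and the constant [C] depend on [D], [A] and [b] only. When [f] and [p] vary with
    the point [u] of the circle, this makes the expansion uniform in [u], hence integrable term by
    term. *)
Lemma quotient_series (D : nat) (A b : R) : 0 < b -> 0 <= A ->
  exists r C : R, [/\ 0 < r, 0 <= C & forall f p s,
    (forall j, modc (f j) <= A) -> (forall j, modc (p j) <= A) ->
    b <= modc (p 0%N) ->
    (forall j, (D <= j)%N -> f j = 0) -> (forall j, (D <= j)%N -> p j = 0) ->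
    modc s < r ->
    psum D p s != 0 /\ forall k,
      modc (psum D f s / psum D p s - \sum_(0 <= n < k) qcoef f p n * s ^+ n)
        <= C * 2^-1 ^+ k].
Proof.
move=> b0 A0; pose M := 1 + A / b.
have M1 : 1 <= M by rewrite lerDl divr_ge0 // ltW.
have DA : 0 <= D%:R * A by rewrite mulr_ge0.
(* The first bound on [modc s] compensates the growth factor [M] of the remainders and leaves the
   ratio 1/2; the second keeps the nonconstant part of the denominator below [b / 2]. *)
exists (Num.min (2^-1 / M) (b / 2 / (D%:R * A + 1))), (D%:R * A / (b / 2)).
have dp : 0 < D%:R * A + 1 by lra.
split; first by rewrite lt_min !divr_gt0 //; lra.
  by rewrite divr_ge0 //; lra.
move=> f p s fA pA bp f0 p0; rewrite lt_min => /andP[sM sD].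
have s0 := modc_ge0 s.
have sM' : modc s * M <= 2^-1 by rewrite -ler_pdivlMr ?ltW //; lra.
have s1 : modc s <= 1 by nra.
have sD' : modc s * (D%:R * A) <= b / 2.
  have : modc s * (D%:R * A + 1) < b / 2 by rewrite -ltr_pdivlMr.
  by nra.
have p00 : p 0%N != 0 by rewrite -modc_gt0 (lt_le_trans b0).
have psb : b / 2 <= modc (psum D p s).
  have : (0 < D)%N by rewrite lt0n; apply: contraNneq p00 => D0; rewrite p0 // D0.
  case: D DA dp sD sD' f0 p0 => // D' DA dp sD sD' f0 p0 _.
  rewrite /psum big_nat_recl //= expr0 mulr1.
  apply: le_trans (ler_modcDB _ _).
  suff : modc (\sum_(0 <= i < D') p i.+1 * s ^+ i.+1) <= b / 2 by lra.
  apply: le_trans (modc_sum _ _ _) _; apply: le_trans sD'.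
  have -> : modc s * (D'.+1%:R * A) = modc s * A + \sum_(0 <= i < D') (modc s * A).
    by rewrite sumr_const_nat subn0 -mulr_natl -addn1 natrD; ring.
  rewrite ler_wpDl ?mulr_ge0 //; apply: ler_sum => i _.
  rewrite modcM modcX mulrC ler_pM ?exprn_ge0 ?modc_ge0 //.
  by rewrite exprS ler_piMr // exprn_ile1.
have ps0 : psum D p s != 0 by rewrite -modc_gt0; lra.
split=> // k; rewrite {1}(qrem_identity s k p00 f0 p0) [X in modc X](_ : _ =
  s ^+ k * psum D (qrem f p k) s / psum D p s); last by field.
rewrite !modcM modcV modcX.
have rb : modc (psum D (qrem f p k) s) <= D%:R * A * M ^+ k.
  apply: le_trans (modc_sum _ _ _) _.
  have -> : D%:R * A * M ^+ k = \sum_(0 <= i < D) (A * M ^+ k).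
    by rewrite sumr_const_nat subn0 -mulr_natl; ring.
  apply: ler_sum => i _; rewrite modcM -[leRHS]mulr1 ler_pM ?modc_ge0 //.
    exact: modc_qrem.
  by rewrite modcX exprn_ile1.
apply: (@le_trans _ _ (modc s ^+ k * (D%:R * A * M ^+ k) / (b / 2))).
  apply: ler_pM; rewrite ?mulr_ge0 ?exprn_ge0 ?modc_ge0 ?invr_ge0 ?modc_ge0 //.
    by rewrite ler_wpM2l ?exprn_ge0.
  by rewrite lef_pV2 ?posrE ?modc_gt0 //; lra.
have -> : modc s ^+ k * (D%:R * A * M ^+ k) / (b / 2) =
   D%:R * A / (b / 2) * (modc s * M) ^+ k by rewrite exprMn; ring.
rewrite ler_wpM2l ?divr_ge0 //; first lra.
by rewrite lerXn2r // nnegrE ?mulr_ge0 //; lra.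
Qed.

Lemma urat_common_bound (D : nat) (f : nat -> R[i] -> R[i]) :
  (forall j, urat (f j)) -> exists2 A : R, 0 <= A &
    forall j u, (j < D)%N -> modc u = 1 -> modc (f j u) <= A.
Proof.
move=> fr; elim: D => [|D [A A0 hA]]; first by exists 0.
have [B B0 hB] := urat_bounded (fr D).
exists (A + B) => [|j u]; first by rewrite addr_ge0.
rewrite ltnS leq_eqVlt => /orP[/eqP -> u1|jD u1].
  by have := hB u u1; lra.
by have := hA j u jD u1; lra.
Qed.

(** Analyticity in [s] of a mean over a fixed circle. The coefficients of the quotient are rational
    in [u], so their means exist; the nonvanishing of the denominator says that no pole meets the
    circle for small [s]. *)
Lemma umean_quotient_series (D : nat) (f p : nat -> R[i] -> R[i]) :
  (forall j, urat (f j)) -> (forall j, urat (p j)) ->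
  (forall j u, (D <= j)%N -> f j u = 0) -> (forall j u, (D <= j)%N -> p j u = 0) ->
  (forall u, modc u = 1 -> p 0%N u != 0) ->
  exists (r : R) (N : nat -> R[i]), [/\ 0 < r,
    forall n, umean (fun u => qcoef (f^~ u) (p^~ u) n) (N n) &
    forall s, modc s < r ->
      (forall u, modc u = 1 -> psum D (p^~ u) s != 0) /\
      forall v, umean (fun u => psum D (f^~ u) s / psum D (p^~ u) s) v ->
        series (fun n => N n * s ^+ n : (R[i])^o) @ \oo --> (v : (R[i])^o)].
Proof.
move=> fr pr f0 p0 p00.
have [A1 A10 hA1] := urat_common_bound D fr.
have [A2 A20 hA2] := urat_common_bound D pr.
have [B B0 hB] := urat_bounded (uratV (pr 0%N) p00).
have rr k j : urat (fun u => qrem (f^~ u) (p^~ u) k j).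
  elim: k j => [|k ih] j /=; first exact: fr.
  by apply: uratB => //; apply: uratM => //; apply: uratM => //; apply: uratV.
have cr k : urat (fun u => qcoef (f^~ u) (p^~ u) k).
  by apply: uratM => //; apply: uratV.
pose N n := xget 0 [set v | umean (fun u => qcoef (f^~ u) (p^~ u) n) v].
have hN n : umean (fun u => qcoef (f^~ u) (p^~ u) n) (N n).
  by have [v hv] := urat_mean (cr n); apply: (xgetPex 0); exists v.
have b0 : 0 < (B + 1)^-1 by rewrite invr_gt0; lra.
have AA : 0 <= A1 + A2 by rewrite addr_ge0.
have [r [C [r0 C0 H]]] := quotient_series D b0 AA.
have {}H u s : modc u = 1 -> modc s < r -> psum D (p^~ u) s != 0 /\ forall k,
    modc (psum D (f^~ u) s / psum D (p^~ u) s -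
          \sum_(0 <= n < k) qcoef (f^~ u) (p^~ u) n * s ^+ n) <= C * 2^-1 ^+ k.
  move=> u1 sr; apply: H => //.
  move=> j; have [jD|jD] := ltnP j D; last by rewrite f0 // modc0.
    by have := hA1 j u jD u1; lra.
  move=> j; have [jD|jD] := ltnP j D; last by rewrite p0 // modc0.
    by have := hA2 j u jD u1; lra.
  have := hB u u1; rewrite modcV => h.
    rewrite -[leRHS]invrK lef_pV2 ?posrE ?invr_gt0 ?modc_gt0 ?p00 //; lra.
  by move=> j jD; apply: f0.
  by move=> j jD; apply: p0.
exists r, N; split=> // s sr; split=> [u u1|v hv].
  by have [] := H u s u1 sr.
apply: (umean_series C0 _ _ _ hv (th := 2^-1)
   (kap := fun n u => qcoef (f^~ u) (p^~ u) n * s ^+ n)).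
by rewrite invr_ge0 ler0n /= invf_lt1 // ltr1n.
by move=> k u u1; have [_] := H u s u1 sr; apply.
move=> n; rewrite mulrC; apply: eq_umean (umeanZ (s ^+ n) (hN n)) => u _.
  by rewrite mulrC.
Qed.

End QuotientSeries.

(** * Residues as means over small circles *)

Section Residues.
Variable R : realType.
Implicit Types (f F : R[i] -> R[i]) (z : R[i]) (G P : {poly R[i]}).

Lemma cvg_series_bounded (t : nat -> (R[i])^o) (l : (R[i])^o) :
  series t @ \oo --> l -> exists2 B : R, 0 <= B & forall n, modc (t n) <= B.
Proof.
move=> /cvg_modcP /(_ 1 ltr01) [k0 hk].
exists (2 + \sum_(0 <= n < k0) modc (t n)).
  by rewrite addr_ge0 // sumr_ge0 // => i _; apply: modc_ge0.
move=> n; have [nk|kn] := ltnP n k0.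
  rewrite (big_rem n) ?mem_index_iota //=.
  have : 0 <= \sum_(y <- rem n (index_iota 0 k0)) modc (t y).
    by rewrite sumr_ge0 // => i _; apply: modc_ge0.
  lra.
have S0 : 0 <= \sum_(0 <= n < k0) modc (t n).
  by rewrite sumr_ge0 // => i _; apply: modc_ge0.
have -> : t n = (l - series t n) - (l - series t n.+1).
  by rewrite /series /= big_nat_recr //=; ring.
have := ler_modcB (l - series t n) (l - series t n.+1).
by have := hk n kn; have := hk n.+1 (leqW kn); lra.
Qed.

Lemma cvg_series_tail (t : nat -> (R[i])^o) (l : (R[i])^o) (B : R) :
  (forall n, modc (t n) <= B * 2^-1 ^+ n) -> series t @ \oo --> l ->
  forall k, modc (l - series t k) <= 2 * B * 2^-1 ^+ k.
Proof.
move=> tB /cvg_modcP tl k; rewrite -subr_le0; apply: le0_of_eps => e /tl[k0 hk].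
have step n : modc (series t (k + n)%N - series t k) <=
    2 * B * 2^-1 ^+ k - 2 * B * 2^-1 ^+ (k + n).
  elim: n => [|n ih]; first by rewrite addn0 !subrr modc0.
  rewrite addnS /series /= big_nat_recr //= addrAC.
  apply: le_trans (ler_modcD _ _) _; rewrite /series /= in ih.
  by have := tB (k + n)%N; rewrite exprS; lra.
pose N := maxn k0 k; have NE : N = (k + (N - k))%N by rewrite subnKC // leq_maxr.
have := hk N (leq_maxl _ _); have := step (N - k)%N; rewrite -NE.
have := ler_modcD (l - series t N) (series t N - series t k); rewrite addrA subrK.
have B0 : 0 <= B by have := tB 0%N; rewrite expr0 mulr1; apply: le_trans (modc_ge0 _).
have : 0 <= 2 * B * 2^-1 ^+ N by rewrite !mulr_ge0 // exprn_ge0 // invr_ge0.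
lra.
Qed.

Lemma umeanXz (m : int) : umean (fun u : R[i] => u ^ m) (m == 0)%:R.
Proof.
case: m => [[|n]|n] /=.
by apply: eq_umean (umean_cst 1) => u _; rewrite expr0z.
by apply: eq_umean (@umeanX R n.+1 _).
by apply: eq_umean (@umeanVX R n.+1 _) => // u _; rewrite exprVn.
Qed.

Lemma modc_exprz z (m : int) : modc (z ^ m) = modc z ^ m.
Proof. by case: m => n; rewrite ?NegzE /= -?exprnN ?modcV ?modcX. Qed.

(** Links the Laurent definition to the means. On a circle of less than half the radius of one where
    the expansion converges, the terms decrease geometrically, so integration term by term
    applies. *)
Lemma residue_mean f z (c : R[i]) : is_residue f z c ->
  exists2 d0 : R, 0 < d0 & forall (d : R) l, 0 < d < d0 ->
    umean (fun u => d%:C * u * f (z + d%:C * u)) l -> l = c.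
Proof.
move=> hc; have [m [a [[r r0 H] cE]]] : exists m (a : nat -> R[i]),
    (exists2 r : R[i], 0 < r & forall y : R[i], 0 < `|y - z| < r ->
       series (fun n => a n * (y - z) ^ (n%:Z - m%:Z) : (R[i])^o) @ \oo
         --> (f y : (R[i])^o)) /\ c = if m is m'.+1 then a m' else 0 by exact: hc.
have rE : r = (complex.Re r)%:C by rewrite RRe_real // gtr0_real.
move: r0; rewrite rE ltcR => r0.
have [d1 d10 d1r] : exists2 d1, 0 < d1 & d1 < complex.Re r.
  by exists (complex.Re r / 2); [rewrite divr_gt0|lra].
have {}H w : 0 < modc w < complex.Re r ->
    series (fun n => a n * w ^ (n%:Z - m%:Z) : (R[i])^o) @ \oo --> (f (z + w) : (R[i])^o).
  move=> hw; have /H : 0 < `|(z + w) - z| < r.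
    by rewrite [z + w]addrC addrK -modcE rE !ltcR.
  by rewrite [z + w - z]addrAC subrr add0r.
have [B B0 hB] : exists2 B : R, 0 <= B & forall n, modc (a n * d1%:C ^ (n%:Z - m%:Z)) <= B.
  apply: (cvg_series_bounded (H d1%:C _)).
  by rewrite modc_real ?d10 // ltW.
exists (d1 / 2) => [|d l /andP[d0 dd1] hl]; first by rewrite divr_gt0.
have tb n w : modc w = d -> modc (a n * w ^ (n%:Z - m%:Z)) <=
    B * (d1 / d) ^+ m * 2^-1 ^+ n.
  move=> wd; have := hB n; rewrite 2!(modcM (a n)).
  rewrite (modc_exprz w).
  rewrite (modc_exprz d1%:C) wd (modc_real (ltW d10)) => h.
  have -> : modc (a n) * d ^ (n%:Z - m%:Z) =
      modc (a n) * d1 ^ (n%:Z - m%:Z) * (d1 / d) ^+ m * (d / d1) ^+ n.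
    rewrite !expfzDr ?gt_eqF // -!exprnP -!exprnN !exprMn !exprVn.
    by field; rewrite !expf_neq0 ?gt_eqF.
  apply: ler_pM.
  by rewrite !mulr_ge0 ?modc_ge0 ?exprz_ge0 ?exprn_ge0 ?divr_ge0 // ltW.
  by rewrite exprn_ge0 // divr_ge0 // ltW.
  by rewrite ler_wpM2r // exprn_ge0 // divr_ge0 // ltW.
  by rewrite lerXn2r // ?nnegrE ?invr_ge0 ?divr_ge0 ?(ltW d0) ?(ltW d10) // ler_pdivrMr //; lra.
set B' := B * (d1 / d) ^+ m in tb.
have B'0 : 0 <= B' by rewrite mulr_ge0 // exprn_ge0 // divr_ge0 // ltW.
have md u : modc u = 1 -> modc (d%:C * u) = d.
  by move=> u1; rewrite modcM u1 mulr1 modc_real // ltW.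
have dn0 : d%:C != 0 by rewrite -modc_gt0 modc_real // ltW.
(* Only the exponent -1 survives: its index is [m - 1], which exists if [m] is positive. *)
pose v n := if m is m'.+1 then (n == m')%:R * a n else 0.
have /cvg_modcP cv : series (v : nat -> (R[i])^o) @ \oo --> (l : (R[i])^o).
  apply: (@umean_series R (fun u => d%:C * u * f (z + d%:C * u))
     (fun n u => d%:C * u * (a n * (d%:C * u) ^ (n%:Z - m%:Z))) v l (d * (2 * B')) 2^-1) => //.
  by rewrite mulr_ge0 ?(ltW d0) // mulr_ge0.
  by rewrite invr_ge0 ler0n /= invf_lt1 // ltr1n.
  move=> k u u1; rewrite -mulr_sumr -mulrBr modcM md // -mulrA.
    rewrite ler_wpM2l ?(ltW d0) //.
    apply: (cvg_series_tail _ (H _ _)); last by rewrite md // d0 /=; lra.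
    by move=> n; apply: tb; apply: md.
  move=> n.
    have E : v n = d%:C ^ (n%:Z - m%:Z + 1) * a n * (n%:Z - m%:Z + 1 == 0)%:R.
      rewrite /v; case: (m) => [|m'].
        by rewrite subr0 -PoszD addn1 mulr0.
      have -> : (n%:Z - m'.+1%:Z + 1 == 0) = (n == m') by lia.
      have [->|_] := eqVneq n m'; last by rewrite mul0r mulr0.
      have -> : m'%:Z - m'.+1%:Z + 1 = 0 by lia.
      by rewrite expr0z !mul1r mulr1.
    rewrite E; apply: eq_umean (umeanZ _ (umeanXz _)) => u u1.
    have u0 := modc1_neq0 u1.
    by rewrite -[in RHS](mulrA d%:C) !exprzMl ?unitfE // !expfzDr // !expr1z; ring.
have Sv k : (m <= k)%N -> series (v : nat -> (R[i])^o) k = c.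
  rewrite cE /series /= /v; case: (m) => [|m'] mk; first by rewrite big1_eq.
  rewrite (bigD1_seq m') ?mem_index_iota ?iota_uniq //= eqxx mul1r big1 ?addr0 //.
  by move=> i /negbTE ->; rewrite mul0r.
apply/eqP; rewrite -subr_eq0; apply/eqP/modc_eps => e /cv[k0 hk].
by rewrite -(Sv (maxn k0 m)) ?leq_maxr // hk ?leq_maxl.
Qed.

Lemma polys_bound (G P : {poly R[i]}) : exists2 A : R, 0 <= A &
  forall j, modc G`_j <= A /\ modc P`_j <= A.
Proof.
have B (Q : {poly R[i]}) : exists2 A : R, 0 <= A & forall j, modc Q`_j <= A.
  exists (\sum_(i < size Q) modc Q`_i).
    by rewrite sumr_ge0 // => i _; apply: modc_ge0.
  move=> j; have [jD|jD] := ltnP j (size Q); last first.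
    by rewrite nth_default // modc0 sumr_ge0 // => i _; apply: modc_ge0.
  rewrite (bigD1 (Ordinal jD)) //= lerDl sumr_ge0 // => i _; apply: modc_ge0.
have [A A0 hA] := B G; have [C C0 hC] := B P.
exists (A + C); first by rewrite addr_ge0.
by move=> j; have := hA j; have := hC j; split; lra.
Qed.

Lemma psum_horner (D : nat) (Q : {poly R[i]}) (s : R[i]) : (size Q <= D)%N ->
  psum D (fun j => Q`_j) s = Q.[s].
Proof.
move=> QD; rewrite (horner_coef_wide _ QD) /psum big_mkord.
by apply: eq_bigr.
Qed.

Definition shiftp z (Q : {poly R[i]}) := Q \Po ('X + z%:P).

Lemma horner_shiftp z (Q : {poly R[i]}) h : (shiftp z Q).[h] = Q.[z + h].
Proof. by rewrite horner_comp !hornerE addrC. Qed.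

(** Power series division at [z] yields the Laurent expansion, and [(y - z)^-1] has the index
    [k - 1] in the expansion of [G / W]. This provides the existence of residues. *)
Lemma is_residue_quotient F z k G W (r0 : R) : 0 < r0 -> W.[z] != 0 ->
  (forall y, 0 < modc (y - z) < r0 -> F y = G.[y] / ((y - z) ^+ k * W.[y])) ->
  is_residue F z (if k is k'.+1 then
    qcoef (fun j => (shiftp z G)`_j) (fun j => (shiftp z W)`_j) k' else 0).
Proof.
move=> r00 Wz FE; pose g := shiftp z G; pose w := shiftp z W.
pose D := maxn (size g) (size w).
have gD : (size g <= D)%N by rewrite leq_maxl.
have wD : (size w <= D)%N by rewrite leq_maxr.
have [A A0 hA] := polys_bound g w.
have w0 : w`_0 = W.[z] by rewrite -horner_coef0 horner_shiftp addr0.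
have b0 : 0 < modc w`_0 by rewrite w0 modc_gt0.
have [r [C [rp C0 H]]] := quotient_series D b0 A0.
exists k, (qcoef (fun j => g`_j) (fun j => w`_j)); split=> //.
exists (Num.min r r0)%:C; first by rewrite ltcR lt_min rp r00.
move=> y; rewrite -modcE !ltcR lt_min => /and3P[y0 yr yr0].
have yz : y - z != 0 by rewrite -modc_gt0.
have [] := H (fun j => g`_j) (fun j => w`_j) (y - z) _ _ _ _ _ yr.
by move=> j; have [] := hA j.
by move=> j; have [] := hA j.
by [].
by move=> j jD; rewrite nth_default // (leq_trans gD).
by move=> j jD; rewrite nth_default // (leq_trans wD).
rewrite !psum_horner // !horner_shiftp addrC subrK => Wy hk.
apply: (@series_geometric_cvg R _ _ (C / modc (y - z) ^+ k) 2^-1).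
by rewrite divr_ge0 // exprn_ge0 // ltW.
by rewrite invr_ge0 ler0n /= invf_lt1 // ltr1n.
move=> n; rewrite FE ?y0 //.
have -> : G.[y] / ((y - z) ^+ k * W.[y]) - \sum_(0 <= i < n)
    qcoef (fun j => g`_j) (fun j => w`_j) i * (y - z) ^ (i%:Z - k%:Z) =
   ((y - z) ^+ k)^-1 * (G.[y] / W.[y] - \sum_(0 <= i < n)
    qcoef (fun j => g`_j) (fun j => w`_j) i * (y - z) ^+ i).
  rewrite mulrBr mulr_sumr; congr (_ - _).
    by rewrite invfM; ring.
  by apply: eq_bigr => i _; rewrite expfzDr // -exprnP -exprnN; ring.
rewrite modcM modcV modcX mulrC mulrAC ler_wpM2r ?invr_ge0 ?exprn_ge0 ?modc_ge0 //.
Qed.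

Definition residue_weights G P (c : R[i] -> R[i]) := forall c0 d,
  (forall z, root P z -> modc (z - c0) != modc d) ->
  umean (fun u => d * u * (G.[c0 + d * u] / P.[c0 + d * u]))
    (\sum_(z <- croots P | modc (z - c0) < modc d) c z).

Lemma roots_isolated P z : P != 0 -> exists2 e : R, 0 < e &
  forall y, root P y -> y != z -> e <= modc (y - z).
Proof.
move=> P0.
have : exists2 e : R, 0 < e & forall y, y \in croots P -> y != z -> e <= modc (y - z).
  elim: (croots P) => [|x s [e e0 he]]; first by exists 1.
  have [->|xz] := eqVneq x z.
    by exists e => // y; rewrite inE => /orP[/eqP ->|]; [rewrite eqxx|apply: he].
  exists (Num.min e (modc (x - z))); first by rewrite lt_min e0 modc_gt0 subr_eq0.
  move=> y; rewrite inE ge_min => /orP[/eqP ->|ys yz]; first by rewrite lexx orbT.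
  by rewrite he.
by move=> [e e0 he]; exists e => // y yP; apply: he; rewrite mem_croots.
Qed.

(** Over a circle around [z] that encloses no other root, the mean is [c z] by Cauchy's formula and
    [r] by [residue_mean]. *)
Lemma is_residue_weight F z G P c r (r0 : R) : P != 0 -> root P z -> 0 < r0 ->
  (forall y, 0 < modc (y - z) < r0 -> F y = G.[y] / P.[y]) ->
  residue_weights G P c -> is_residue F z r -> r = c z.
Proof.
move=> P0 Pz r00 FE hc /residue_mean[d0 d00 H].
have [e e0 he] := roots_isolated z P0.
pose d := Num.min (Num.min r0 e) d0 / 2.
have m0 : 0 < Num.min (Num.min r0 e) d0 by rewrite !lt_min r00 e0 d00.
have dp : 0 < d by rewrite divr_gt0.
have : d < Num.min (Num.min r0 e) d0 by rewrite /d; lra.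
rewrite !lt_min => /andP[/andP[dr0 de] dd0].
have md : modc d%:C = d by rewrite modc_real // ltW.
apply/esym/(H d); first by rewrite dp.
have av y : root P y -> modc (y - z) != modc d%:C.
  move=> Py; rewrite md; have [->|yz] := eqVneq y z.
    by rewrite subrr modc0 lt_eqF.
  by rewrite gt_eqF // (lt_le_trans de) // he.
have -> : c z = \sum_(y <- croots P | modc (y - z) < modc d%:C) c y.
  rewrite big_mkcond (bigD1_seq z) ?croots_uniq ?mem_croots //= subrr modc0 md dp.
  rewrite big_seq_cond big1 ?addr0 // => y /andP[yP yz].
  rewrite mem_croots // in yP.
  by rewrite ltNge (ltW (lt_le_trans de (he y yP yz))).
apply: eq_umean (hc z d%:C av) => u u1.
rewrite FE // [z + _]addrC addrK modcM md u1 mulr1 dp //.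
Qed.

(** [residue] is a choice with default 0, so a residue must first be exhibited, by factoring out the
    full power of the root; its value then follows from [is_residue_weight]. *)
Lemma residue_weightE F z G P c (r0 : R) : P != 0 -> root P z -> 0 < r0 ->
  (forall y, 0 < modc (y - z) < r0 -> F y = G.[y] / P.[y]) ->
  residue_weights G P c -> residue F z = c z.
Proof.
move=> P0 Pz r00 FE hc; apply: (is_residue_weight P0 Pz r00 FE hc).
have [k [W [Wz PE]]] : exists k W, W.[z] != 0 /\ P = W * ('X - z%:P) ^+ k.
  by have [k [W Wz PE]] := multiplicity_XsubC P z; exists k, W; rewrite P0 in Wz.
have FE' y : 0 < modc (y - z) < r0 -> F y = G.[y] / ((y - z) ^+ k * W.[y]).
  by move=> h; rewrite FE // PE hornerM horner_exp hornerXsubC [W.[y] * _]mulrC.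
have := is_residue_quotient r00 Wz FE'.
by set r := (if _ is _.+1 then _ else _) => hr; apply: (xgetPex 0); exists r.
Qed.

End Residues.

(** * The polynomial [y^m V] and aperiodicity *)

Section StepPolynomial.
Variable S : {fset int}.
Hypothesis S_neg : exists2 v, v \in S & v < 0.

Definition stepQ (F : fieldType) : {poly F} := \sum_(v <- S) 'X^(shifted S v).

Lemma kernel_polyE (F : fieldType) (t : F) :
  kernel_poly S t = 'X^(minv S) - t *: stepQ F.
Proof. by []. Qed.

Lemma bigmin_mem (s : seq int) :
  (\big[Num.min/0]_(v <- s) v == 0) || (\big[Num.min/0]_(v <- s) v \in s).
Proof.
elim: s => [|x s ih]; first by rewrite big_nil.
rewrite big_cons inE; set b := \big[_/_]_(_ <- _) _ in ih *.
by case: leP => _; rewrite ?eqxx ?orbT //; case/orP: ih => ->; rewrite ?orbT.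
Qed.

Lemma bigmin_le (s : seq int) : (\big[Num.min/0]_(v <- s) v <= 0) /\
  forall x, x \in s -> \big[Num.min/0]_(v <- s) v <= x.
Proof.
elim: s => [|x s [ih0 ih]]; first by rewrite big_nil.
rewrite big_cons ge_min ih0 orbT; split=> // y.
by rewrite inE ge_min => /orP[/eqP ->|/ih ->]; rewrite ?lexx ?orbT.
Qed.

Lemma minvE : (minv S)%:Z = - \big[Num.min/0]_(v <- S) v.
Proof. by rewrite /minv abszE ler0_norm // (bigmin_le S).1. Qed.

Lemma minv_gt0 : (0 < minv S)%N.
Proof.
have [v vS v0] := S_neg; rewrite -ltz_nat minvE oppr_gt0.
exact: le_lt_trans ((bigmin_le S).2 v vS) v0.
Qed.

Lemma shiftedE v : v \in S -> (shifted S v)%:Z = v + (minv S)%:Z.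
Proof.
by move=> vS; rewrite /shifted abszE ger0_norm // minvE subr_ge0 (bigmin_le S).2.
Qed.

Lemma minv_mem : - (minv S)%:Z \in S.
Proof.
rewrite minvE opprK; have /orP[/eqP h|//] := bigmin_mem S.
by have := minv_gt0; have := minvE; rewrite h; lia.
Qed.

Lemma stepV_Q (F : fieldType) (y : F) : y != 0 ->
  y ^+ minv S * stepV S y = (stepQ F).[y].
Proof.
move=> y0; rewrite /stepV /stepQ horner_sum mulr_sumr big_seq [RHS]big_seq.
apply: eq_bigr => v vS; rewrite hornerXn exprnP (exprnP y) shiftedE // -expfzDr //.
by rewrite addrC.
Qed.

Lemma stepV_kernel (F : fieldType) (t y : F) : y != 0 ->
  1 - t * stepV S y = (kernel_poly S t).[y] / y ^+ minv S.
Proof.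
move=> y0; rewrite kernel_polyE !hornerE -stepV_Q //.
by field; rewrite expf_neq0.
Qed.

Lemma stepQ_0 (F : fieldType) : (stepQ F).[0] = 1.
Proof.
rewrite horner_sum (bigD1_seq (- (minv S)%:Z)) ?fset_uniq ?minv_mem //=.
have -> : shifted S (- (minv S)%:Z) = 0%N by have := shiftedE minv_mem; lia.
rewrite hornerXn expr0 big_seq_cond big1 ?addr0 // => v /andP[vS vm].
by rewrite hornerXn expr0n; have := shiftedE vS; case: eqP => //; move: vm; lia.
Qed.

Lemma kernel_poly_0 (F : fieldType) (t : F) : (kernel_poly S t).[0] = - t.
Proof.
rewrite kernel_polyE hornerD hornerN hornerZ stepQ_0 hornerXn expr0n.
by have := minv_gt0; case: (minv S) => // n _; rewrite sub0r mulr1.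
Qed.

Lemma root_of_unity_gcd (F : fieldType) (u : F) (s : seq int) (e : int -> nat) :
  (forall v, v \in s -> u ^+ e v = 1) -> u ^+ (\big[gcdn/0%N]_(v <- s) e v) = 1.
Proof.
elim: s => [|v s ih] h; first by rewrite big_nil expr0.
rewrite big_cons; set g := \big[gcdn/0%N]_(_ <- _) _ in ih *.
have ug : u ^+ g = 1 by apply: ih => x xs; apply: h; rewrite inE xs orbT.
have uv : u ^+ e v = 1 by apply: h; apply: mem_head.
have [->|v0] := posnP (e v); first by rewrite gcd0n.
have [km kn E _] := egcdnP g v0.
have : u ^+ (km * e v) = 1 by rewrite mulnC exprM uv expr1n.
by rewrite E exprD mulnC exprM ug expr1n mul1r.
Qed.

(** Aperiodicity is about the shifted exponents. Since [- minv S] is itself a step,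
    [u ^+ minv S = 1] and the shift is harmless. *)
Lemma aperiodic_unity (F : fieldType) (u : F) : aperiodic S -> u != 0 ->
  (forall v, v \in S -> u ^ v = 1) -> u = 1.
Proof.
move=> ap u0 h; rewrite -[u]expr1 -ap; apply: root_of_unity_gcd => v vS.
rewrite exprnP shiftedE // expfzDr // h // mul1r.
by have /eqP := h _ minv_mem; rewrite -exprnN invr_eq1 => /eqP.
Qed.

End StepPolynomial.

(** * The Laurent polynomial [V] on the positive axis *)

Section CriticalPoint.
Variables (R : realType) (S : {fset int}) (tau rho : R).
Hypothesis S_neg : exists2 v, v \in S & v < 0.
Hypothesis tau_gt0 : 0 < tau.
Hypothesis tau_crit : derive1 (fun x : R => stepV S x) tau = 0.
Hypothesis rhoE : rho = (stepV S tau)^-1.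

Lemma stepV_gt0 (x : R) : 0 < x -> 0 < stepV S x.
Proof.
move=> x0; have [v vS _] := S_neg.
rewrite /stepV (bigD1_seq v) ?fset_uniq //= ltr_pwDl ?exprz_gt0 //.
by apply: sumr_ge0 => w _; rewrite ltW // exprz_gt0.
Qed.

Lemma rho_gt0 : 0 < rho. Proof. by rewrite rhoE invr_gt0 stepV_gt0. Qed.

Lemma is_derive_exprz (x : R) (v : int) : 0 < x ->
  is_derive x 1 (fun y : R => y ^ v) (v%:~R * x ^ (v - 1)).
Proof.
move=> x0; case: v => n.
  have := is_deriveX n (is_derive_id x 1); rewrite exprfctE /= scaler1.
  case: n => [|n]; first by rewrite !mul0r.
  by have -> : n.+1%:Z - 1 = n by lia.
have xn : x ^+ n.+1 != 0 by rewrite expf_neq0 // gt_eqF.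
have D : is_derive x 1 (fun y : R => y ^+ n.+1) (n.+1%:R * x ^+ n).
  by have := is_deriveX n.+1 (is_derive_id x 1); rewrite exprfctE /= scaler1.
have := @is_deriveV R (fun y => y ^+ n.+1) x _ 1 xn D.
set d := (X in is_derive _ _ _ X); suff -> : d = (Negz n)%:~R * x ^ (Negz n - 1) by [].
have -> : Negz n - 1 = - n.+2%:Z by lia.
rewrite /d NegzE -exprnN mulrNz -pmulrn.
by rewrite /GRing.scale /= !exprS; field; rewrite expf_neq0 ?gt_eqF.
Qed.

Lemma critical_sum : \sum_(v <- S) v%:~R * tau ^ v = 0.
Proof.
have D : is_derive tau 1 (fun x : R => stepV S x) (\sum_(v <- S) v%:~R * tau ^ (v - 1)).
  rewrite /stepV; elim: (enum_fset S) => [|v s ih].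
    by rewrite big_nil; under eq_fun do rewrite big_nil; apply: is_derive_cst.
  rewrite big_cons; under eq_fun do rewrite big_cons.
  exact: is_deriveD (is_derive_exprz v tau_gt0) ih.
have := tau_crit; rewrite derive1E (@derive_val _ _ _ _ _ _ _ D) => E.
transitivity ((\sum_(v <- S) v%:~R * tau ^ (v - 1)) * tau); last by rewrite E mul0r.
rewrite mulr_suml; apply: eq_bigr => v _.
by rewrite -mulrA -[X in _ * (_ * X)]expr1z -expfzDr ?gt_eqF // subrK.
Qed.

Lemma bernoulli_nat (x : R) n : 0 <= x -> 1 + n%:R * (x - 1) <= x ^+ n.
Proof.
move=> x0; elim: n => [|n ih]; first by rewrite mul0r addr0 expr0.
rewrite exprS -natr1; apply: le_trans (ler_wpM2l x0 ih).
have : 0 <= n%:R * (x - 1) ^+ 2 by rewrite mulr_ge0 // sqr_ge0.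
by rewrite expr2; lra.
Qed.

(** This tangent inequality replaces the convexity of [V]. For a negative exponent it is applied to
    [x^-1], since [x^-1 - 1 >= - (x - 1)]. *)
Lemma bernoulli_int (x : R) (v : int) : 0 < x -> 1 + v%:~R * (x - 1) <= x ^ v.
Proof.
move=> x0; case: v => n; first by rewrite -pmulrn -exprnP bernoulli_nat // ltW.
rewrite NegzE -exprnN -exprVn mulrNz -pmulrn.
apply: le_trans (bernoulli_nat n.+1 _); last by rewrite invr_ge0 ltW.
have : 0 <= (x - 1) ^+ 2 / x by rewrite divr_ge0 ?sqr_ge0 // ltW.
have -> : (x - 1) ^+ 2 / x = (x^-1 - 1) + (x - 1) by field; rewrite gt_eqF.
move=> h; have := mulr_ge0 (ler0n R n.+1) h.
by set k := n.+1%:R; rewrite -[1 *- _]/(- k); lra.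
Qed.

Lemma bernoulli_neg (x : R) (v : int) : 0 < x -> x != 1 -> v < 0 ->
  1 + v%:~R * (x - 1) < x ^ v.
Proof.
move=> x0 x1; case: v => // n _.
rewrite NegzE -exprnN -exprVn mulrNz -pmulrn.
apply: lt_le_trans (bernoulli_nat n.+1 _); last by rewrite invr_ge0 ltW.
have : 0 < (x - 1) ^+ 2 / x by rewrite divr_gt0 // exprn_even_gt0 //= subr_eq0.
have -> : (x - 1) ^+ 2 / x = (x^-1 - 1) + (x - 1) by field; rewrite gt_eqF.
move=> h; have := mulr_gt0 (ltr0Sn R n) h.
by set k := n.+1%:R; rewrite -[1 *- _]/(- k); lra.
Qed.

(** With [q = x / tau], bound each [q ^ v] below by Bernoulli's inequality; the linear terms add up
    to 0 by [critical_sum], and a negative step makes the inequality strict. *)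
Lemma stepV_min (x : R) : 0 < x -> x != tau -> stepV S tau < stepV S x.
Proof.
move=> x0 xt; pose q := x / tau.
have q0 : 0 < q by rewrite divr_gt0.
have xE : x = tau * q by rewrite /q mulrC divfK ?gt_eqF.
have q1 : q != 1 by apply: contra_neq xt => E; rewrite xE E mulr1.
have tv v : 0 < tau ^ v by apply: exprz_gt0.
have E v : x ^ v = tau ^ v * q ^ v by rewrite xE exprzMl ?unitfE ?gt_eqF.
have -> : stepV S tau = \sum_(v <- S) tau ^ v * (1 + v%:~R * (q - 1)).
  transitivity (stepV S tau + (\sum_(v <- S) v%:~R * tau ^ v) * (q - 1)).
    by rewrite critical_sum mul0r addr0.
  by rewrite mulr_suml -big_split /=; apply: eq_bigr => v _; ring.
have [v vS v0] := S_neg.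
rewrite /stepV (bigD1_seq v) ?fset_uniq //= [ltRHS](bigD1_seq v) ?fset_uniq //=.
apply: ltr_leD; first by rewrite E ltr_pM2l // bernoulli_neg.
by apply: ler_sum => w _; rewrite E ler_pM2l // bernoulli_int.
Qed.

(** The sum is [x V'(x)]. For [q = x / tau < 1] each [v q ^ v] is at most [v], whatever the sign of
    [v], so the comparison with [critical_sum] is termwise. *)
Lemma weighted_sum_lt0 (x : R) : 0 < x < tau -> \sum_(v <- S) v%:~R * x ^ v < 0.
Proof.
move=> /andP[x0 xt]; pose q := x / tau.
have q0 : 0 < q by rewrite divr_gt0.
have q1 : q < 1 by rewrite ltr_pdivrMr // mul1r.
have xE : x = tau * q by rewrite /q mulrC divfK ?gt_eqF.
have tv v : 0 < tau ^ v by apply: exprz_gt0.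
have E v : x ^ v = tau ^ v * q ^ v by rewrite xE exprzMl ?unitfE ?gt_eqF.
have le v : v%:~R * q ^ v <= v%:~R.
  case: v => n; first by rewrite -pmulrn -exprnP ler_piMr // exprn_ile1 // ltW.
  rewrite NegzE -exprnN mulrNz -pmulrn mulNr lerN2 ler_peMr // -invr1.
  by rewrite lef_pV2 ?posrE ?exprn_gt0 // exprn_ile1 // ltW.
have [v vS v0] := S_neg.
have lt : v%:~R * q ^ v < v%:~R.
  case: v v0 {vS} => // n _.
  rewrite NegzE -exprnN mulrNz -pmulrn mulNr ltrN2 ltr_pMr // -invr1.
  by rewrite ltf_pV2 ?posrE ?exprn_gt0 // exprn_ilt1 // ltW.
rewrite -[ltRHS]critical_sum (bigD1_seq v) ?fset_uniq //= [ltRHS](bigD1_seq v) ?fset_uniq //=.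
apply: ltr_leD.
  by rewrite E mulrCA [ltRHS]mulrC ltr_pM2l.
by apply: ler_sum => w _; rewrite E mulrCA [leRHS]mulrC ler_pM2l.
Qed.

End CriticalPoint.

(** * The kernel on the circle of radius [tau] and at [t = rho] *)

Section KernelAtCriticalPoint.
Variables (R : realType) (S : {fset int}) (tau rho : R).
Hypothesis S_neg : exists2 v, v \in S & v < 0.
Hypothesis tau_gt0 : 0 < tau.
Hypothesis tau_crit : derive1 (fun x : R => stepV S x) tau = 0.
Hypothesis rhoE : rho = (stepV S tau)^-1.

Lemma map_stepQ : map_poly (real_complex R) (stepQ S R) = stepQ S R[i].
Proof. by rewrite rmorph_sum /=; apply: eq_bigr => v _; rewrite map_polyXn. Qed.

Lemma map_kernel (t : R) :
  map_poly (real_complex R) (kernel_poly S t) = kernel_poly S t%:C.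
Proof.
by rewrite !kernel_polyE rmorphB /= map_polyZ map_stepQ map_polyXn.
Qed.

Lemma stepQ_real (x : R) : (stepQ S R[i]).[x%:C] = ((stepQ S R).[x])%:C.
Proof. by rewrite -map_stepQ horner_map. Qed.

Lemma kernel_real (t x : R) : (kernel_poly S t%:C).[x%:C] = ((kernel_poly S t).[x])%:C.
Proof. by rewrite -map_kernel horner_map. Qed.

Lemma modc_stepQ (y : R[i]) : modc (stepQ S R[i]).[y] <= (stepQ S R).[modc y].
Proof.
rewrite !horner_sum; apply: le_trans (modc_sum _ _ _) _.
by apply: ler_sum => v _; rewrite !hornerXn modcX.
Qed.

Lemma stepQ_tau : rho * (stepQ S R).[tau] = tau ^+ minv S.
Proof.
rewrite -stepV_Q ?gt_eqF // rhoE mulrCA mulVf ?mulr1 //.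
by rewrite gt_eqF // stepV_gt0.
Qed.

Lemma kernel_rho_tau : (kernel_poly S rho).[tau] = 0.
Proof. by rewrite kernel_polyE !hornerE stepQ_tau subrr. Qed.

(** The coefficients of [Q] are nonnegative, so on the circle [|t Q(y)| <= |t| Q(tau) < rho Q(tau) =
    tau^m = |y^m|]. *)
Lemma kernel_circle_neq0 (t y : R[i]) : modc y = tau -> modc t < rho ->
  (kernel_poly S t).[y] != 0.
Proof.
move=> yt tr; rewrite kernel_polyE !hornerE subr_eq0; apply/eqP => /(congr1 (@modc R)).
rewrite modcX modcM yt => E; have := modc_stepQ y; rewrite yt => h.
have Q0 : 0 < (stepQ S R).[tau].
  by rewrite -stepV_Q ?gt_eqF // mulr_gt0 ?exprn_gt0 ?stepV_gt0.
have : tau ^+ minv S < rho * (stepQ S R).[tau].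
  rewrite E; apply: (@le_lt_trans _ _ (modc t * (stepQ S R).[tau])).
    by rewrite ler_wpM2l ?modc_ge0.
  by rewrite ltr_pM2r.
by rewrite stepQ_tau ltxx.
Qed.

Lemma complexRe_sum (I : Type) (r : seq I) (F : I -> R[i]) :
  complex.Re (\sum_(i <- r) F i) = \sum_(i <- r) complex.Re (F i).
Proof.
elim: r => [|i r ih]; rewrite ?big_nil // !big_cons -ih.
by case: (F i) => a b; case: (\sum_(j <- r) F j).
Qed.

Lemma complexRe_real_mul (x : R) (z : R[i]) :
  complex.Re (x%:C * z) = x * complex.Re z.
Proof. by case: z => a b /=; rewrite mul0r subr0. Qed.

(** The equality case of the triangle inequality: with [y = tau u], the nonnegative terms
    [tau ^ v (1 - Re (u ^ v))] add up to 0, so [u ^ v = 1] for every step. *)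
Lemma kernel_circle_root (y : R[i]) : aperiodic S -> modc y = tau ->
  root (kernel_poly S rho%:C) y -> y = tau%:C.
Proof.
move=> ap yt Py; have y0 : y != 0 by rewrite -modc_gt0 yt.
have t0 : tau%:C != 0 by rewrite -modc_gt0 modc_real // ltW.
have [u yE] : exists u, y = tau%:C * u by exists (y / tau%:C); rewrite mulrC divfK.
have u0 : u != 0 by apply: contraNneq y0 => u0; rewrite yE u0 mulr0.
have u1 : modc u = 1.
  by apply: (mulfI (lt0r_neq0 tau_gt0)); rewrite mulr1 -{2}yt yE modcM modc_real // ltW.
have V1 : rho%:C * stepV S y = 1.
  have := stepV_kernel S rho%:C y0; rewrite (eqP Py) mul0r => /eqP.
  by rewrite subr_eq0 => /eqP.
have r0 := rho_gt0 S_neg tau_gt0 rhoE.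
have rn0 : rho%:C != 0 by rewrite -modc_gt0 modc_real // ltW.
have tz v : tau%:C ^ v = (tau ^ v)%:C.
  by case: v => n; rewrite ?NegzE -?exprnN -?exprnP ?fmorphV rmorphXn.
have : \sum_(v <- S) tau ^ v * (1 - complex.Re (u ^ v)) = 0.
  transitivity (stepV S tau - complex.Re (stepV S y)).
    rewrite /stepV complexRe_sum -sumrB; apply: eq_bigr => v _.
    have -> : y ^ v = (tau ^ v)%:C * u ^ v by rewrite yE exprzMl ?unitfE // tz.
    by rewrite complexRe_real_mul; ring.
  apply/eqP; rewrite subr_eq0 -[stepV S y](mulKf rn0) V1 mulr1 rhoE -fmorphV /=.
  by rewrite invrK.
have ux v : modc (u ^ v) = 1 by rewrite modc_exprz u1 exp1rz.
have Re1 v : complex.Re (u ^ v) <= 1.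
  by rewrite -(ux v) (le_trans (ler_norm _)) // Re_le_modc.
move/eqP; rewrite psumr_eq0 => [/allP H|v _]; last first.
  by rewrite mulr_ge0 ?subr_ge0 ?Re1 // ltW // exprz_gt0.
suff uE : u = 1 by rewrite yE uE mulr1.
apply: (aperiodic_unity S_neg ap u0) => v vS.
have := H v vS; rewrite /= mulf_eq0 gt_eqF ?exprz_gt0 //= subr_eq0 => /eqP E1.
have := modc_Re2Im2 (u ^ v); rewrite ux -E1 !expr1n => /eqP.
rewrite -subr_eq0 opprD addrA subrr sub0r oppr_eq0 sqrf_eq0 => /eqP E2.
by case: (u ^ v) E1 E2 => a b /= <- ->.
Qed.

Lemma kernel_theta (F : fieldType) (t x : F) :
  x * ((kernel_poly S t)^`()).[x] =
  (minv S)%:R * x ^+ minv S - t * \sum_(v <- S) (shifted S v)%:R * x ^+ shifted S v.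
Proof.
have D n : x * (('X^n)^`()).[x] = n%:R * x ^+ n.
  rewrite derivXn hornerMn hornerXn; case: n => [|n]; first by rewrite mulr0n mulr0 mul0r.
  by rewrite /= mulrnAr -exprS mulr_natl.
rewrite kernel_polyE derivB derivZ hornerD hornerN hornerZ mulrBr D mulrCA.
congr (_ - _ * _); rewrite /stepQ raddf_sum horner_sum mulr_sumr.
by apply: eq_bigr => v _; rewrite D.
Qed.

(** At a positive root, [x d/dx] of the kernel thus reduces to [- t x^m] times [x V'(x)], whose sign
    is known. *)
Lemma shifted_sum (x t : R) : 0 < x -> t * (stepQ S R).[x] = x ^+ minv S ->
  (minv S)%:R * x ^+ minv S - t * \sum_(v <- S) (shifted S v)%:R * x ^+ shifted S v =
  - (t * x ^+ minv S * \sum_(v <- S) v%:~R * x ^ v).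
Proof.
move=> x0 E; rewrite -[in (minv S)%:R * _]E horner_sum mulrCA -mulrBr -mulrA -mulrN.
congr (_ * _); rewrite !mulr_sumr -sumrB -sumrN big_seq [RHS]big_seq.
apply: eq_bigr => v vS; rewrite hornerXn.
have -> : x ^+ shifted S v = x ^+ minv S * x ^ v.
  by rewrite exprnP shiftedE // expfzDr ?gt_eqF // mulrC.
have -> : (shifted S v)%:R = v%:~R + (minv S)%:R :> R.
  by rewrite pmulrn shiftedE // intrD.
ring.
Qed.

(** Used only through its consequence that positive roots below [tau] are simple, which isolates the
    principal branch. *)
Lemma kernel_deriv_gt0 (t x : R) : 0 < t -> 0 < x < tau ->
  (kernel_poly S t).[x] = 0 -> 0 < ((kernel_poly S t)^`()).[x].
Proof.
move=> t0 /andP[x0 xt] E; rewrite -(pmulr_rgt0 _ x0) kernel_theta shifted_sum //.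
  rewrite -mulrN mulr_gt0 ?mulr_gt0 ?exprn_gt0 // oppr_gt0.
  by apply: (weighted_sum_lt0 S_neg tau_gt0 tau_crit); rewrite x0.
by move/eqP: E; rewrite kernel_polyE !hornerE subr_eq0 => /eqP.
Qed.

Lemma kernel_rho_positive_root (x : R) : 0 < x -> (kernel_poly S rho).[x] = 0 -> x = tau.
Proof.
move=> x0 E; apply/eqP/negPn/negP => xt.
have := stepV_min S_neg tau_gt0 tau_crit x0 xt.
have := stepV_kernel S rho (lt0r_neq0 x0); rewrite E mul0r => /eqP.
rewrite subr_eq0 rhoE eq_sym => /eqP h.
have V0 := stepV_gt0 S_neg tau_gt0.
by rewrite -[ltLHS]mulr1 -h mulVKf ?ltxx // gt_eqF.
Qed.

(** Both [P_rho] and its derivative vanish at [tau]. The sign of the cofactor comes from applying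
    [x d/dx] twice: the value at [tau] is [2 tau^2 W(tau)], and also [- rho tau^m] times the
    positive sum of the [v^2 tau^v]. *)
Lemma kernel_double_root : exists (H : {poly R[i]}) (h0 : R),
  [/\ 0 < h0, H.[tau%:C] = h0%:C &
      kernel_poly S rho%:C = - (('X - tau%:C%:P) ^+ 2 * H)].
Proof.
pose P := kernel_poly S rho; have r0 := rho_gt0 S_neg tau_gt0 rhoE.
have /factor_theorem[W1 W1E] : root P tau by rewrite rootE kernel_rho_tau.
have P1 : (P^`()).[tau] = 0.
  apply: (mulfI (lt0r_neq0 tau_gt0)); rewrite mulr0 kernel_theta shifted_sum ?stepQ_tau //.
  by rewrite critical_sum // mulr0 oppr0.
have /factor_theorem[W WE] : root W1 tau.
  by move: P1; rewrite W1E derivM derivXsubC !hornerE subrr mulr0 add0r => /eqP.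
have PE : P = W * ('X - tau%:P) ^+ 2 by rewrite W1E WE -mulrA expr2.
pose th (p : {poly R}) := 'X * p^`().
have thX n : th 'X^n = n%:R *: 'X^n.
  rewrite /th derivXn; case: n => [|n]; first by rewrite mulr0n mulr0 scale0r.
  by rewrite mulrnAr -exprS scaler_nat.
have thB p q : th (p - q) = th p - th q by rewrite /th derivB mulrBr.
have thZ c p : th (c *: p) = c *: th p by rewrite /th derivZ scalerAr.
have thS (f : int -> {poly R}) : th (\sum_(v <- S) f v) = \sum_(v <- S) th (f v).
  by rewrite /th raddf_sum mulr_sumr.
have T1 : (th (th P)).[tau] = 2 * tau ^+ 2 * W.[tau].
  have -> : th P = 'X * (W^`() * ('X - tau%:P) + W *+ 2) * ('X - tau%:P).
    by rewrite /th PE derivM expr2 derivM derivXsubC; ring.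
  rewrite /th derivM derivXsubC hornerM hornerX hornerD hornerM hornerXsubC subrr.
  rewrite mulr0 add0r mulr1 hornerM hornerX hornerD hornerM hornerXsubC subrr.
  by rewrite hornerMn; ring.
have T2 : (th (th P)).[tau] = (minv S)%:R ^+ 2 * tau ^+ minv S -
     rho * \sum_(v <- S) (shifted S v)%:R ^+ 2 * tau ^+ shifted S v.
  rewrite /P kernel_polyE thB thZ thS thX thB !thZ thS thX hornerD hornerN !hornerZ.
  rewrite hornerXn horner_sum mulrA -expr2; congr (_ - _ * _); apply: eq_bigr => v _.
  by rewrite thX thZ thX !hornerZ hornerXn mulrA -expr2.
have T3 : (th (th P)).[tau] = - (rho * tau ^+ minv S * \sum_(v <- S) v%:~R ^+ 2 * tau ^ v).
  (* Expanding [(v + m)^2], the [m^2] terms cancel by [stepQ_tau] and the cross terms vanish by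
     [critical_sum]. *)
  rewrite T2; transitivity (- (rho * tau ^+ minv S * \sum_(v <- S) v%:~R ^+ 2 * tau ^ v)
     - 2 * (minv S)%:R * rho * tau ^+ minv S * \sum_(v <- S) v%:~R * tau ^ v); last first.
    by rewrite critical_sum // mulr0 subr0.
  rewrite -[in X in X = _]stepQ_tau horner_sum !mulr_sumr -!sumrN -!big_split /=.
  rewrite big_seq [RHS]big_seq; apply: eq_bigr => v vS.
  rewrite hornerXn.
  have -> : tau ^+ shifted S v = tau ^+ minv S * tau ^ v.
    by rewrite exprnP shiftedE // expfzDr ?gt_eqF // mulrC.
  have -> : (shifted S v)%:R = v%:~R + (minv S)%:R :> R.
    by rewrite pmulrn shiftedE // intrD.
  ring.
have W0 : W.[tau] < 0.
  have : 2 * tau ^+ 2 * W.[tau] < 0.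
    rewrite -T1 T3 oppr_lt0 !mulr_gt0 ?exprn_gt0 //.
    have [v vS v0] := S_neg.
    rewrite (bigD1_seq v) ?fset_uniq //= ltr_pwDl //.
      by rewrite mulr_gt0 ?exprz_gt0 // exprn_even_gt0 //= intr_eq0 lt_eqF.
    by apply: sumr_ge0 => w _; rewrite mulr_ge0 ?sqr_ge0 // ltW // exprz_gt0.
  by rewrite pmulr_rlt0 // mulr_gt0 ?exprn_gt0.
exists (- map_poly (real_complex R) W), (- W.[tau]); split; first by rewrite oppr_gt0.
  by rewrite hornerN horner_map rmorphN.
rewrite -map_kernel -/P PE rmorphM rmorphXn /= map_polyXsubC.
by rewrite mulrN opprK mulrC.
Qed.

(** Expanding the power over all words gives one monomial [(tau u) ^ k] for each word of sum [k];
    the mean keeps those with [k = 0], with weight [tau ^ 0 = 1]. *)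
Lemma bridges_mean n :
  umean (fun u => stepV S (tau%:C * u) ^+ n) (bridges S n)%:R.
Proof.
have t0 : tau%:C != 0 by rewrite -modc_gt0 modc_real // ltW.
pose sw (w : n.-tuple S) : int := \sum_(i < n) val (tnth w i).
have E (y : R[i]) : y != 0 -> stepV S y ^+ n = \sum_(w : n.-tuple S) y ^ (sw w).
  move=> y0; rewrite /stepV big_seq_fsetE /= -[in LHS](card_ord n) -prodr_const.
  rewrite bigA_distr_bigA /=.
  rewrite (reindex (fun w : n.-tuple S => [ffun i => tnth w i])) /=.
    apply: eq_bigr => w _; rewrite /sw.
    under eq_bigr do rewrite ffunE.
    elim: (index_enum _) => [|i r ih]; first by rewrite !big_nil expr0z.
    by rewrite !big_cons ih expfzDr.
  exists (fun f : {ffun 'I_n -> S} => [tuple f i | i < n]) => [w _|f _].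
    by apply: eq_from_tnth => i; rewrite tnth_mktuple ffunE.
  by apply/ffunP => i; rewrite ffunE tnth_mktuple.
have -> : (bridges S n)%:R = \sum_(w : n.-tuple S) tau%:C ^ (sw w) * (sw w == 0)%:R :> R[i].
  rewrite /bridges -sum1_card natr_sum big_mkcond /=; apply: eq_bigr => w _.
  rewrite inE -/(sw w); have [->|_] := eqVneq (sw w) 0; last by rewrite mulr0.
  by rewrite expr0z mulr1.
apply: (@eq_umean _ (fun u => \sum_(w : n.-tuple S) tau%:C ^ (sw w) * u ^ (sw w))).
  move=> u u1; have u0 := modc1_neq0 u1.
  by rewrite E ?mulf_neq0 //; apply: eq_bigr => w _; rewrite exprzMl ?unitfE.
by apply: umean_sum => w _; apply: umeanZ; apply: umeanXz.
Qed.

End KernelAtCriticalPoint.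

(** * Quantitative location of roots of polynomials *)

Section PolynomialEstimates.
Variable R : realType.
Implicit Types (p q P : {poly R[i]}) (y z : R[i]).

Lemma poly_bounded_disc p (r : R) : 0 <= r ->
  exists2 C : R, 0 <= C & forall y, modc y <= r -> modc p.[y] <= C.
Proof.
move=> r0; exists (\sum_(i < size p) modc p`_i * r ^+ i).
  by apply: sumr_ge0 => i _; rewrite mulr_ge0 ?modc_ge0 ?exprn_ge0.
move=> y yr; rewrite horner_coef; apply: le_trans (modc_sum _ _ _) _.
apply: ler_sum => i _; rewrite modcM modcX ler_wpM2l ?modc_ge0 //.
by rewrite lerXn2r ?nnegrE ?modc_ge0.
Qed.

Lemma poly_continuous_at p z (e : R) : 0 < e -> exists2 d : R, 0 < d &
  forall y, modc (y - z) < d -> modc (p.[y] - p.[z]) < e.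
Proof.
move=> e0; have /factor_theorem[w wE] : root (p - p.[z]%:P) z by rewrite rootE !hornerE subrr.
have [C C0 hC] := @poly_bounded_disc w (modc z + 1) (addr_ge0 (modc_ge0 _) ler01).
exists (Num.min 1 (e / (C + 1))); first by rewrite lt_min ltr01 divr_gt0 //; lra.
move=> y; rewrite lt_min => /andP[y1 ye].
have -> : p.[y] - p.[z] = w.[y] * (y - z).
  by have := congr1 (horner^~ y) wE; rewrite /= !hornerE.
have wy : modc w.[y] <= C.
  by apply: hC; have := ler_modcD (y - z) z; rewrite subrK; lra.
move: ye; rewrite ltr_pdivlMr; last lra.
by rewrite modcM; have := modc_ge0 (y - z); nra.
Qed.

Lemma poly_lipschitz p (r : R) : 0 <= r -> exists2 C : R, 0 <= C &
  forall a b, modc a <= r -> modc b <= r -> modc (p.[a] - p.[b]) <= C * modc (a - b).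
Proof.
move=> r0; have X n : exists2 C : R, 0 <= C &
    forall a b : R[i], modc a <= r -> modc b <= r -> modc (a ^+ n - b ^+ n) <= C * modc (a - b).
  elim: n => [|n [C C0 hC]]; first by exists 0 => // a b _ _; rewrite subrr modc0 mul0r.
  exists (r ^+ n + r * C) => [|a b ar br]; first by rewrite addr_ge0 ?mulr_ge0 ?exprn_ge0.
  have -> : a ^+ n.+1 - b ^+ n.+1 = (a - b) * a ^+ n + b * (a ^+ n - b ^+ n).
    by rewrite !exprS; ring.
  apply: le_trans (ler_modcD _ _) _; rewrite !modcM mulrDl lerD //.
    by rewrite mulrC ler_wpM2r ?modc_ge0 // modcX lerXn2r ?nnegrE ?modc_ge0.
  by rewrite -mulrA ler_pM ?modc_ge0 // hC.
have S n : exists2 C : R, 0 <= C & forall a b : R[i], modc a <= r -> modc b <= r ->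
    modc (\sum_(i < n) p`_i * a ^+ i - \sum_(i < n) p`_i * b ^+ i) <= C * modc (a - b).
  elim: n => [|n [C C0 hC]].
    by exists 0 => // a b _ _; rewrite !big_ord0 subrr modc0 mul0r.
  have [D D0 hD] := X n; exists (C + modc p`_n * D) => [|a b ar br].
    by rewrite addr_ge0 ?mulr_ge0 ?modc_ge0.
  rewrite !big_ord_recr /= opprD addrACA -mulrBr mulrDl.
  apply: le_trans (ler_modcD _ _) _; rewrite lerD ?hC // modcM -mulrA.
  by rewrite ler_wpM2l ?modc_ge0 ?hD.
have [C C0 hC] := S (size p); exists C => // a b ar br.
by rewrite !horner_coef hC.
Qed.

Lemma modc_conj z : modc (conjc z) = modc z.
Proof. by apply: complexI; rewrite !modcE normcJ. Qed.

(** A substitute for the implicit function theorem. With [p = W * ('X - x)], subtracting the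
    equations of two roots bounds [(a - b) W(a)] by a small multiple of [|a - b|], while [W(a)]
    stays away from 0. *)
Lemma simple_root_unique p q (x : R[i]) : root p x -> p^`().[x] != 0 ->
  exists2 d : R, 0 < d & forall eps a b : R[i],
    modc eps < d -> modc (a - x) < d -> modc (b - x) < d ->
    root (p + eps *: q) a -> root (p + eps *: q) b -> a = b.
Proof.
move=> /factor_theorem[W WE] Dx.
have Wx : 0 < modc W.[x].
  move: Dx; rewrite WE derivM derivXsubC hornerD hornerM hornerXsubC subrr mulr0 add0r.
  by rewrite mulr1 modc_gt0.
have rad0 : 0 <= modc x + 1 by rewrite addr_ge0 ?modc_ge0.
have [CQ CQ0 hCQ] := poly_lipschitz q rad0; have [CW CW0 hCW] := poly_lipschitz W rad0.
have w20 : 0 < modc W.[x] / 4 by rewrite divr_gt0.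
have [d1 d10 hd1] := poly_continuous_at W x w20.
have CW1 : 0 < CW + 1 by lra.
have CQ1 : 0 < CQ + 1 by lra.
(* Each of the two terms on the right of [key] is then at most a quarter of [|W(x)| |a - b|],
   against more than three quarters on the left. *)
exists (Num.min (Num.min 1 d1) (Num.min (modc W.[x] / 4 / (CW + 1)) (modc W.[x] / 4 / (CQ + 1)))).
  by rewrite !lt_min ltr01 d10 !divr_gt0.
move=> eps a b; rewrite !lt_min => /andP[_ /andP[_ epsQ]] /andP[/andP[a1 ad] _].
move=> /andP[/andP[b1 _] /andP[bW _]] ra rb.
have bd w : modc (w - x) < 1 -> modc w <= modc x + 1.
  by move=> hw; have := ler_modcD (w - x) x; rewrite subrK; lra.
have Psp w : root (p + eps *: q) w -> W.[w] * (w - x) = - (eps * q.[w]).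
  rewrite rootE hornerD hornerZ WE hornerM hornerXsubC addr_eq0 => /eqP.
  by [].
have key : (a - b) * W.[a] = eps * (q.[b] - q.[a]) - (W.[a] - W.[b]) * (b - x).
  have -> : eps * (q.[b] - q.[a]) = - (eps * q.[a]) - - (eps * q.[b]) by ring.
  by rewrite -(Psp a ra) -(Psp b rb); ring.
apply/eqP; rewrite -subr_eq0 -modc_eq0; apply/negPn/negP => nz.
have zp : 0 < modc (a - b) by rewrite lt_neqAle eq_sym nz modc_ge0.
have lo : modc W.[x] * (3 / 4) < modc W.[a].
  have := hd1 a ad; have := ler_modcDB W.[x] (W.[a] - W.[x]).
  by rewrite [W.[x] + _]addrC subrK; lra.
have := congr1 (@modc R) key; rewrite modcM => E.
have := ler_modcB (eps * (q.[b] - q.[a])) ((W.[a] - W.[b]) * (b - x)).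
rewrite -E !modcM => up.
have u1 : modc eps * modc (q.[b] - q.[a]) <= modc W.[x] / 4 * modc (a - b).
  apply: (@le_trans _ _ (modc eps * ((CQ + 1) * modc (a - b)))).
    rewrite ler_wpM2l ?modc_ge0 // [modc (a - b)]modcB.
    apply: le_trans (hCQ _ _ (bd _ b1) (bd _ a1)) _.
    by rewrite ler_wpM2r ?modc_ge0 // lerDl.
  by rewrite mulrA ler_pM2r // -ler_pdivlMr // ltW.
have u2 : modc (W.[a] - W.[b]) * modc (b - x) <= modc W.[x] / 4 * modc (a - b).
  apply: (@le_trans _ _ ((CW + 1) * modc (a - b) * modc (b - x))).
    rewrite ler_wpM2r ?modc_ge0 //; apply: le_trans (hCW _ _ (bd _ a1) (bd _ b1)) _.
    by rewrite ler_pM2r // lerDl.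
  by rewrite mulrAC ler_pM2r // mulrC -ler_pdivlMr // ltW.
have : modc (a - b) * (modc W.[x] * (3 / 4)) < modc (a - b) * modc W.[a].
  by rewrite ltr_pM2l.
have : 0 < modc W.[x] * modc (a - b) by rewrite mulr_gt0.
lra.
Qed.

Lemma root_near P z (e : R) : P != 0 -> 0 < e ->
  modc P.[z] < modc (lead_coef P) * e ^+ (size P).-1 ->
  exists2 w, root P w & modc (z - w) < e.
Proof.
move=> P0 e0; have [rs PE] := closed_field_poly_normal P.
have lcn : lead_coef P != 0 by rewrite lead_coef_eq0.
have -> : (size P).-1 = size rs by rewrite [in LHS]PE size_scale // size_prod_XsubC.
rewrite [X in modc X < _](_ : _ = lead_coef P * \prod_(w <- rs) (z - w)); last first.
  rewrite [in LHS]PE hornerZ horner_prod; congr (_ * _).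
  by apply: eq_bigr => w _; rewrite hornerXsubC.
rewrite modcM ltr_pM2l ?modc_gt0 // modc_prod => lt.
have [/hasP[w wr wz]|/hasPn far] := boolP (has (fun w => modc (z - w) < e) rs).
  by exists w => //; rewrite PE rootZ // root_prod_XsubC.
exfalso; move: lt; rewrite ltNge => /negP; apply.
elim: rs {PE} far => [|w rs ih] far; first by rewrite big_nil expr0.
rewrite big_cons exprS ler_pM ?exprn_ge0 ?(ltW e0) //.
  by rewrite leNgt far ?mem_head.
by apply: ih => x xr; apply: far; rewrite inE xr orbT.
Qed.

Lemma small_value_near_root P (e : R) : P != 0 -> 0 < e -> exists2 d : R, 0 < d &
  forall y, modc P.[y] < d -> exists2 z, root P z & modc (y - z) < e.
Proof.
move=> P0 e0; exists (modc (lead_coef P) * e ^+ (size P).-1).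
  by rewrite mulr_gt0 ?exprn_gt0 // modc_gt0 lead_coef_eq0.
by move=> y; apply: root_near.
Qed.

(** The factor 2 leaves room: a point of modulus between [tau - e] and [tau] cannot be within [e] of
    an element of [s] other than [w]. *)
Lemma moduli_gap (s : seq R[i]) (w : R[i]) (tau : R) : 0 < tau ->
  (forall z, z \in s -> modc z = tau -> z = w) ->
  exists e : R, [/\ 0 < e, e < tau & forall z, z \in s -> z != w ->
    modc z <= tau - 2 * e \/ tau + 2 * e <= modc z].
Proof.
move=> t0; elim: s => [|x s ih] h.
  by exists (tau / 2); split=> //; lra.
have [|e [e0 et he]] := ih; first by move=> z zs; apply: h; rewrite inE zs orbT.
have [xw|xw] := eqVneq x w.
  exists e; split=> // z; rewrite inE => /orP[/eqP ->|zs]; last exact: he.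
  by rewrite xw eqxx.
have xt : 0 < `|modc x - tau|.
  rewrite normr_gt0 subr_eq0; apply: contra_neq xw; apply: h.
  exact: mem_head.
exists (Num.min e (`|modc x - tau| / 2)).
have m1 : Num.min e (`|modc x - tau| / 2) <= e by rewrite ge_min lexx.
have m2 : Num.min e (`|modc x - tau| / 2) <= `|modc x - tau| / 2.
  by rewrite ge_min lexx orbT.
split=> [||z]; first by rewrite lt_min e0 divr_gt0.
  exact: le_lt_trans et.
rewrite inE => /orP[/eqP -> _|zs zw].
  have [le|lt] := lerP (modc x) tau.
    have nE : `|modc x - tau| = tau - modc x by rewrite ler0_norm ?subr_le0 // opprB.
    by left; rewrite nE in m2 *; lra.
  have nE : `|modc x - tau| = modc x - tau by rewrite gtr0_norm ?subr_gt0.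
  by right; rewrite nE in m2 *; lra.
by have [?|?] := he z zs zw; [left|right]; lra.
Qed.

Lemma sqrtc_Re_ge0 (x : R[i]) : 0 <= complex.Re (sqrtc x).
Proof. by case: x => a b /=; apply: sqrtr_ge0. Qed.

Lemma complexReD (x y : R[i]) : complex.Re (x + y) = complex.Re x + complex.Re y.
Proof. by case: x => a b; case: y => c d. Qed.

(** [Re (s^2) > 0] means [|Im s| < |Re s|]; the constant 2 is a convenient bound for the square root
    of 2. *)
Lemma modc_le_2Re (s : R[i]) : 0 <= complex.Re s -> 0 < complex.Re (s ^+ 2) ->
  modc s <= 2 * complex.Re s /\ 0 < complex.Re s.
Proof.
move=> s0; have := modc_Re2Im2 s; case: s s0 => a b /= a0 E.
move=> h; have m0 := modc_ge0 (a +i* b); rewrite !expr2 in E.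
split; last by rewrite lt_neqAle a0 andbT eq_sym; apply: contraTneq h => ->; rewrite -leNgt; nra.
rewrite leNgt; apply/negP => lt; nra.
Qed.

End PolynomialEstimates.

(** * Expansion near [rho] of the sum over the roots in the disc *)

Section SingularExpansion.
Variables (R : realType) (m : nat) (Q H : {poly R[i]}) (tau rho h0 : R).
Hypothesis m_gt0 : (0 < m)%N.
Hypothesis tau_gt0 : 0 < tau.
Hypothesis rho_gt0 : 0 < rho.
Hypothesis h0_gt0 : 0 < h0.
Hypothesis Qtau : rho%:C * Q.[tau%:C] = tau%:C ^+ m.
Hypothesis Htau : H.[tau%:C] = h0%:C.
Definition perturbed (t : R[i]) : {poly R[i]} := 'X^m - t *: Q.
Local Notation P := perturbed.
Hypothesis PE : P rho%:C = - (('X - tau%:C%:P) ^+ 2 * H).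
Hypothesis P_circle : forall t y, modc y = tau -> modc t < rho -> (P t).[y] != 0.
Hypothesis P_circle_rho : forall y, modc y = tau -> root (P rho%:C) y -> y = tau%:C.

Definition crit_val : R := tau ^+ m / rho.
Local Notation q0 := crit_val.
Definition split_root : R := Num.sqrt (q0 / h0).
Local Notation xi := split_root.
(** With [xi = 4 del] and [|s| <= 2 Re s], a point [x] of the disc of radius [del] about [- xi]
    satisfies [Re (s x) <= - del |s|], so that [tau + s x] is inside the circle for small [s]. *)
Definition split_radius : R := xi / 4.
Local Notation del := split_radius.

Lemma crit_val_gt0 : 0 < q0. Proof. by rewrite divr_gt0 ?exprn_gt0. Qed.

Lemma split_root_gt0 : 0 < xi. Proof. by rewrite sqrtr_gt0 divr_gt0 ?crit_val_gt0. Qed.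

Lemma split_root_sqr : xi ^+ 2 * h0 = q0.
Proof.
have qh : 0 <= q0 / h0 by rewrite divr_ge0 // ltW // crit_val_gt0.
by rewrite /xi (sqr_sqrtr qh) divfK // gt_eqF.
Qed.

Lemma horner_crit_val : Q.[tau%:C] = q0%:C.
Proof.
have r0 : rho%:C != 0 by rewrite -modc_gt0 modc_real // ltW.
by apply: (mulfI r0); rewrite Qtau -rmorphM /= mulrC divfK ?gt_eqF // rmorphXn.
Qed.

Lemma P_rho_neq0 : P rho%:C != 0.
Proof.
rewrite PE oppr_eq0 mulf_neq0 ?expf_neq0 ?polyXsubC_eq0 //.
have : H.[tau%:C] != 0 by rewrite Htau -modc_gt0 modc_real // ltW.
by apply: contraNneq => ->; rewrite horner0.
Qed.

Lemma P_split (t y : R[i]) : (P t).[y] = (P rho%:C).[y] + (rho%:C - t) * Q.[y].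
Proof. by rewrite /perturbed !hornerE; ring. Qed.

(* In the variable [x] given by [y = tau + s x] the two roots of [P t] that
   merge at [tau] are separated: they lie near [xi] and [- xi]. *)
Lemma P_local (t s x : R[i]) : s ^+ 2 = rho%:C - t ->
  (P t).[tau%:C + s * x] =
  s ^+ 2 * (Q.[tau%:C + s * x] - x ^+ 2 * H.[tau%:C + s * x]).
Proof.
move=> s2; rewrite P_split PE -s2 hornerN hornerM horner_exp hornerXsubC.
by rewrite [tau%:C + _]addrC addrK; ring.
Qed.

(** A root of [P t] in the thin annulus makes [P_rho] small, so it is near a root of [P_rho], which
    can only be [tau]; then [x^2] is close to [xi^2], and [x] near [xi] would give a modulus above
    [tau]. Conversely, the small disc lies in the annulus once [s] is small. *)
Lemma roots_near_circle : exists e r : R, [/\ 0 < e, e < tau, 0 < r,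
  forall z, root (P rho%:C) z -> modc z < tau -> modc z < tau - e &
  forall t y : R[i], modc t < rho -> modc (rho%:C - t) < r -> root (P t) y ->
    let s := sqrtc (rho%:C - t) in
    (tau - e < modc y < tau) =
    (modc (y - (tau%:C + s * - xi%:C)) < modc (s * del%:C))].
Proof.
have xi0 := split_root_gt0; have P0 := P_rho_neq0.
have hs z : z \in croots (P rho%:C) -> modc z = tau -> z = tau%:C.
  by rewrite mem_croots // => zr zt; apply: P_circle_rho.
have [e [e0 et he]] := moduli_gap tau_gt0 hs.
(* [M] vanishes at [tau], and at a root [M(y) = (x^2 - xi^2) H(y)]; its smallness forces [x] near
   [xi] or [- xi]. *)
pose M := Q - (xi ^+ 2)%:C *: H.
have Mt : M.[tau%:C] = 0.
  by rewrite /M !hornerE horner_crit_val Htau -rmorphM /= split_root_sqr subrr.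
have del0 : 0 < del by rewrite divr_gt0.
have k1 : 0 < del ^+ 2 * (h0 / 2) by rewrite mulr_gt0 ?exprn_gt0 ?divr_gt0.
have k2 : 0 < h0 / 2 by rewrite divr_gt0.
have [d1 d10 hd1] := poly_continuous_at M tau%:C k1.
have [d2 d20 hd2] := poly_continuous_at H tau%:C k2.
pose ep := Num.min e (Num.min d1 d2).
have ep0 : 0 < ep by rewrite !lt_min e0 d10 d20.
have [et0 het0 hroot] := small_value_near_root P0 ep0.
have [CQ CQ0 hCQ] := poly_bounded_disc Q (ltW tau_gt0).
(* For [|x| <= 5 del], the first bound gives [|s x| < e] and the second [|s x|^2 < 2 tau del |s|],
   which is needed to compare [|tau + s x|] with [tau]. *)
pose sm := Num.min (e / (2 * xi)) (8 * tau / (25 * xi)).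
have sm0 : 0 < sm.
  by rewrite lt_min; apply/andP; split; rewrite divr_gt0 ?mulr_gt0.
exists e, (Num.min (et0 / (CQ + 1)) (sm ^+ 2)); split=> //.
by rewrite lt_min !(divr_gt0, exprn_gt0) //; lra.
move=> z zr zt; have zr' : z \in croots (P rho%:C) by rewrite mem_croots.
  have zw : z != tau%:C by apply: contraTneq zt => ->; rewrite modc_real ?ltxx // ltW.
  by have [?|?] := he z zr' zw; lra.
move=> t y tr; rewrite lt_min => /andP[tr1 tr2] Py s.
have s2 : s ^+ 2 = rho%:C - t by apply: sqr_sqrtc.
have rt : rho%:C - t != 0.
  rewrite subr_eq0; apply: contraTneq tr => <-.
  by rewrite modc_real ?ltxx // ltW.
have s0 : s != 0 by apply: contraNneq rt => s0; rewrite -s2 s0 expr0n.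
have ms0 : 0 < modc s by rewrite modc_gt0.
have msm : modc s < sm.
  rewrite ltNge; apply/negP => le; move: tr2; rewrite -s2 modcX ltNge => /negP; apply.
  by rewrite lerXn2r ?nnegrE ?modc_ge0 // ltW.
have [msR Rs0] : modc s <= 2 * complex.Re s /\ 0 < complex.Re s.
  apply: modc_le_2Re; first exact: sqrtc_Re_ge0.
  rewrite s2 complexReD /=.
  have := Re_le_modc t; have := ler_norm (complex.Re t).
  by case: (t) tr => a b /= ?; lra.
pose x := (y - tau%:C) / s; have yE : y = tau%:C + s * x.
  by rewrite /x mulrC divfK // addrC subrK.
have xE : x ^+ 2 * H.[y] = Q.[y].
  have /eqP := Py; rewrite yE (P_local _ s2) => /eqP.
  by rewrite mulf_eq0 expf_eq0 /= (negbTE s0) subr_eq0 -yE => /eqP.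
have -> : y - (tau%:C + s * - xi%:C) = s * (x + xi%:C) by rewrite yE; ring.
rewrite !modcM modc_real ?(ltW del0) // ltr_pM2l //.
have ReM (w : R[i]) : `|complex.Re (s * w)| <= modc s * modc w.
  by rewrite -modcM Re_le_modc.
have Resxi : complex.Re (s * xi%:C) = xi * complex.Re s.
  by rewrite mulrC; case: (s) => a b /=; rewrite mul0r subr0.
have delE : xi = 4 * del by rewrite /del mulrC divfK.
apply/idP/idP => [/andP[y1 y2]|xd].
  have Pr : modc (P rho%:C).[y] < et0.
    have /eqP := P_split t y; rewrite (eqP Py) eq_sym addr_eq0 => /eqP ->.
    rewrite modcN modcM; move: tr1; rewrite ltr_pdivlMr; last lra.
    have := hCQ y (ltW y2); have := modc_ge0 (rho%:C - t); have := modc_ge0 Q.[y].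
    by nra.
  have [z zr yz] := hroot y Pr.
  move: yz; rewrite !lt_min => /and3P[yze yzd1 yzd2].
  have zt : z = tau%:C.
    apply/eqP/negPn/negP => zt; have := he z; rewrite mem_croots // zr zt.
    have := ler_modcD (y - z) z; rewrite subrK.
    have := ler_modcB y (y - z); rewrite opprB addrC subrK.
    by move=> a b /(_ isT isT) [|]; lra.
  rewrite zt in yzd1 yzd2.
  have := hd1 y yzd1; have := hd2 y yzd2; rewrite Mt Htau subr0 => b1 b2.
  have Hy : h0 / 2 < modc H.[y].
    have := ler_modcDB h0%:C (H.[y] - h0%:C); rewrite modc_real ?(ltW h0_gt0) //.
    by rewrite [h0%:C + _]addrC subrK; lra.
  have xx : modc (x - xi%:C) * modc (x + xi%:C) < del ^+ 2.
    have : modc M.[y] = modc (x - xi%:C) * modc (x + xi%:C) * modc H.[y].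
      rewrite -!modcM /M !hornerE -xE; congr modc.
      by rewrite rmorphXn /=; ring.
    have := modc_ge0 (x - xi%:C); have := modc_ge0 (x + xi%:C).
    move=> n1 n2 E; rewrite ltNge; apply/negP => le.
    have n3 : 0 <= modc (x - xi%:C) * modc (x + xi%:C) by rewrite mulr_ge0.
    have := exprn_gt0 2 del0; nra.
  rewrite ltNge; apply/negP => le.
  have xs : modc (x - xi%:C) < del.
    by rewrite ltNge; apply/negP => le'; move: xx; rewrite expr2; nra.
  have : tau < modc y; last by lra.
  (* Near [xi] the real part of [s x] is positive, because [xi Re s >= 2 del |s|]. *)
  apply: lt_le_trans (le_trans (ler_norm _) (Re_le_modc y)).
  have -> : y = tau%:C + (s * xi%:C + s * (x - xi%:C)) by rewrite yE; ring.
  rewrite !complexReD Resxi /=; have := ReM (x - xi%:C).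
  by rewrite ler_norml => /andP[? _]; nra.
pose w := s * x; have yw : y = tau%:C + w by [].
have mx : modc x <= 5 * del.
  have := ler_modcB (x + xi%:C) xi%:C; rewrite addrK modc_real ?(ltW xi0) //.
  lra.
have mw : modc w <= modc s * (5 * del) by rewrite modcM ler_wpM2l ?modc_ge0.
move: msm; rewrite lt_min !ltr_pdivlMr ?mulr_gt0 // => /andP[sm1 sm2].
have me : modc w < e by have := modc_ge0 w; nra.
apply/andP; split.
  have := ler_modcDB tau%:C w; rewrite -yw modc_real ?(ltW tau_gt0) //; lra.
have Rw : complex.Re w <= - (del * modc s).
  have -> : w = - (s * xi%:C) + s * (x + xi%:C) by rewrite /w; ring.
  rewrite complexReD; have := ReM (x + xi%:C).
  have -> : complex.Re (- (s * xi%:C)) = - (xi * complex.Re s).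
    by rewrite -Resxi; case: (s * xi%:C).
  by rewrite ler_norml => /andP[_ ?]; nra.
rewrite -(ltr_pXn2r (n := 2)) ?nnegrE ?modc_ge0 ?(ltW tau_gt0) //.
have yE2 : modc y ^+ 2 = tau ^+ 2 + 2 * tau * complex.Re w + modc w ^+ 2.
  rewrite !modc_Re2Im2 yw; case: (w) => a b /=; rewrite add0r; ring.
rewrite yE2; have mw0 := modc_ge0 w; rewrite !expr2.
have ww := ler_pM mw0 mw0 mw mw.
have k0 : 0 < del * modc s by rewrite mulr_gt0.
have t1 : tau * complex.Re w <= tau * - (del * modc s) by rewrite ler_pM2l.
have t2 : del * modc s * (25 * (del * modc s)) < del * modc s * (2 * tau).
  by rewrite ltr_pM2l //; move: sm2; rewrite delE; lra.
lra.
Qed.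

Lemma urat_affine (p : {poly R[i]}) (c d : R[i]) : urat (fun u => p.[c + d * u]).
Proof.
apply: eq_urat (urat_poly (p \Po (c%:P + d *: 'X))) => u _.
by rewrite horner_comp !hornerE.
Qed.

(* The contribution of the roots that stay inside the circle of radius [q]. *)
Lemma inner_expansion (q : R) : 0 < q ->
  (forall z, root (P rho%:C) z -> modc z != q) ->
  exists (r : R) (N : nat -> R[i]), [/\ 0 < r,
    umean (fun u => (q%:C * u) ^+ m / (P rho%:C).[q%:C * u]) (N 0%N) &
    forall t s : R[i], s ^+ 2 = rho%:C - t -> modc s < r ->
      (forall z, root (P t) z -> modc z != q) /\
      forall v, umean (fun u => (q%:C * u) ^+ m / (P t).[q%:C * u]) v ->
        series (fun n => N n * s ^+ n : (R[i])^o) @ \oo --> (v : (R[i])^o)].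
Proof.
move=> q_gt0 av.
(* Since [P t = P_rho + s^2 Q], the denominator only has coefficients of index 0 and 2 in [s],
   whence [D = 3] below. *)
pose f j (u : R[i]) : R[i] := if j is 0%N then (q%:C * u) ^+ m else 0.
pose p j (u : R[i]) : R[i] := if j is 0%N then (P rho%:C).[q%:C * u] else
  if j is 2%N then Q.[q%:C * u] else 0.
have af (w : {poly R[i]}) : urat (fun u => w.[q%:C * u]).
  by apply: eq_urat (urat_affine w 0 q%:C) => u _; rewrite add0r.
have qn0 : q%:C != 0 by rewrite -modc_gt0 modc_real // ltW.
have [||||u u1|r [N [r0 hN0 hN]]] := @umean_quotient_series R 3 f p.
case=> [|j]; last exact: urat_cst.
  by apply: eq_urat (af 'X^m) => u _; rewrite hornerXn.
case=> [|[|[|j]]]; rewrite /p; try exact: urat_cst; exact: af.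
by case.
by case=> [|[|[|j]]].
have := av (q%:C * u); rewrite modcM u1 mulr1 modc_real ?(ltW q_gt0) // eqxx.
  by rewrite /p rootE => h; apply/negP => /h.
exists r, N; split=> // [|t s s2 sr].
  by apply: eq_umean (hN0 0%N) => u u1.
have ps u : psum 3 (p^~ u) s = (P t).[q%:C * u].
  rewrite /psum !big_nat_recr //= big_geq // (P_split t) -s2 /p.
  by rewrite expr0; ring.
have fs u : psum 3 (f^~ u) s = (q%:C * u) ^+ m.
  by rewrite /psum !big_nat_recr //= big_geq // /f !mul0r expr0 mulr1 add0r !addr0.
have [pn hv] := hN s sr; split=> [z zr|v vm].
  apply/eqP => zq; have u1 : modc (z / q%:C) = 1.
    by rewrite modcM modcV zq modc_real ?(ltW q_gt0) // divff ?gt_eqF.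
  have := pn _ u1; rewrite ps [q%:C * _]mulrC divfK //.
  by rewrite (eqP zr) eqxx.
by apply: hv; apply: eq_umean vm => u _; rewrite ps fs.
Qed.

(** In the coefficient of [s], the residues in [x] at [xi] and [- xi] are equal by oddness, and
    their sum is read off at infinity, where [Q - x^2 H] behaves like [- x^2 H]: this is why the
    second Taylor coefficient of [G / (- H)] at [tau] appears, halved. *)
Lemma local_expansion (G : {poly R[i]}) :
  exists (r : R) (N : nat -> R[i]), [/\ 0 < r,
    N 1%N = 2^-1 * qcoef (fun j => (shiftp tau%:C G)`_j)
                         (fun j => (shiftp tau%:C (- H))`_j) 1 &
    forall t s : R[i], s ^+ 2 = rho%:C - t -> s != 0 -> modc s < r ->
      (forall z, root (P t) z ->
         modc (z - (tau%:C + s * - xi%:C)) != modc (s * del%:C)) /\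
      forall v, umean (fun u => s * del%:C * u *
          (G.[tau%:C + s * - xi%:C + s * del%:C * u] /
           (P t).[tau%:C + s * - xi%:C + s * del%:C * u])) v ->
        series (fun n => N n * s ^+ n : (R[i])^o) @ \oo --> (s * v : (R[i])^o)].
Proof.
have xi0 := split_root_gt0; have del0 : 0 < del by rewrite divr_gt0.
have delE : xi = 4 * del by rewrite /del mulrC divfK.
pose x (u : R[i]) : R[i] := - xi%:C + del%:C * u.
pose g := shiftp tau%:C G; pose k := shiftp tau%:C Q; pose h := shiftp tau%:C H.
pose D := (size g + size k + size h)%N.
(* [f j] and [p j] are the coefficients of [s ^ j] after the substitution; the factor [del u] is
   what remains of [s del u] once multiplied by [s] and divided by the [s^2] of [P_local]. *)
pose f j (u : R[i]) : R[i] := del%:C * u * g`_j * x u ^+ j.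
pose p j (u : R[i]) : R[i] := (k`_j - x u ^+ 2 * h`_j) * x u ^+ j.
have xr j : urat (fun u => x u ^+ j).
  apply: eq_urat (urat_affine 'X^j (- xi%:C) del%:C) => u _.
  by rewrite hornerXn.
have k00 : k`_0 = q0%:C by rewrite -horner_coef0 horner_shiftp addr0 horner_crit_val.
have h00 : h`_0 = h0%:C by rewrite -horner_coef0 horner_shiftp addr0 Htau.
have g0 j : (D <= j)%N -> g`_j = 0.
  by move=> jD; apply: nth_default; apply: leq_trans jD; rewrite /D -addnA leq_addr.
have k0 j : (D <= j)%N -> k`_j = 0.
  by move=> jD; apply: nth_default; apply: leq_trans jD; rewrite /D addnAC leq_addl.
have h0' j : (D <= j)%N -> h`_j = 0.
  by move=> jD; apply: nth_default; apply: leq_trans jD; rewrite /D leq_addl.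
have dC : del%:C != 0 by rewrite -modc_gt0 modc_real // ltW.
have xiC : xi%:C != 0 by rewrite -modc_gt0 modc_real // ltW.
have hC : h0%:C != 0 by rewrite -modc_gt0 modc_real // ltW.
have mdu u : modc u = 1 -> modc (del%:C * u) = del.
  by move=> u1; rewrite modcM u1 mulr1 modc_real // ltW.
have xm u : modc u = 1 -> x u + xi%:C != 0.
  by move=> u1; rewrite /x addrAC addNr add0r -modc_gt0 mdu.
have xp u : modc u = 1 -> x u - xi%:C != 0.
  move=> u1; rewrite -modc_gt0; have := ler_modcDB (- (2 * xi)%:C) (del%:C * u).
  rewrite modcN modc_real ?mdu //; last by rewrite mulr_ge0 // ltW.
  have -> : - (2 * xi)%:C + del%:C * u = x u - xi%:C by rewrite /x rmorphM /= rmorph_nat; ring.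
  by lra.
have p0E u : p 0%N u = - h0%:C * ((x u + xi%:C) * (x u - xi%:C)).
  by rewrite /p k00 h00 -split_root_sqr rmorphM rmorphXn /= expr0; ring.
have p00 u : modc u = 1 -> p 0%N u != 0.
  by move=> u1; rewrite p0E !mulf_neq0 ?oppr_eq0 ?xm ?xp.
have [||||//|r [N [r0 hN0 hN]]] := @umean_quotient_series R D f p.
move=> j; apply: uratM => //; apply: eq_urat (urat_affine (g`_j *: 'X) 0 del%:C) => u _.
  by rewrite hornerZ hornerX add0r; ring.
move=> j; apply: uratM => //; apply: uratB; first exact: urat_cst.
  by apply: uratM => //; apply: urat_cst.
by move=> j u jD; rewrite /f g0 // mulr0 mul0r.
by move=> j u jD; rewrite /p k0 // h0' // mulr0 subrr mul0r.
have sumx (w : {poly R[i]}) (u s : R[i]) : (size w <= D)%N ->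
    \sum_(0 <= j < D) w`_j * x u ^+ j * s ^+ j = w.[s * x u].
  move=> wD; rewrite (horner_coef_wide _ wD) big_mkord; apply: eq_bigr => j _.
  by rewrite exprMn; ring.
have ps u s : psum D (p^~ u) s = Q.[tau%:C + s * x u] - x u ^+ 2 * H.[tau%:C + s * x u].
  rewrite -!horner_shiftp -!sumx; first last.
  by rewrite /D addnAC leq_addl.
  by rewrite /D leq_addl.
  rewrite mulr_sumr -sumrB; apply: eq_bigr => j _.
  by rewrite /p; ring.
have fs u s : psum D (f^~ u) s = del%:C * u * G.[tau%:C + s * x u].
  rewrite -horner_shiftp -sumx; last by rewrite /D -addnA leq_addr.
  by rewrite mulr_sumr; apply: eq_bigr => j _; rewrite /f; ring.
exists r, N; split=> //.
  set c1 := qcoef _ _ _.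
  have c1E : c1 = - (g`_1 - g`_0 / h0%:C * h`_1) / h0%:C.
    rewrite /c1 /qcoef /= /shiftp -/(shiftp _ _).
    have -> : (- H) \Po ('X + (tau%:C)%:P) = - h by rewrite /h /shiftp rmorphN.
    by rewrite !coefN h00 -/g; field.
  (* [be] is the coefficient of the double pole at [- xi]; by oddness the one at [xi] is its
     opposite. Double poles do not contribute to the mean. *)
  pose be := - (g`_0 / h0%:C ^+ 2) * (k`_1 - xi%:C ^+ 2 * h`_1) / (- 4 * xi%:C).
  apply: (umean_unique (hN0 1%N)).
  have A0 : umean (fun u => del%:C * u / (- xi%:C + del%:C * u - - xi%:C) ^+ 1) 1.
    by apply: (@umean_pole_in R (- xi%:C) del%:C (- xi%:C) 0); rewrite subrr modc0 modc_real // ltW.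
  have A1 : umean (fun u => del%:C * u / (- xi%:C + del%:C * u - - xi%:C) ^+ 2) 0.
    by apply: (@umean_pole_in R (- xi%:C) del%:C (- xi%:C) 1); rewrite subrr modc0 modc_real // ltW.
  have out n : umean (fun u => del%:C * u / (- xi%:C + del%:C * u - xi%:C) ^+ n.+1) 0.
    apply: umean_pole_out; rewrite opprK -rmorphD /= !modc_real ?addr_ge0 ?(ltW del0) ?(ltW xi0) //.
    by lra.
  have -> : 2^-1 * c1 = 2^-1 * c1 * (1 + 0) + be * (0 - 0) by ring.
  apply: eq_umean (umeanD (umeanZ _ (umeanD A0 (out 0%N))) (umeanZ be (umeanB A1 (out 1%N)))).
  move=> u u1; rewrite /qcoef /= p0E /f /p.
  have u0 := modc1_neq0 u1; have n1 := xm u u1; have n2 := xp u u1.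
  rewrite -[- xi%:C + _]/(x u) opprK c1E /be.
  have -> : del%:C * u = x u + xi%:C by rewrite /x; ring.
  have two : (2 : R[i]) != 0 by rewrite pnatr_eq0.
  by rewrite !expr0 !expr1; field; rewrite ?n1 ?n2 ?hC ?xiC ?two.
move=> t s s2 s0 sr; have [pn hv] := hN s sr.
have yE u : tau%:C + s * - xi%:C + s * del%:C * u = tau%:C + s * x u by rewrite /x; ring.
split=> [z zr|v vm].
  apply/eqP => E; pose u := (z - (tau%:C + s * - xi%:C)) / (s * del%:C).
  have sd : s * del%:C != 0 by rewrite mulf_neq0.
  have u1 : modc u = 1 by rewrite modcM modcV E divff // gt_eqF ?modc_gt0.
  have zE : z = tau%:C + s * x u by rewrite -yE /u [s * del%:C * _]mulrC divfK //; ring.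
  have := pn u u1; rewrite ps => /negP; apply.
  have /eqP := zr; rewrite zE (P_local _ s2) => /eqP.
  by rewrite mulf_eq0 expf_eq0 (negbTE s0).
apply: hv; apply: eq_umean (umeanZ s vm) => u u1.
rewrite ps fs yE (P_local _ s2); have := pn u u1; rewrite ps => n1.
by field; rewrite s0 n1.
Qed.

(** The disc of radius [tau] is cut into that of radius [q = tau - e], treated by [inner_expansion],
    and an annulus, whose roots [roots_near_circle] identifies with those of a small disc around
    [tau - s xi]. One family of Cauchy weights for [P t] serves all three circles. *)
Lemma mean_expansion : exists a : int -> R[i],
  (exists2 r : R, 0 < r & forall t : R[i], modc t < rho -> modc (t - rho%:C) < r ->
     forall v, umean (fun u => (tau%:C * u) ^+ m / (P t).[tau%:C * u]) v ->
       series (fun n : nat => a (n%:Z - 1) * sqrtc (rho%:C - t) ^ (n%:Z - 1)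
                 : (R[i])^o) @ \oo --> (v : (R[i])^o)) /\
  forall c, residue_weights 'X^(m.-1) (P rho%:C) c ->
    a 0 = 2^-1 * c tau%:C + \sum_(z <- croots (P rho%:C) | modc z < tau) c z.
Proof.
pose G : {poly R[i]} := 'X^(m.-1).
have iE (i : nat) : i.+1%:Z - 1 = i%:Z by rewrite -addn1 PoszD addrK.
have GE y : y * G.[y] = y ^+ m by rewrite /G hornerXn -exprS prednK.
have [e [r1 [e0 et r10 inner annulus]]] := roots_near_circle.
pose q := tau - e; have q_gt0 : 0 < q by rewrite subr_gt0.
have qt : q < tau by rewrite /q; lra.
have avq z : root (P rho%:C) z -> modc z != q.
  move=> zr; apply: contraTneq isT => zq.
  by have := inner z zr; rewrite zq qt ltxx => /(_ isT).
have [r2 [Ne [r20 hNe0 hNe]]] := inner_expansion q_gt0 avq.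
have [r3 [N [r30 hN1 hN]]] := local_expansion G.
(* The local series expands [s] times the local sum, hence its indices are shifted by one with
   respect to those of the inner series. *)
pose a (j : int) : R[i] := match j with
  | Posz n => N n.+1 + Ne n | Negz _ => N 0%N end.
exists a; split; last first.
  move=> c hc; rewrite /a /= hN1; congr (_ * _ + _).
    pose F y : R[i] := G.[y] / ((y - tau%:C) ^+ 2 * (- H).[y]).
    have Ht : (- H).[tau%:C] != 0 by rewrite hornerN oppr_eq0 Htau -modc_gt0 modc_real // ltW.
    have res := @is_residue_quotient R F tau%:C 2 G (- H) 1 ltr01 Ht (fun _ _ => erefl).
    apply: (is_residue_weight P_rho_neq0 _ ltr01 _ hc res).
      by rewrite rootE PE hornerN hornerM horner_exp hornerXsubC subrr expr0n mul0r oppr0.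
    move=> y _; rewrite /F; congr (_ / _).
    have -> : P rho%:C = ('X - tau%:C%:P) ^+ 2 * - H by rewrite PE mulrN.
    by rewrite hornerM horner_exp hornerXsubC.
  apply: (umean_unique hNe0).
  have avq' z : root (P rho%:C) z -> modc (z - 0) != modc q%:C.
    by move=> zr; rewrite subr0 modc_real ?(ltW q_gt0) // avq.
  have := hc 0 q%:C avq'; rewrite modc_real ?(ltW q_gt0) //.
  have -> : \sum_(z <- croots (P rho%:C) | modc (z - 0) < q) c z =
            \sum_(z <- croots (P rho%:C) | modc z < tau) c z.
    rewrite big_seq_cond [RHS]big_seq_cond; apply: eq_bigl => z.
    rewrite subr0; case: (boolP (z \in _)) => //=; rewrite mem_croots ?P_rho_neq0 // => zr.
    by apply/idP/idP => [/lt_trans ->//|/(inner z zr)].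
  by apply: eq_umean => u _; rewrite add0r mulrA GE.
exists (Num.min r1 (Num.min r2 r3 ^+ 2)).
  by rewrite lt_min r10 exprn_gt0 // lt_min r20.
move=> t tr; rewrite lt_min modcB => /andP[tr1 tr2] v vm.
set s := sqrtc _; have s2 : s ^+ 2 = rho%:C - t by apply: sqr_sqrtc.
have rt : rho%:C - t != 0.
  by rewrite subr_eq0; apply: contraTneq tr => <-; rewrite modc_real ?ltxx // ltW.
have s0 : s != 0 by apply: contraNneq rt => s0; rewrite -s2 s0 expr0n.
have : modc s < Num.min r2 r3.
  rewrite ltNge; apply/negP => le; move: tr2; rewrite -s2 modcX ltNge => /negP; apply.
  by rewrite lerXn2r ?nnegrE ?modc_ge0 // ltW // lt_min r20.
rewrite lt_min => /andP[sr2 sr3].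
have Pt0 : P t != 0.
  have := @P_circle t tau%:C (modc_real (ltW tau_gt0)) tr.
  by apply: contraNneq => ->; rewrite horner0.
have [c hc] := rational_means G Pt0.
have avt z : root (P t) z -> modc (z - 0) != modc tau%:C.
  move=> zr; rewrite subr0 modc_real ?(ltW tau_gt0) //.
  by apply: contraTneq zr => zt; rewrite rootE P_circle.
have [avq2 hE] := hNe t s s2 sr2.
have avq' z : root (P t) z -> modc (z - 0) != modc q%:C.
  by move=> zr; rewrite subr0 modc_real ?(ltW q_gt0) // avq2.
have [avl hL] := hN t s s2 s0 sr3.
have mT := hc 0 tau%:C avt; have mQ := hc 0 q%:C avq'.
have mL := hc (tau%:C + s * - xi%:C) (s * del%:C) avl.
set L := (X in umean _ X) in mL; set Ei := (X in umean _ X) in mQ.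
have vE : v = Ei + L.
  apply: (umean_unique vm).
  have <- : \sum_(z <- croots (P t) | modc (z - 0) < modc tau%:C) c z = Ei + L.
    rewrite /Ei /L big_seq_cond [X in _ = X + _]big_seq_cond [X in _ = _ + X]big_seq_cond.
    rewrite !modc_real ?(ltW tau_gt0) ?(ltW q_gt0) //.
    rewrite big_mkcond [X in _ = X + _]big_mkcond [X in _ = _ + X]big_mkcond -big_split /=.
    apply: eq_bigr => z _; case: (boolP (z \in _)) => /=; last by rewrite addr0.
    rewrite mem_croots // => zr; rewrite subr0 -(annulus t z tr tr1 zr).
    have := avq2 z zr; rewrite -/q; case: (ltgtP (modc z) q) => //= zq _.
      by rewrite (lt_trans zq qt) addr0.
    by rewrite add0r.
  by apply: eq_umean mT => u _; rewrite add0r mulrA GE.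
have mE : series (fun n => Ne n * s ^+ n : (R[i])^o) @ \oo --> (Ei : (R[i])^o).
  by apply: hE; apply: eq_umean mQ => u _; rewrite add0r mulrA GE.
have {}mL := hL _ mL.
apply/cvg_modcP => ep ep0; rewrite vE.
have ms0 : 0 < modc s by rewrite modc_gt0.
have [k1 hk1] := (cvg_modcP _ _).2 mE _ (divr_gt0 ep0 (ltr0Sn _ 1)).
have [k2 hk2] := (cvg_modcP _ _).2 mL _ (mulr_gt0 ms0 (divr_gt0 ep0 (ltr0Sn _ 1))).
(* A partial sum of [n + 1] terms stops at the exponent [n - 1]: it uses [n + 1] coefficients of [N]
   but only [n] of [Ne]. *)
exists (maxn k1 k2).+1 => -[//|n]; rewrite ltnS geq_max => /andP[/hk1 l1 n2].
have {}l2 := hk2 n.+1 (leqW n2).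
have -> : Ei + L - series (fun n : nat => a (n%:Z - 1) * s ^ (n%:Z - 1) : (R[i])^o) n.+1 =
   (Ei - series (fun n => Ne n * s ^+ n : (R[i])^o) n) +
   s^-1 * (s * L - series (fun n => N n * s ^+ n : (R[i])^o) n.+1).
  rewrite /series /= big_nat_recl //= [in RHS]big_nat_recl //=.
  rewrite mulrBr mulKf // mulrDr mulr_sumr expr0 mulr1 exprN1.
  have -> : \sum_(0 <= i < n) a (i.+1%:Z - 1) * s ^ (i.+1%:Z - 1) =
     \sum_(0 <= i < n) s^-1 * (N i.+1 * s ^+ i.+1) + \sum_(0 <= i < n) Ne i * s ^+ i.
    rewrite -big_split; apply: eq_bigr => i _; rewrite iE /a /=.
    by rewrite -exprnP exprS; field.
  by rewrite /a /=; ring.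
apply: le_trans (ler_modcD _ _) _; rewrite modcM modcV.
have : (modc s)^-1 * modc (s * L - series (fun n => N n * s ^+ n : (R[i])^o) n.+1) <= ep / 2.
  by rewrite ler_pdivrMl.
by move: l1; lra.
Qed.

(** Both roots have coordinates [xa], [xb] near [- xi] with [x^2 H(y) = Q(y)]. On subtracting,
    [xa - xb] has a factor bounded below on one side and of order [s] on the other. This will
    prevent a second branch from reaching [tau]. *)
Lemma unique_root_near_circle : exists e r : R, [/\ 0 < e, 0 < r &
  forall t a b : R[i], modc t < rho -> modc (rho%:C - t) < r ->
    root (P t) a -> root (P t) b ->
    tau - e < modc a < tau -> tau - e < modc b < tau -> a = b].
Proof.
have [e [r1 [e0 et r10 _ annulus]]] := roots_near_circle.
have xi0 := split_root_gt0; have del0 : 0 < del by rewrite divr_gt0.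
have delE : xi = 4 * del by rewrite /del mulrC divfK.
have k2 : 0 < h0 / 2 by rewrite divr_gt0.
have [d2 d20 hd2] := poly_continuous_at H tau%:C k2.
have rad0 : 0 <= tau + d2 by rewrite addr_ge0 // ltW.
have [CQ CQ0 hCQ] := poly_lipschitz Q rad0.
have [CH CH0 hCH] := poly_lipschitz H rad0.
pose C := CQ + (5 * del) ^+ 2 * CH + 1.
have C0 : 0 < C.
  have : 0 <= (5 * del) ^+ 2 * CH by rewrite mulr_ge0 // sqr_ge0.
  by rewrite /C; lra.
pose sm := Num.min (d2 / (5 * del)) (del * h0 / C).
have sm0 : 0 < sm.
  by rewrite lt_min; apply/andP; split; rewrite divr_gt0 ?mulr_gt0.
exists e, (Num.min r1 (sm ^+ 2)); split=> //; first by rewrite lt_min r10 exprn_gt0.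
move=> t a b tr; rewrite lt_min => /andP[tr1 tr2] ra rb ha hb.
move: ha hb; rewrite (annulus t a tr tr1 ra) (annulus t b tr tr1 rb).
set s := sqrtc _; have s2 : s ^+ 2 = rho%:C - t by apply: sqr_sqrtc.
have rt : rho%:C - t != 0.
  by rewrite subr_eq0; apply: contraTneq tr => <-; rewrite modc_real ?ltxx // ltW.
have s0 : s != 0 by apply: contraNneq rt => s0; rewrite -s2 s0 expr0n.
have ms0 : 0 < modc s by rewrite modc_gt0.
have : modc s < sm.
  rewrite ltNge; apply/negP => le; move: tr2; rewrite -s2 modcX ltNge => /negP; apply.
  by rewrite lerXn2r ?nnegrE ?modc_ge0 // ltW.
rewrite lt_min !ltr_pdivlMr ?mulr_gt0 // => /andP[sm1 sm2].
have loc y : root (P t) y -> modc (y - (tau%:C + s * - xi%:C)) < modc (s * del%:C) ->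
    exists x, [/\ y = tau%:C + s * x, x ^+ 2 * H.[y] = Q.[y], modc (x + xi%:C) < del,
      modc x <= 5 * del & modc (y - tau%:C) < d2].
  move=> ry hy; exists ((y - tau%:C) / s); set x := _ / s.
  have yE : y = tau%:C + s * x by rewrite /x mulrC divfK // addrC subrK.
  have hx : modc (x + xi%:C) < del.
    move: hy; have -> : y - (tau%:C + s * - xi%:C) = s * (x + xi%:C) by rewrite yE; ring.
    by rewrite !modcM (modc_real (ltW del0)) ltr_pM2l.
  have mx : modc x <= 5 * del.
    have := ler_modcB (x + xi%:C) xi%:C; rewrite addrK (modc_real (ltW xi0)); lra.
  split=> //; last first.
    have -> : y - tau%:C = s * x by rewrite yE addrC addKr.
    by rewrite modcM; apply: le_lt_trans sm1; rewrite ler_pM2l.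
  have /eqP := ry; rewrite yE (P_local _ s2) => /eqP.
  by rewrite mulf_eq0 expf_eq0 /= (negbTE s0) subr_eq0 -yE => /eqP.
move=> /(loc a ra)[xa [aE Ea ha ma da]] /(loc b rb)[xb [bE Eb hb mb db]].
have bd y : modc (y - tau%:C) < d2 -> modc y <= tau + d2.
  by move=> hy; have := ler_modcD (y - tau%:C) tau%:C; rewrite subrK (modc_real (ltW tau_gt0)); lra.
suff xx : xa = xb by rewrite aE bE xx.
apply/eqP; rewrite -subr_eq0 -modc_eq0; apply/negPn/negP => nz.
have xp : 0 < modc (xa - xb) by rewrite lt_neqAle eq_sym nz modc_ge0.
have ab : modc (a - b) = modc s * modc (xa - xb).
  by rewrite -modcM aE bE; congr modc; ring.
have hQ := hCQ a b (bd _ da) (bd _ db); have hH := hCH a b (bd _ da) (bd _ db).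
rewrite ab in hQ hH.
have key : (xa - xb) * (xa + xb) * H.[a] = Q.[a] - Q.[b] - xb ^+ 2 * (H.[a] - H.[b]).
  by rewrite -Ea -Eb; ring.
have Ha : h0 / 2 < modc H.[a].
  have := hd2 a da; rewrite Htau => h.
  have := ler_modcDB h0%:C (H.[a] - h0%:C); rewrite (modc_real (ltW h0_gt0)).
  by rewrite [h0%:C + _]addrC subrK; lra.
have xs : 2 * del <= modc (xa + xb).
  have := ler_modcDB (- (2 * xi)%:C) ((xa + xi%:C) + (xb + xi%:C)).
  have -> : - (2 * xi)%:C + (xa + xi%:C + (xb + xi%:C)) = xa + xb.
    by rewrite rmorphM /= rmorph_nat; ring.
  rewrite modcN modc_real; last by rewrite mulr_ge0 // ltW.
  by have := ler_modcD (xa + xi%:C) (xb + xi%:C); lra.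
have up : modc ((xa - xb) * (xa + xb) * H.[a]) <= modc s * modc (xa - xb) * C.
  rewrite key; apply: le_trans (ler_modcB _ _) _; rewrite modcM modcX.
  have t1 : modc xb ^+ 2 * modc (H.[a] - H.[b]) <=
      (5 * del) ^+ 2 * (CH * (modc s * modc (xa - xb))).
    by rewrite ler_pM ?modc_ge0 ?exprn_ge0 // ?modc_ge0 // lerXn2r // nnegrE ?modc_ge0 // mulr_ge0 // ltW.
  have t2 : 0 <= modc s * modc (xa - xb) by rewrite mulr_ge0 // modc_ge0.
  by rewrite /C; lra.
have low : modc (xa - xb) * (del * h0) <= modc ((xa - xb) * (xa + xb) * H.[a]).
  rewrite !modcM -mulrA ler_pM2l //.
  have -> : del * h0 = 2 * del * (h0 / 2) by field.
  by rewrite ler_pM ?(ltW Ha) ?mulr_ge0 ?invr_ge0 // ltW.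
have : modc (xa - xb) * (modc s * C) < modc (xa - xb) * (del * h0) by rewrite ltr_pM2l.
by lra.
Qed.

End SingularExpansion.

(** * Tools for counting roots inside a circle *)

Section RootCount.
Variable R : realType.

Lemma geometric_remainder (a : R[i]) (th : R) k : modc a <= th -> th < 1 ->
  1 - a != 0 /\
  modc ((1 - a)^-1 - \sum_(0 <= n < k) a ^+ n) <= (1 - th)^-1 * th ^+ k.
Proof.
move=> at1 th1; have a0 := modc_ge0 a.
have lo : 1 - th <= modc (1 - a).
  by have := ler_modcDB 1 (- a); rewrite modc1 modcN; lra.
have nz : 1 - a != 0 by rewrite -modc_gt0; lra.
split=> //; have -> : (1 - a)^-1 - \sum_(0 <= n < k) a ^+ n = (1 - a)^-1 * a ^+ k.
  apply: (mulfI nz); rewrite mulrBr mulVKf // divff // big_mkord.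
  by rewrite -[1 - a]opprB mulNr -subrX1; ring.
rewrite modcM modcV modcX ler_pM ?invr_ge0 ?modc_ge0 ?exprn_ge0 ?modc_ge0 //.
  by rewrite lef_pV2 ?posrE ?modc_gt0 //; lra.
by rewrite lerXn2r ?nnegrE ?modc_ge0 // (le_trans a0).
Qed.

Lemma log_deriv_roots (c : R[i]) (rs : seq R[i]) (y : R[i]) : c != 0 ->
  (forall z, z \in rs -> y - z != 0) ->
  let P := c *: \prod_(z <- rs) ('X - z%:P) in
  P^`().[y] / P.[y] = \sum_(z <- rs) (y - z)^-1.
Proof.
move=> c0 yz P.
have -> : P^`().[y] / P.[y] = (\prod_(z <- rs) ('X - z%:P))^`().[y] /
                              (\prod_(z <- rs) ('X - z%:P)).[y].
  by rewrite /P derivZ !hornerZ -mulf_div divff // mul1r.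
elim: rs yz {P} => [|z rs ih] yz.
  by rewrite !big_nil -[1]/(1%:P) derivC horner0 mul0r.
rewrite !big_cons derivM derivXsubC mul1r hornerD !hornerM hornerXsubC -ih; last first.
  by move=> w wr; apply: yz; rewrite inE wr orbT.
have n1 := yz z (mem_head _ _).
have n2 : (\prod_(j <- rs) ('X - j%:P)).[y] != 0.
  rewrite horner_prod prodf_seq_neq0; apply/allP => w wr /=.
  by rewrite hornerXsubC yz // inE wr orbT.
by field; rewrite n1 n2.
Qed.

(* The argument principle on a circle centred at the origin. *)
Lemma root_count (c : R[i]) (rs : seq R[i]) (d : R) : c != 0 -> 0 < d ->
  (forall z, z \in rs -> modc z != d) ->
  let P := c *: \prod_(z <- rs) ('X - z%:P) in
  umean (fun u => d%:C * u * (P^`().[d%:C * u] / P.[d%:C * u]))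
    (count (fun z => modc z < d) rs)%:R.
Proof.
move=> c0 d0 av P; have md : modc d%:C = d by rewrite modc_real // ltW.
have -> : (count (fun z => modc z < d) rs)%:R =
    \sum_(z <- rs | z \in rs) (modc z < d)%R%:R :> R[i].
  by rewrite -big_seq -sum1_count natr_sum big_mkcond; apply: eq_bigr => z _; case: ifP.
apply: (@eq_umean _ (fun u => \sum_(z <- rs | z \in rs)
          (d%:C * u / (0 + d%:C * u - z) ^+ 1))).
  move=> u u1; rewrite /P log_deriv_roots // => [|z /av zd].
    by rewrite mulr_sumr -big_seq; apply: eq_bigr => z _; rewrite add0r.
  rewrite subr_eq0; apply: contra_neq zd => <-.
  by rewrite modcM u1 mulr1 md.
apply: umean_sum => z /av; case: ltgtP => // zd _.
  by apply: (@umean_pole_in R 0 d%:C z 0); rewrite subr0 md.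
by apply: umean_pole_out; rewrite subr0 md.
Qed.

(** The integrand is [y d/dy] of [T / y^M], which has no constant term. *)
Lemma umean_theta_laurent (T : {poly R[i]}) (M : nat) (d : R) : 0 < d ->
  umean (fun u => (d%:C * u * T^`().[d%:C * u] - M%:R * T.[d%:C * u]) /
                  (d%:C * u) ^+ M) 0.
Proof.
move=> d0; have dn : d%:C != 0 by rewrite -modc_gt0 modc_real // ltW.
pose c (i : nat) : R[i] := (i%:R - M%:R) * T`_i * d%:C ^ (i%:Z - M%:Z).
have -> : 0 = \sum_(i < size T) c i * (i%:Z - M%:Z == 0)%:R :> R[i].
  rewrite big1 // => i _; rewrite /c subr_eq0 eqz_nat.
  by have [->|_] := eqVneq (i : nat) M; rewrite ?mulr0 // subrr !mul0r.
apply: (@eq_umean _ (fun u => \sum_(i < size T) c i * u ^ (i%:Z - M%:Z))).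
  move=> u u1; have u0 := modc1_neq0 u1; set y := d%:C * u.
  have y0 : y != 0 by rewrite mulf_neq0.
  have -> : y * T^`().[y] = \sum_(i < size T) i%:R * T`_i * y ^+ i.
    have E : T = \sum_(i < size T) T`_i *: 'X^i.
      by rewrite -[LHS]coefK poly_def.
    rewrite [in LHS]E raddf_sum horner_sum mulr_sumr; apply: eq_bigr => i _ /=.
    rewrite derivZ derivXn hornerZ hornerMn hornerXn; case: (i : nat) => [|j] /=.
      by rewrite mulr0n !mul0r !mulr0.
    by rewrite exprS -mulr_natl; ring.
  rewrite horner_coef mulr_sumr -sumrB mulr_suml; apply: eq_bigr => i _.
  have -> : c i * u ^ (i%:Z - M%:Z) = (i%:R - M%:R) * T`_i * y ^ (i%:Z - M%:Z).
    by rewrite /c /y exprzMl ?unitfE // mulrA.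
  by rewrite expfzDr // -exprnP -exprnN; ring.
by apply: umean_sum => i _; apply: umeanZ; apply: umeanXz.
Qed.

End RootCount.

(** * Continuity arguments along a real segment *)

Section RealInduction.
Variable R : realType.

(** Connectedness of the interval, for a property that holds near 0 and is open and closed. The
    proof takes the supremum of the [t <= t0] such that [A] holds on all of []0, t]]. *)
Lemma real_induction (b : R) (A : R -> Prop) :
  (exists2 d, 0 < d & forall t, 0 < t < d -> t < b -> A t) ->
  (forall t, 0 < t < b -> A t -> exists2 d, 0 < d &
     forall t', 0 < t' < b -> `|t' - t| < d -> A t') ->
  (forall t, 0 < t < b ->
     (forall d, 0 < d -> exists t', [/\ 0 < t' < b, `|t' - t| < d & A t']) -> A t) ->
  forall t, 0 < t < b -> A t.
Proof.
move=> [d0 d00 base] op cl t0 /andP[t00 t0b]; apply/not_notP => nA.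
pose E : set R := [set t | 0 < t /\ t <= t0 /\ forall s, 0 < s <= t -> A s].
have E0 : E (Num.min (d0 / 2) t0).
  split; first by rewrite lt_min t00 divr_gt0.
  split; first by rewrite ge_min lexx orbT.
  move=> s /andP[s0]; rewrite le_min => /andP[sd st]; apply: base; last lra.
  by rewrite s0 /=; lra.
have hub : has_ubound E by exists t0 => t [_ [? _]].
have hs : has_sup E by split => //; exists (Num.min (d0 / 2) t0).
pose c := sup E.
have c0 : 0 < c.
  apply: lt_le_trans (ub_le_sup hub E0).
  by rewrite lt_min t00 divr_gt0.
have ct0 : c <= t0 by apply: ge_sup; [exists (Num.min (d0 / 2) t0)|move=> t [_ []]].
have cb : 0 < c < b by rewrite c0 (le_lt_trans ct0).
have below s : 0 < s < c -> A s.
  move=> /andP[s0 sc]; have cs0 : 0 < c - s by rewrite subr_gt0.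
  have [x [_ [_ hx]] sx] := sup_adherent cs0 hs.
  by apply: hx; rewrite s0 /=; move: sx; rewrite -/c; lra.
have Ac : A c.
  apply: cl => // d dp; exists (c - Num.min (d / 2) (c / 2)).
  have m1 : Num.min (d / 2) (c / 2) <= d / 2 by rewrite ge_min lexx.
  have m2 : Num.min (d / 2) (c / 2) <= c / 2 by rewrite ge_min lexx orbT.
  have m3 : 0 < Num.min (d / 2) (c / 2) by rewrite lt_min !divr_gt0.
  case/andP: cb => _ cb'; split.
  by apply/andP; split; lra.
  by rewrite ler0_norm; lra.
  by apply: below; apply/andP; split; lra.
have [d dp hd] := op c cb Ac.
have [ctE|ct] := eqVneq c t0; first by apply: nA; rewrite -ctE.
have ct1 : c < t0 by rewrite lt_neqAle ct.
have : E (Num.min (c + d / 2) t0).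
  split; first by rewrite lt_min t00 andbT; lra.
  split; first by rewrite ge_min lexx orbT.
  move=> s /andP[s0]; rewrite le_min => /andP[s1 s2].
  have [sc|cs] := ltP s c; first by apply: below; rewrite s0.
  apply: hd; first by rewrite s0 /=; lra.
  by rewrite ger0_norm; lra.
move/(ub_le_sup hub); rewrite -/c leNgt lt_min ct1 andbT => /negP; apply.
lra.
Qed.

Lemma within_continuous_eps (b : R) (f : R -> R[i]) :
  {within `]0, b], continuous (f : R -> (R[i])^o)} ->
  forall t, 0 < t <= b -> forall e : R, 0 < e -> exists2 d : R, 0 < d &
    forall t', 0 < t' <= b -> `|t' - t| < d -> modc (f t' - f t) < e.
Proof.
move=> /subspace_continuousP cf t tb e e0.
have /cf /cvgrPdist_lt /(_ e%:C) : `]0, b]%classic t by rewrite /= in_itv.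
rewrite ltcR => /(_ e0); rewrite near_withinE => /nbhs_ballP[d /= d0 h].
exists d => // t' tb' td; have := h t'; rewrite /ball /= distrC => /(_ td).
by rewrite in_itv /= => /(_ tb'); rewrite -modcE ltcR modcB.
Qed.

Lemma at_right_eps (f : R -> R[i]) :
  (f : R -> (R[i])^o) t @[t --> 0^'+] --> (0 : (R[i])^o) ->
  forall e : R, 0 < e -> exists2 d : R, 0 < d & forall t, 0 < t < d -> modc (f t) < e.
Proof.
move=> /cvgrPdist_lt cf e e0; have := cf e%:C; rewrite ltcR => /(_ e0).
rewrite near_withinE => /nbhs_ballP[d /= d0 h].
exists d => // t /andP[t0 td]; have := h t; rewrite /ball /= sub0r normrN gtr0_norm //.
by move=> /(_ td t0); rewrite sub0r normrN -modcE ltcR.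
Qed.

End RealInduction.

(** * The small branches and the roots in the disc *)

Section SmallBranches.
Variables (R : realType) (S : {fset int}) (tau rho : R) (y : nat -> R -> R[i]).
Hypothesis S_neg : exists2 v, v \in S & v < 0.
Hypothesis S_pos : exists2 v, v \in S & 0 < v.
Hypothesis S_aper : aperiodic S.
Hypothesis tau_gt0 : 0 < tau.
Hypothesis tau_crit : derive1 (fun x : R => stepV S x) tau = 0.
Hypothesis rhoE : rho = (stepV S tau)^-1.
Hypothesis y_small : small_branches S rho y.
Hypothesis y_first : principal_first y.
Local Notation m := (minv S).
Local Notation Q := (stepQ S R[i]).
Local Notation P t := (kernel_poly S (t : R[i])).
Let rho0 : 0 < rho := rho_gt0 S_neg tau_gt0 rhoE.

Lemma circle_stepV (t u : R[i]) : modc u = 1 ->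
  modc (t * stepV S (tau%:C * u)) <= modc t / rho.
Proof.
move=> u1; have u0 := modc1_neq0 u1.
have tn : tau%:C != 0 by rewrite -modc_gt0 modc_real // ltW.
have yn : tau%:C * u != 0 by rewrite mulf_neq0.
have my : modc (tau%:C * u) = tau by rewrite modcM u1 mulr1 modc_real // ltW.
rewrite modcM ler_wpM2l ?modc_ge0 //.
have /(congr1 (@modc R)) := stepV_Q S yn; rewrite modcM modcX my => E.
have tm : 0 < tau ^+ m by rewrite exprn_gt0.
rewrite -(ler_pM2l tm) E; apply: le_trans (modc_stepQ S _) _; rewrite my.
by rewrite -(stepQ_tau S_neg tau_gt0 rhoE) [X in _ <= X]mulrAC mulrV ?mul1r // unitfE gt_eqF.
Qed.

Lemma kernel_neq0 (t : R[i]) : t != 0 -> P t != 0.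
Proof.
move=> t0; apply: contraNneq t0 => E; have := kernel_poly_0 S_neg t.
by rewrite E horner0 => /esym/eqP; rewrite oppr_eq0.
Qed.

Lemma realC_neq0 (t : R) : 0 < t -> t%:C != 0.
Proof. by move=> t0; rewrite -modc_gt0 modc_real // ltW. Qed.

Lemma branch_root k (t : R) : (1 <= k <= m)%N -> 0 < t <= rho -> root (P t%:C) (y k t).
Proof.
move=> km tr; case: y_small => _ _ /(_ k t km tr)[y0 E] _; move: E.
rewrite stepV_kernel // => /eqP; rewrite mulf_eq0 invr_eq0 expf_eq0 (negbTE y0) andbF orbF.
by [].
Qed.

Lemma branch_neq0 k (t : R) : (1 <= k <= m)%N -> 0 < t <= rho -> y k t != 0.
Proof. by move=> km tr; case: y_small => _ _ /(_ k t km tr)[]. Qed.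

Lemma branch_continuous k (t : R) : (1 <= k <= m)%N -> 0 < t <= rho ->
  forall e : R, 0 < e -> exists2 d : R, 0 < d &
    forall t', 0 < t' <= rho -> `|t' - t| < d -> modc (y k t' - y k t) < e.
Proof.
by move=> km; case: y_small => /(_ k km) c _ _ _; apply: within_continuous_eps.
Qed.

Lemma ltW_itv (t : R) : 0 < t < rho -> 0 < t <= rho.
Proof. by move=> /andP[-> /ltW]. Qed.

(** A branch starts at 0 and moves continuously, and the kernel has no root on the circle as long as
    [t < rho]. *)
Lemma branch_inside k (t : R) : (1 <= k <= m)%N -> 0 < t < rho -> modc (y k t) < tau.
Proof.
move=> km; move: t; apply: real_induction.
case: y_small => _ /(_ k km) /at_right_eps /(_ tau tau_gt0) [d d0 h] _ _.
  by exists d => // t td _; apply: h.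
move=> t tr lt; have e0 : 0 < tau - modc (y k t) by rewrite subr_gt0.
  have [d d0 h] := branch_continuous km (ltW_itv tr) e0; exists d => // t' tr' td.
  have := h t' (ltW_itv tr') td; have := ler_modcD (y k t' - y k t) (y k t).
  by rewrite subrK; lra.
move=> t tr H; case: (ltgtP (modc (y k t)) tau) => // [gt|eq].
    have e0 : 0 < modc (y k t) - tau by rewrite subr_gt0.
    have [d d0 h] := branch_continuous km (ltW_itv tr) e0.
    have [t' [tr' td lt]] := H d d0; have := h t' (ltW_itv tr') td.
    have := ler_modcB (y k t') (y k t' - y k t); rewrite opprB addrC subrK; lra.
  have mt : modc t%:C < rho by case/andP: tr => t0 t1; rewrite modc_real // ltW.
  have := kernel_circle_neq0 S_neg tau_gt0 rhoE eq mt.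
  by have := branch_root km (ltW_itv tr); rewrite rootE => ->.
Qed.

(** With [W = y V'(y)], the argument principle gives [m - N] as [t] times the mean of
    [W / (1 - t V)]. The geometric series turns this into means of
    [W V^n = y d/dy (V^(n+1)) / (n+1)], which all vanish. *)
Lemma inner_root_count (t : R) (c : R[i]) rs : 0 < t < rho -> c != 0 ->
  P t%:C = c *: \prod_(z <- rs) ('X - z%:P) ->
  count (fun z => modc z < tau) rs = m.
Proof.
move=> /andP[t0 tr] c0 PE.
have tC := realC_neq0 t0; have mt : modc t%:C = t by rewrite modc_real // ltW.
have tauC := realC_neq0 tau_gt0.
have mty u : modc u = 1 -> modc (tau%:C * u) = tau.
  by move=> u1; rewrite modcM u1 mulr1 modc_real // ltW.
have Pn u : modc u = 1 -> (P t%:C).[tau%:C * u] != 0.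
  by move=> u1; rewrite (kernel_circle_neq0 S_neg tau_gt0 rhoE) ?mty ?mt.
have av z : z \in rs -> modc z != tau.
  move=> zr; apply/eqP => zt; have := kernel_circle_neq0 S_neg tau_gt0 rhoE zt.
  move=> /(_ t%:C); rewrite mt => /(_ tr) /negP; apply.
  by rewrite -rootE PE rootZ // root_prod_XsubC.
have := root_count c0 tau_gt0 av; rewrite /= -PE; set N := count _ _ => hN.
pose V u := stepV S (tau%:C * u).
pose W u := (tau%:C * u * Q^`().[tau%:C * u] - m%:R * Q.[tau%:C * u]) / (tau%:C * u) ^+ m.
have VE u : modc u = 1 -> V u = Q.[tau%:C * u] / (tau%:C * u) ^+ m.
  move=> u1; have yn : tau%:C * u != 0 by rewrite mulf_neq0 // modc1_neq0.
  by rewrite /V -(stepV_Q S yn) [_ ^+ m * _]mulrC mulfK // expf_neq0.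
have Wu : urat W.
  have af (w : {poly R[i]}) : urat (fun u => w.[tau%:C * u]).
    by apply: eq_urat (urat_affine w 0 tau%:C) => u _; rewrite add0r.
  apply: uratM.
    apply: uratB; last by apply: uratM; [exact: urat_cst|exact: af].
    by apply: uratM => //; apply: eq_urat (af 'X) => u _; rewrite hornerX.
  apply: uratV => [|u u1]; first by apply: eq_urat (af 'X^m) => u _; rewrite hornerXn.
  by rewrite expf_neq0 // mulf_neq0 // modc1_neq0.
have [CW CW0 hCW] := urat_bounded Wu.
have th1 : t / rho < 1 by rewrite ltr_pdivrMr // mul1r.
have th0 : 0 <= t / rho by rewrite divr_ge0 // ltW.
have geo u k : modc u = 1 -> _ := fun u1 =>
  geometric_remainder k (circle_stepV t%:C u1) (eq_ind_r (fun x => x / rho < 1) th1 mt).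
have mean0 n : umean (fun u => t%:C ^+ n * (W u * V u ^+ n)) 0.
  have n1 : (n.+1%:R : R[i]) != 0 by rewrite pnatr_eq0.
  rewrite -[0](mulr0 (t%:C ^+ n / n.+1%:R)).
  apply: eq_umean (umeanZ _ (umean_theta_laurent (Q ^+ n.+1) (m * n.+1) tau_gt0)) => u u1.
  have yn : (tau%:C * u) ^+ m != 0 by rewrite expf_neq0 // mulf_neq0 // modc1_neq0.
  rewrite VE // /W deriv_exp /= hornerMn hornerM !horner_exp exprM natrM expr_div_n.
  rewrite -[(_ * _) *+ n.+1]mulr_natl !exprS.
  have yn' : ((tau%:C * u) ^+ m) ^+ n != 0 by rewrite expf_neq0.
  move: (n.+1%:R) n1 => kk n1.
  by field; rewrite n1 yn yn'.
have mean1 : umean (fun u => W u / (1 - t%:C * V u)) ((m%:R - N%:R) / t%:C).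
  rewrite mulrC; apply: eq_umean (umeanZ _ (umeanB (umean_cst m%:R) hN)) => u u1.
  have yn : (tau%:C * u) ^+ m != 0 by rewrite expf_neq0 // mulf_neq0 // modc1_neq0.
  have yn1 : tau%:C * u != 0 by rewrite mulf_neq0 // modc1_neq0.
  have := Pn u u1; rewrite VE // /W kernel_polyE derivB derivZ derivXn.
  rewrite !hornerD !hornerN !hornerZ hornerMn !hornerXn.
  have mE : tau%:C * u * ((tau%:C * u) ^+ m.-1 *+ m) = m%:R * (tau%:C * u) ^+ m.
    by rewrite mulrnAr -exprS prednK ?minv_gt0 // mulr_natl.
  move: (tau%:C * u) yn yn1 mE => x yn yn1 mE nz.
  rewrite [x * (_ / _)]mulrA [x * (_ - _)]mulrBr mE.
  by field; rewrite nz yn tC.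
have C10 : 0 <= CW * (1 - t / rho)^-1.
  by rewrite mulr_ge0 // invr_ge0 subr_ge0 ltW.
have th01 : 0 <= t / rho < 1 by rewrite th0.
have rem k u : modc u = 1 -> modc (W u / (1 - t%:C * V u) -
    \sum_(0 <= n < k) t%:C ^+ n * (W u * V u ^+ n)) <= CW * (1 - t / rho)^-1 * (t / rho) ^+ k.
  move=> u1; have [nz h] := geo u k u1; rewrite mt in h.
  have -> : W u / (1 - t%:C * V u) - \sum_(0 <= n < k) t%:C ^+ n * (W u * V u ^+ n) =
      W u * ((1 - t%:C * V u)^-1 - \sum_(0 <= n < k) (t%:C * V u) ^+ n).
    rewrite [RHS]mulrBr [X in _ = _ - X]mulr_sumr; congr (_ - _).
    by apply: eq_bigr => n _; rewrite exprMn mulrCA.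
  by rewrite modcM -mulrA ler_pM ?modc_ge0 ?hCW.
have /cvg_modcP cv := umean_series C10 th01 rem mean0 mean1.
have : (m%:R - N%:R) / t%:C = 0 :> R[i].
  apply: modc_eps => e /cv[k0 /(_ k0 (leqnn _))].
  by rewrite /series /= big1_eq subr0.
move/eqP; rewrite mulf_eq0 invr_eq0 (negbTE tC) orbF subr_eq0 eqr_nat => /eqP.
by move=> ->.
Qed.

(** Divisibility supplies [m] roots counted with multiplicity, all inside by [branch_inside]; the
    count being exactly [m], the cofactor has no root in the disc. *)
Lemma inner_root_is_branch (t : R) z : 0 < t < rho -> root (P t%:C) z ->
  modc z < tau -> exists2 k, (1 <= k <= m)%N & z = y k t.
Proof.
move=> tr zr zt; have [t0 _] := andP tr.
have Pn := kernel_neq0 (realC_neq0 t0).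
pose ys := [seq y k t | k <- index_iota 1 m.+1].
have kin k : (k \in index_iota 1 m.+1) = (1 <= k <= m)%N by rewrite mem_index_iota ltnS.
case: y_small => _ _ _ /(_ t (ltW_itv tr)) dv.
have [W WE] : exists W, P t%:C = W * \prod_(w <- ys) ('X - w%:P).
  by exists (P t%:C %/ \prod_(w <- ys) ('X - w%:P)); rewrite divpK // /ys big_map.
have W0 : W != 0 by apply: contraNneq Pn => W0; rewrite WE W0 mul0r.
have [rs rsE] := closed_field_poly_normal W.
have lc0 : lead_coef W != 0 by rewrite lead_coef_eq0.
have PE : P t%:C = lead_coef W *: \prod_(w <- ys ++ rs) ('X - w%:P).
  by rewrite WE {1}rsE big_cat /= -scalerAl mulrC.
have := inner_root_count tr lc0 PE; rewrite count_cat.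
have -> : count (fun w => modc w < tau) ys = m.
  rewrite -[RHS](size_iota 1 m); have -> : iota 1 m = index_iota 1 m.+1 by rewrite /index_iota subSS subn0.
  rewrite -(size_map (fun k => y k t)) -/ys; apply/eqP; rewrite -all_count.
  by apply/allP => w /mapP[k]; rewrite kin => km ->; apply: branch_inside.
move=> /eqP; rewrite -[X in _ == X]addn0 eqn_add2l => /eqP/eqP.
rewrite -leqn0 leqNgt -has_count => /hasPn out.
move: zr; rewrite PE rootZ // root_prod_XsubC mem_cat => /orP[/mapP[k]|zrs].
  by rewrite kin => km ->; exists k.
by have := out z zrs; rewrite zt.
Qed.

Lemma Im_le_modc (z : R[i]) : `|complex.Im z| <= modc z.
Proof.
rewrite -(@ler_pXn2r _ 2) ?nnegrE ?modc_ge0 // modc_Re2Im2 real_normK ?num_real //.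
by rewrite lerDr sqr_ge0.
Qed.

Lemma complex_gt0P (z : R[i]) : reflect (exists2 x : R, 0 < x & z = x%:C) (0 < z).
Proof.
apply: (iffP idP) => [|[x x0 ->]]; last by rewrite ltcR.
by case: z => a b; rewrite ltcE /= => /andP[/eqP -> a0]; exists a.
Qed.

Lemma limit_of_positives (z : R[i]) : z != 0 ->
  (forall e : R, 0 < e -> exists2 w : R[i], 0 < w & modc (w - z) < e) -> 0 < z.
Proof.
move=> z0 h.
have Im0 : complex.Im z = 0.
  apply/eqP; rewrite -normr_eq0; apply/eqP/le_anti; rewrite normr_ge0 andbT.
  apply: le0_of_eps => e /h[w /complex_gt0P[x _ ->]] wz.
  apply: ltW; apply: le_lt_trans wz; apply: le_trans (Im_le_modc _).
  by case: (z) => a b /=; rewrite sub0r normrN.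
have Re0 : 0 <= complex.Re z.
  rewrite -oppr_le0; apply: le0_of_eps => e /h[w /complex_gt0P[x x0 ->]] wz.
  have := Re_le_modc (x%:C - z); have -> : complex.Re (x%:C - z) = x - complex.Re z.
    by case: (z).
  by rewrite ler_norml => /andP[_]; lra.
rewrite ltcE /= Im0 eqxx /= lt_neqAle Re0 andbT eq_sym; apply: contra_neq z0.
by case: z Im0 {h Re0} => a b /= -> ->.
Qed.

Lemma conj_kernel (t : R) z : root (P t%:C) z -> root (P t%:C) (conjc z).
Proof.
rewrite -complex_root_conj; suff -> : map_poly conjc (P t%:C) = P t%:C by [].
rewrite -map_kernel -map_poly_comp; apply: eq_map_poly => x /=.
by rewrite oppr0.
Qed.

Lemma simple_root_real (t x : R) : 0 < t < rho -> 0 < x < tau -> root (P t%:C) x%:C ->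
  (P t%:C)^`().[x%:C] != 0.
Proof.
move=> /andP[t0 _] xt; rewrite rootE kernel_real => /eqP E.
have E0 : (kernel_poly S t).[x] = 0 by apply: complexI.
rewrite -map_kernel deriv_map horner_map /=.
by rewrite realC_neq0 // (kernel_deriv_gt0 S_neg tau_gt0 tau_crit t0 xt E0).
Qed.

(** Openness: near a simple positive root the perturbed kernel has at most one root, and the
    conjugate of [y 1] would be another one unless [y 1] is real. Closedness: a limit of positive
    numbers is positive unless it is 0, which a branch avoids. *)
Lemma first_branch_gt0 (t : R) : 0 < t < rho -> 0 < y 1%N t.
Proof.
have m1 : (1 <= 1 <= m)%N by rewrite minv_gt0.
move: t; apply: real_induction.
have := y_first; rewrite /principal_first near_withinE => /nbhs_ballP[d /= d0 h].
  exists d => // t /andP[t0 td] _; apply: h => //.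
  by rewrite /ball /= sub0r normrN gtr0_norm.
move=> t tr /complex_gt0P[x x0 xE].
  have xt : 0 < x < tau.
    by rewrite x0 /= -(modc_real (ltW x0)) -xE branch_inside.
  have Px : root (P t%:C) x%:C by rewrite -xE branch_root // ltW_itv.
  have [d1 d10 uniq_root] := simple_root_unique Q Px (simple_root_real tr xt Px).
  have e0 : 0 < Num.min x d1 by rewrite lt_min x0.
  have [d d0 h] := branch_continuous m1 (ltW_itv tr) e0.
  exists (Num.min d d1); first by rewrite lt_min d0.
  move=> t' tr'; rewrite lt_min => /andP[td1 td2].
  have := h t' (ltW_itv tr') td1; rewrite xE lt_min; set z := y 1%N t'.
  move=> /andP[zx zd].
  have PE : P t%:C + (t%:C - t'%:C) *: Q = P t'%:C.
    by rewrite !kernel_polyE scalerBl addrA subrK.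
  have zr : root (P t'%:C) z by rewrite branch_root // ltW_itv.
  have zz : z = conjc z.
    apply: (uniq_root (t%:C - t'%:C)); rewrite ?PE //; last exact: conj_kernel.
      rewrite -rmorphB /= -modcN -rmorphN /= opprB.
      have [le|lt] := lerP 0 (t' - t); first by rewrite modc_real // -[X in X < _]ger0_norm.
      by rewrite -modcN -rmorphN /= modc_real ?oppr_ge0 ?(ltW lt) // -[X in X < _]ltr0_norm.
    have -> : conjc z - x%:C = conjc (z - x%:C).
      by case: (z) => a b /=; congr (_ +i* _); rewrite oppr0 !addr0.
    by rewrite modc_conj.
  have zre : z = (complex.Re z)%:C.
    move: zz; case: (z) => a b /= [] h'.
    by congr (_ +i* _); lra.
  have := Re_le_modc (z - x%:C); have -> : complex.Re (z - x%:C) = complex.Re z - x.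
    by case: (z).
  rewrite ler_norml => /andP[lo _].
  by rewrite zre ltcR; lra.
move=> t tr h; apply: limit_of_positives => [|e e0].
    by rewrite branch_neq0 // ltW_itv.
  have [d d0 hd] := branch_continuous m1 (ltW_itv tr) e0.
  have [t' [tr' td pos]] := h d d0; exists (y 1%N t') => //.
  by apply: hd => //; apply: ltW_itv.
Qed.

Lemma near_rho (d : R) : 0 < d -> exists t : R, [/\ 0 < t < rho, `|t - rho| < d & rho / 2 <= t].
Proof.
move=> d0; exists (rho - Num.min (d / 2) (rho / 2)).
have m1 : Num.min (d / 2) (rho / 2) <= d / 2 by rewrite ge_min lexx.
have m2 : Num.min (d / 2) (rho / 2) <= rho / 2 by rewrite ge_min lexx orbT.
have m3 : 0 < Num.min (d / 2) (rho / 2) by rewrite lt_min !divr_gt0.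
split; [by apply/andP; split; lra| |lra].
by rewrite ler0_norm; lra.
Qed.

Lemma rho_itv : 0 < rho <= rho. Proof. by rewrite rho0 lexx. Qed.

Lemma first_branch_end : y 1%N rho = tau%:C.
Proof.
have m1 : (1 <= 1 <= m)%N by rewrite minv_gt0.
have /complex_gt0P[x x0 xE] : 0 < y 1%N rho.
  apply: limit_of_positives => [|e e0]; first by rewrite branch_neq0 // rho_itv.
  have [d d0 hd] := branch_continuous m1 rho_itv e0.
  have [t [tr td _]] := near_rho d0; exists (y 1%N t); first exact: first_branch_gt0.
  by apply: hd => //; apply: ltW_itv.
have := branch_root m1 rho_itv; rewrite xE rootE kernel_real => /eqP E.
by congr _%:C; apply: (kernel_rho_positive_root S_neg tau_gt0 tau_crit rhoE x0); apply: complexI.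
Qed.

Lemma branch_end_le k : (1 <= k <= m)%N -> modc (y k rho) <= tau.
Proof.
move=> km; rewrite -subr_le0; apply: le0_of_eps => e e0.
have [d d0 hd] := branch_continuous km rho_itv e0.
have [t [tr td _]] := near_rho d0; have := hd t (ltW_itv tr) td.
have := branch_inside km tr; have := ler_modcB (y k t) (y k t - y k rho).
by rewrite opprB addrC subrK; lra.
Qed.

(** If the two branches met, the divisibility condition would make the common value a double root,
    against [simple_root_real]. *)
Lemma branches_distinct_first k (t : R) : (2 <= k <= m)%N -> 0 < t < rho -> y k t != y 1%N t.
Proof.
move=> /andP[k2 km] tr; apply/eqP => E.
have m1 : (1 <= 1 <= m)%N by rewrite minv_gt0.
have /complex_gt0P[x x0 xE] := first_branch_gt0 tr.
have xt : 0 < x < tau by rewrite x0 /= -(modc_real (ltW x0)) -xE branch_inside.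
have Px : root (P t%:C) x%:C by rewrite -xE branch_root // ltW_itv.
have := simple_root_real tr xt Px.
case: y_small => _ _ _ /(_ t (ltW_itv tr)) /dvdpP[W ->].
rewrite (bigD1_seq 1%N) ?iota_uniq ?mem_index_iota //= -big_filter.
rewrite (bigD1_seq k) ?filter_uniq ?iota_uniq ?mem_filter //=; last first.
by rewrite mem_index_iota ltnS km (ltnW k2) gtn_eqF.
set B := \big[_/_]_(_ <- _ | _) _.
rewrite E xE => /negP; apply.
have -> : W * (('X - x%:C%:P) * (('X - x%:C%:P) * B)) = W * B * ('X - x%:C%:P) * ('X - x%:C%:P).
  by ring.
rewrite derivM derivXsubC mulr1 hornerD hornerM [(W * B * _).[_]]hornerM hornerXsubC.
by rewrite subrr !mulr0 addr0.
Qed.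

(** The only root of [P_rho] on the circle is [tau]. A branch ending there would, just before [rho],
    lie in the annulus of [unique_root_near_circle] together with [y 1]. *)
Lemma other_branch_end k : (2 <= k <= m)%N -> modc (y k rho) < tau.
Proof.
move=> km; have [k2 k3] := andP km.
have km1 : (1 <= k <= m)%N by rewrite (ltnW k2).
have m1 : (1 <= 1 <= m)%N by rewrite minv_gt0.
rewrite lt_neqAle branch_end_le // andbT; apply/eqP => kt.
have Ek := kernel_circle_root S_neg tau_gt0 rhoE S_aper kt (branch_root km1 rho_itv).
have [H [h0 [h00 Ht PE]]] := kernel_double_root S_neg tau_gt0 tau_crit rhoE.
have Qt : rho%:C * Q.[tau%:C] = tau%:C ^+ m.
  by rewrite stepQ_real -rmorphM /= (stepQ_tau S_neg tau_gt0 rhoE) rmorphXn.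
have [e [r [e0 r0 U]]] := unique_root_near_circle tau_gt0 rho0 h00 Qt Ht PE
   (fun y' => kernel_circle_root S_neg tau_gt0 rhoE S_aper (y := y')).
have [d1 d10 hd1] := branch_continuous km1 rho_itv e0.
have [d2 d20 hd2] := branch_continuous m1 rho_itv e0.
have dd : 0 < Num.min r (Num.min d1 d2) by rewrite !lt_min r0 d10.
have [t [tr]] := near_rho dd; rewrite !lt_min => /and3P[tr1 td1 td2] _.
have [t0 t1] := andP tr; have tr' := ltW_itv tr.
have := branches_distinct_first km tr; move/eqP; apply.
apply: (U t%:C).
by rewrite modc_real // ltW.
rewrite -rmorphB /= modc_real ?subr_ge0 ?(ltW t1) //.
  by move: tr1; rewrite ltr0_norm ?subr_lt0 // opprB.
exact: branch_root.
exact: branch_root.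
rewrite branch_inside // andbT; have := hd1 t tr' td1; rewrite Ek.
  have := ler_modcB (y k t) (y k t - tau%:C); rewrite opprB addrC subrK.
  by rewrite (modc_real (ltW tau_gt0)); lra.
rewrite branch_inside // andbT; have := hd2 t tr' td2; rewrite first_branch_end.
  have := ler_modcB (y 1%N t) (y 1%N t - tau%:C); rewrite opprB addrC subrK.
  by rewrite (modc_real (ltW tau_gt0)); lra.
Qed.

(** A positive step makes the degree of [Q] exceed [m], so the degree of [P t] does not depend on
    [t != 0] and its leading coefficient is [- t] times that of [Q]. This makes [root_near] uniform
    near [rho]. *)
Lemma stepQ_size : (m.+1 < size Q)%N.
Proof.
have [v vS v0] := S_pos; have sv : (m < shifted S v)%N.
  by rewrite -ltz_nat shiftedE // ltrDr.
apply: leq_ltn_trans sv _; rewrite ltnNge; apply/negP => /leq_sizeP /(_ _ (leqnn _)).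
rewrite coef_sum; under eq_bigr do rewrite coefXn.
rewrite -natr_sum => /eqP; rewrite pnatr_eq0 (bigD1_seq v) ?fset_uniq //= eqxx.
by [].
Qed.

(** Otherwise all branches would stay away from [z] near [rho], although [P t] has a root close to
    [z], which is in the disc and hence on a branch. The index 1 is excluded as [y 1] ends on the
    circle. *)
Lemma inner_root_end z : root (P rho%:C) z -> modc z < tau ->
  exists2 k, (2 <= k <= m)%N & z = y k rho.
Proof.
move=> zr zt.
suff [k km zE] : exists2 k, (1 <= k <= m)%N & z = y k rho.
  exists k => //; case/andP: km => k1 km; rewrite km andbT.
  case: k k1 zE {km} => [//|[|//]] _ zE.
  by move: zt; rewrite zE first_branch_end modc_real ?ltxx // ltW.
apply/not_exists2P => far; pose ks := index_iota 1 m.+1.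
have kin k : (k \in ks) = (1 <= k <= m)%N by rewrite mem_index_iota ltnS.
have [e [d [e0 d0 he]]] : exists e d : R, [/\ 0 < e, 0 < d & forall k, k \in ks ->
    forall t, 0 < t <= rho -> `|t - rho| < d -> e <= modc (z - y k t)].
  have : forall k, k \in ks -> (1 <= k <= m)%N by move=> k; rewrite kin.
  elim: ks {kin} => [|k s ih] kin; first by exists 1, 1; split.
  have [|e1 [d1 [e10 d10 h1]]] := ih; first by move=> j js; apply: kin; rewrite inE js orbT.
  have km := kin k (mem_head _ _).
  have zk : 0 < modc (z - y k rho).
    rewrite modc_gt0 subr_eq0; apply/eqP => zk; have [/(_ km)|/(_ zk)] := far k; by [].
  have z2 : 0 < modc (z - y k rho) / 2 by rewrite divr_gt0.
  have [d2 d20 h2] := branch_continuous km rho_itv z2.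
  exists (Num.min e1 (modc (z - y k rho) / 2)), (Num.min d1 d2); split.
  by rewrite lt_min e10.
  by rewrite lt_min d10.
  move=> j; rewrite inE => /orP[/eqP ->|js] t tr; rewrite lt_min => /andP[td1 td2].
      rewrite ge_min; apply/orP; right.
      have := h2 t tr td2; have := ler_modcD (z - y k t) (y k t - y k rho).
      by rewrite addrA subrK; lra.
    by rewrite ge_min h1.
pose e' := Num.min e (tau - modc z).
have e'0 : 0 < e' by rewrite lt_min e0 subr_gt0.
have lcQ : 0 < modc (lead_coef Q).
  rewrite modc_gt0 lead_coef_eq0 -size_poly_gt0.
  exact: leq_trans stepQ_size.
(* A lower bound, valid for all [t >= rho / 2], of the threshold in [root_near]. *)
pose A := rho / 2 * modc (lead_coef Q) * e' ^+ (size Q).-1.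
have A0 : 0 < A by rewrite !mulr_gt0 ?exprn_gt0 ?divr_gt0.
have Qz0 : 0 < modc Q.[z] + 1 by have := modc_ge0 Q.[z]; lra.
have dd : 0 < Num.min d (A / (modc Q.[z] + 1)) by rewrite lt_min d0 divr_gt0.
have [t [tr]] := near_rho dd; rewrite lt_min => /andP[td1 td2] t2.
have [t0 t1] := andP tr; have tC := realC_neq0 t0.
have sz : size (P t%:C) = size Q /\ lead_coef (P t%:C) = - (t%:C * lead_coef Q).
  have lt : (size ('X^m : {poly R[i]}) < size (- (t%:C *: Q)))%N.
    by rewrite size_polyXn size_polyN size_scale // stepQ_size.
  rewrite kernel_polyE addrC size_polyDl // lead_coefDl // size_polyN size_scale //.
  by rewrite lead_coefN lead_coefZ.
have [w wr wz] : exists2 w, root (P t%:C) w & modc (z - w) < e'.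
  apply: root_near => //; first exact: kernel_neq0.
  rewrite sz.1 sz.2 modcN modcM (modc_real (ltW t0)).
  have -> : (P t%:C).[z] = (P rho%:C).[z] + (rho%:C - t%:C) * Q.[z].
    by rewrite !kernel_polyE !hornerE; ring.
  rewrite (eqP zr) add0r modcM -rmorphB /= modc_real ?subr_ge0 ?(ltW t1) //.
  apply: (@lt_le_trans _ _ A).
    move: td2; rewrite ltr0_norm ?subr_lt0 // opprB ltr_pdivlMr //.
    by apply: le_lt_trans; rewrite ler_pM2l ?subr_gt0 // lerDl.
  by rewrite /A ler_pM2r ?exprn_gt0 // ler_pM2r.
have wt : modc w < tau.
  have := ler_modcB z (z - w); rewrite opprB addrC subrK.
  by move: wz; rewrite lt_min => /andP[_]; lra.
have [k km wk] := inner_root_is_branch tr wr wt.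
have := he k; rewrite kin => /(_ km t (ltW_itv tr) td1); rewrite -wk.
by move: wz; rewrite lt_min => /andP[+ _]; lra.
Qed.

End SmallBranches.

(** * The singular expansion of the bridge series and its constant term *)

Theorem theorem8 (R : realType) (S : {fset int}) (tau rho : R)
    (y : nat -> R -> R[i])
    (S_neg : exists2 v, v \in S & v < 0)
    (S_pos : exists2 v, v \in S & 0 < v)
    (S_aper : aperiodic S)
    (tau_gt0 : 0 < tau)
    (tau_crit : derive1 (fun x : R => stepV S x) tau = 0)
    (rhoE : rho = (stepV S tau)^-1)
    (y_small : small_branches S rho y)
    (y_first : principal_first y) :
  let F (z : R[i]) := (z * (1 - rho%:C * stepV S z))^-1 in
  let taus := [seq y k rho | k <- index_iota 2 (minv S).+1] in
  exists a : int -> R[i],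
    sqrt_expansion (fun t => bridge_gf S t) rho a /\
    a 0 = 2^-1 * residue F tau%:C + \sum_(z <- undup taus) residue F z.
Proof.
move=> F taus; have rho0 := rho_gt0 S_neg tau_gt0 rhoE.
have m_gt0 := minv_gt0 S_neg.
have [H [h0 [h00 Ht PE]]] := kernel_double_root S_neg tau_gt0 tau_crit rhoE.
have Qt : rho%:C * (stepQ S R[i]).[tau%:C] = tau%:C ^+ minv S.
  by rewrite stepQ_real -rmorphM /= (stepQ_tau S_neg tau_gt0 rhoE) rmorphXn.
have [a [[r r0 aE] a0E]] := mean_expansion m_gt0 tau_gt0 rho0 h00 Qt Ht PE
  (fun t z => kernel_circle_neq0 S_neg tau_gt0 rhoE (t := t) (y := z))
  (fun z => kernel_circle_root S_neg tau_gt0 rhoE S_aper (y := z)).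
exists a; split.
  exists r => // t; rewrite -!modcE !ltcR => tr tr'; apply: aE => //.
  pose V u := stepV S (tau%:C * u).
  have tauC : tau%:C != 0 := realC_neq0 tau_gt0.
  have th1 : modc t / rho < 1 by rewrite ltr_pdivrMr // mul1r.
  have th01 : 0 <= modc t / rho < 1 by rewrite th1 divr_ge0 ?modc_ge0 // ltW.
  have geo u k : modc u = 1 -> _ := fun u1 =>
    geometric_remainder k (circle_stepV S_neg tau_gt0 rhoE t u1) th1.
  have ur : urat (fun u => (tau%:C * u) ^+ minv S / (kernel_poly S t).[tau%:C * u]).
    have af (w : {poly R[i]}) : urat (fun u => w.[tau%:C * u]).
      by apply: eq_urat (urat_affine w 0 tau%:C) => u _; rewrite add0r.
    apply: uratM; first by apply: eq_urat (af 'X^(minv S)) => u _; rewrite hornerXn.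
    apply: uratV => // u u1; apply: (kernel_circle_neq0 S_neg tau_gt0 rhoE) => //.
    by rewrite modcM u1 mulr1 modc_real // ltW.
  have [v vm] := urat_mean ur.
  have VE u : modc u = 1 -> (tau%:C * u) ^+ minv S / (kernel_poly S t).[tau%:C * u] =
      (1 - t * V u)^-1.
    move=> u1; have yn : tau%:C * u != 0 by rewrite mulf_neq0 // modc1_neq0.
    by rewrite /V (stepV_kernel S t yn) invf_div.
  suff -> : bridge_gf S t = v by [].
  apply: cvg_lim => //.
  have C0 : 0 <= (1 - modc t / rho)^-1 by rewrite invr_ge0 subr_ge0 ltW.
  apply: (umean_series (kap := fun n u => (t * V u) ^+ n) C0 th01 _ _ vm).
    by move=> k u u1; rewrite VE //; have [_] := geo u k u1.
  move=> n; rewrite mulrC; apply: eq_umean (umeanZ (t ^+ n) (bridges_mean S tau_gt0 n)).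
  by move=> u _; rewrite exprMn.
have P0 : kernel_poly S rho%:C != 0 := kernel_neq0 S_neg (realC_neq0 rho0).
have [c hc] := rational_means 'X^((minv S).-1) P0.
have resE z : z != 0 -> root (kernel_poly S rho%:C) z -> residue F z = c z.
  move=> z0 zr; have mz0 : 0 < modc z by rewrite modc_gt0.
  (* [F] is identified with [w^(m-1) / P_rho] for [w != 0], which the radius [|z|] ensures. *)
  apply: (residue_weightE P0 zr mz0 _ hc) => w /andP[_ wz].
  have w0 : w != 0.
    by apply: contraTneq wz => ->; rewrite sub0r modcN ltxx.
  rewrite /F (stepV_kernel S _ w0) hornerXn.
  rewrite -[in X in _ / X](prednK m_gt0) exprS invfM invf_div.
  by rewrite mulrA; congr (_ / _); rewrite mulrA mulVf // mul1r.
rewrite (a0E c hc) resE; first last.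
by rewrite rootE kernel_real (kernel_rho_tau S_neg tau_gt0 rhoE).
exact: realC_neq0.
congr (_ + _); rewrite -big_filter.
(* Both lists contain each root of [P_rho] in the disc once. Branches that meet at [rho] are counted
   once, since the residue there already involves the whole multiplicity. *)
have tausP z : (z \in undup taus) =
    (z \in [seq z <- croots (kernel_poly S rho%:C) | modc z < tau]).
  rewrite mem_undup mem_filter mem_croots //; apply/mapP/andP => [[k]|[zt zr]].
    rewrite mem_index_iota ltnS => km ->; have [k2 k3] := andP km.
    split; first exact: (other_branch_end S_neg S_aper tau_gt0 tau_crit rhoE y_small y_first).
    apply: (branch_root y_small); first by rewrite (ltnW k2).
    by rewrite rho0 lexx.
  have [k km ->] := inner_root_end S_neg S_pos tau_gt0 tau_crit rhoE y_small y_first zr zt.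
  by exists k => //; rewrite mem_index_iota ltnS.
rewrite (perm_big (undup taus)) /=; last first.
  by apply: uniq_perm => [||z]; rewrite ?tausP ?undup_uniq ?filter_uniq ?croots_uniq.
rewrite big_seq [RHS]big_seq; apply: eq_bigr => z; rewrite tausP mem_filter mem_croots //.
move=> /andP[_ zr]; rewrite resE //; apply: contraTneq zr => ->.
by rewrite rootE kernel_poly_0 // oppr_eq0 realC_neq0.
Qed.
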